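(* Let $\mathcal{G}$ be an ind-group over $\mathbb{C}$, let $T \subseteq \mathcal{G}$ be a closed torus, and let $\theta \colon \mathcal{G} \to \mathcal{G}$ be an abstract group automorphism (no compatibility with the ind-structure is assumed) such that $\theta(t) = t$ for all $t \in T$. Let $\mathcal{U} \subseteq \mathcal{G}$ be a unipotent ind-subgroup that is normalized by $T$, and suppose that the neutral element is the only element $u \in \mathcal{U}$ satisfying $t u t^{-1} = u$ for all $t \in T$. Then $\theta(\mathcal{U})$ is a unipotent ind-subgroup of $\mathcal{G}$, and $\theta|_{\mathcal{U}} \colon \mathcal{U} \to \theta(\mathcal{U})$ is an isomorphism of ind-groups.
   Context: All varieties are over $\mathbb{C}$; varieties need not be irreducible. Ind-groups. An ind-variety is a set $\mathcal{V}$ with a filtration $V_1 \subseteq V_2 \subseteq \dots$ by affine varieties, each closed in the next, with $\mathcal{V} = \bigcup_i V_i$; one writes $\mathcal{V} = \varinjlim V_i$. A map $f \colon \varinjlim V_i \to \varinjlim W_j$ is a morphism of ind-varieties if for every $i$ there is $j$ such that $f(V_i) \subseteq W_j$ and $f|_{V_i} \colon V_i \to W_j$ is a morphism of varieties. Two filtrations of the same set define the same ind-structure if the identity map is a morphism in both directions. The product of ind-varieties is filtered by $V_i \times W_i$. A group $\mathcal{G}$ is an ind-group if it is an ind-variety $\mathcal{G} = \varinjlim G_i$ such that $\mathcal{G} \times \mathcal{G} \to \mathcal{G}$, $(x,y) \mapsto x y^{-1}$, is a morphism of ind-varieties. An isomorphism of ind-groups is a group isomorphism such that it and its inverse are morphisms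 of ind-varieties. A subset $X \subseteq \mathcal{G} = \varinjlim G_i$ is closed if $X \cap G_i$ is Zariski closed in $G_i$ for every $i$. Ind-subgroups. A subgroup $\mathcal{H}$ of an ind-group $\mathcal{G} = \varinjlim G_i$ is an ind-subgroup if $\mathcal{H}$ can be turned into an ind-group $\mathcal{H} = \varinjlim H_k$ such that for every $k$ there is $i = i(k)$ for which $H_k \subseteq G_i$ is a closed subvariety. The ind-structure on $\mathcal{H}$ is then unique. (An ind-subgroup is not required to be closed in $\mathcal{G}$.) A subgroup $\mathcal{H}$ is an algebraic subgroup of $\mathcal{G}$ if it is closed in $\mathcal{G}$ and contained in some $G_i$; it is then an affine algebraic group. A closed torus in $\mathcal{G}$ is an algebraic subgroup of $\mathcal{G}$ isomorphic, as an algebraic group, to $(\mathbb{C}^\ast)^n$ for some $n$. Unipotent ind-groups. An ind-group $\mathcal{U}$ is unipotent if its ind-structure can be given by a filtration $\mathcal{U} = \varinjlim U_i$ in which every $U_i$ is a unipotent algebraic group. A unipotent ind-subgroup is an ind-subgroup that is a unipotent ind-group. *)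

(* Defs.v *)
From HB Require Import structures.
From mathcomp Require Import all_boot all_order all_algebra.
From mathcomp Require Import complex mpoly.
From mathcomp Require Import boolp classical_sets reals.

Set Implicit Arguments.
Unset Strict Implicit.
Unset Printing Implicit Defensive.

Import GRing.Theory.

Local Open Scope ring_scope.
Local Open Scope classical_set_scope.

(* The complex numbers are R[i] for R : realType. *)

Definition zariski_closed (R : realType) (n : nat) (Z : set 'rV[R[i]]_n) :=
  exists S : set {mpoly R[i][n]},
    Z = [set v | forall p, S p -> p.@[v 0] = 0].

(* An affine variety whose points are the elements of a subset [pts] of T: the
   coordinates identify [pts] with a Zariski closed subset of C^n. The
   coordinates are only a presentation (varieties are always compared by means
   of [var_morphism]), and their values outside [pts] are irrelevant. *)
Record affineVariety (R : realType) (T : Type) := AffineVariety {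
  pts : set T;
  vdim : nat;
  coord : T -> 'rV[R[i]]_vdim;
  coord_inj : forall x y, pts x -> pts y -> coord x = coord y -> x = y;
  coord_closed : zariski_closed (coord @` pts)
}.

(* f is a total function, but only its restriction to X matters. *)
Definition var_morphism (R : realType) (T1 T2 : Type)
    (X : affineVariety R T1) (Y : affineVariety R T2) (f : T1 -> T2) :=
  (forall x, pts X x -> pts Y (f x)) /\
  exists P : 'I_(vdim Y) -> {mpoly R[i][vdim X]},
    forall x, pts X x -> forall j, coord Y (f x) 0 j = (P j).@[coord X x 0].

Definition var_isomorphism (R : realType) (T1 T2 : Type)
    (X : affineVariety R T1) (Y : affineVariety R T2) (f : T1 -> T2) :=
  var_morphism X Y f /\
  exists g : T2 -> T1, [/\ var_morphism Y X g,
    forall x, pts X x -> g (f x) = x & forall y, pts Y y -> f (g y) = y].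

Definition var_closed (R : realType) (T : Type) (X : affineVariety R T)
    (A : set T) :=
  A `<=` pts X /\ zariski_closed (coord X @` A).

(* X is a closed subset of Y whose structure of variety is the induced one:
   the coordinates of X and Y are polynomials in each other on X. *)
Definition closed_subvariety (R : realType) (T : Type)
    (X Y : affineVariety R T) :=
  [/\ var_closed Y (pts X), var_morphism X Y id &
    exists P : 'I_(vdim X) -> {mpoly R[i][vdim Y]},
      forall x, pts X x -> forall j, coord X x 0 j = (P j).@[coord Y x 0]].

Section Product.
Variables (R : realType) (T1 T2 : Type).
Variables (X : affineVariety R T1) (Y : affineVariety R T2).

Let pcoord (z : T1 * T2) : 'rV[R[i]]_(vdim X + vdim Y) :=
  row_mx (coord X z.1) (coord Y z.2).

Definition mpoly_l m n (p : {mpoly R[i][m]}) : {mpoly R[i][m + n]} :=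
  p \mPo [tuple 'X_(lshift n i) | i < m].

Definition mpoly_r m n (p : {mpoly R[i][n]}) : {mpoly R[i][m + n]} :=
  p \mPo [tuple 'X_(rshift m i) | i < n].

Lemma mpoly_lE m n (p : {mpoly R[i][m]}) (v : 'rV_(m + n)) :
  (mpoly_l n p).@[v 0] = p.@[lsubmx v 0].
Proof.
rewrite comp_mpoly_meval; apply: meval_eq => i.
by rewrite tnth_mktuple mevalXU mxE.
Qed.

Lemma mpoly_rE m n (p : {mpoly R[i][n]}) (v : 'rV_(m + n)) :
  (mpoly_r m p).@[v 0] = p.@[rsubmx v 0].
Proof.
rewrite comp_mpoly_meval; apply: meval_eq => i.
by rewrite tnth_mktuple mevalXU mxE.
Qed.

Lemma prod_coord_inj z w : (pts X `*` pts Y) z -> (pts X `*` pts Y) w ->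
  pcoord z = pcoord w -> z = w.
Proof.
case: z w => [x y] [x' y'] [/= Xx Yy] [/= Xx' Yy'] /eq_row_mx [ex ey].
by rewrite (coord_inj Xx Xx' ex) (coord_inj Yy Yy' ey).
Qed.

Lemma zariski_closedX (A : set T1) (B : set T2) :
  zariski_closed (coord X @` A) -> zariski_closed (coord Y @` B) ->
  zariski_closed (pcoord @` (A `*` B)).
Proof.
move=> [S1 E1] [S2 E2].
exists ([set p | exists2 q, S1 q & p = mpoly_l _ q] `|`
        [set p | exists2 q, S2 q & p = mpoly_r _ q]).
apply/seteqP; split=> [_ [[x y] [/= Ax By] <-] p|v /= Sv].
  move=> [] [q Sq ->].
    rewrite mpoly_lE row_mxKl.
    have : (coord X @` A) (coord X x) by exists x.
    by rewrite E1; apply.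
  rewrite mpoly_rE row_mxKr.
  have : (coord Y @` B) (coord Y y) by exists y.
  by rewrite E2; apply.
have : (coord X @` A) (lsubmx v).
  by rewrite E1 => q Sq; rewrite -mpoly_lE; apply: Sv; left; exists q.
have : (coord Y @` B) (rsubmx v).
  by rewrite E2 => q Sq; rewrite -mpoly_rE; apply: Sv; right; exists q.
move=> [y By Ey] [x Ax Ex]; exists (x, y) => //.
by rewrite /pcoord /= Ex Ey hsubmxK.
Qed.

Definition prod_variety : affineVariety R (T1 * T2) :=
  AffineVariety prod_coord_inj
    (zariski_closedX (coord_closed X) (coord_closed Y)).

End Product.

Section GeneralLinear.
Variables (R : realType) (n : nat).

Let glcoord (A : 'M[R[i]]_n) : 'rV[R[i]]_(n * n + 1) :=
  row_mx (mxvec A) (\det A)^-1%:M.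

Lemma GL_coord_inj A B : A \in unitmx -> B \in unitmx ->
  glcoord A = glcoord B -> A = B.
Proof. by move=> _ _ /eq_row_mx [/(can_inj mxvecK)]. Qed.

Lemma GL_coord_closed :
  zariski_closed (glcoord @` [set A | A \in unitmx]).
Proof.
pose M : 'M[{mpoly R[i][n * n + 1]}]_n :=
  \matrix_(i, j) 'X_(lshift 1 (mxvec_index i j)).
have ME (v : 'rV_(n * n + 1)) : map_mx (meval (v 0)) M = vec_mx (lsubmx v).
  by apply/matrixP => i j; rewrite !mxE mevalXU.
exists [set \det M * 'X_(rshift (n * n) 0) - 1].
have PE (v : 'rV_(n * n + 1)) : (\det M * 'X_(rshift (n * n) 0) - 1).@[v 0] =
    \det (vec_mx (lsubmx v)) * rsubmx v 0 0 - 1.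
  by rewrite mevalB mevalM meval1 mevalXU -ME det_map_mx mxE.
apply/seteqP; split=> [_ [A /= uA <-] p ->|v /(_ _ erefl)].
  rewrite PE row_mxKl row_mxKr mxvecK mxE eqxx mulr1n divrr ?subrr //.
rewrite PE => /eqP; rewrite subr_eq0 => /eqP dv1.
have du : \det (vec_mx (lsubmx v)) \is a GRing.unit.
  by rewrite unitfE; apply: contra_eq_neq dv1 => ->; rewrite mul0r eq_sym oner_eq0.
exists (vec_mx (lsubmx v)) => //=; rewrite /glcoord vec_mxK.
rewrite -[RHS]hsubmxK; congr row_mx; rewrite [RHS]mx11_scalar; congr _%:M.
by apply: (mulrI du); rewrite divrr // dv1.
Qed.

Definition GL_variety : affineVariety R 'M[R[i]]_n :=
  AffineVariety GL_coord_inj GL_coord_closed.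

End GeneralLinear.

(* (C^* )^n, embedded in C^(2n) by v |-> (v, v^-1) *)
Section Torus.
Variables (R : realType) (n : nat).

Let tcoord (v : 'rV[R[i]]_n) : 'rV[R[i]]_(n + n) := row_mx v (map_mx GRing.inv v).

Lemma torus_coord_inj (v w : 'rV[R[i]]_n) : (forall i, v 0 i != 0) -> (forall i, w 0 i != 0) ->
  tcoord v = tcoord w -> v = w.
Proof. by move=> _ _ /eq_row_mx []. Qed.

Lemma torus_coord_closed :
  zariski_closed (tcoord @` [set v : 'rV[R[i]]_n | forall i, v 0 i != 0]).
Proof.
exists [set p | exists i, p = 'X_(lshift n i) * 'X_(rshift n i) - 1].
have PE (v : 'rV_(n + n)) i : ('X_(lshift n i) * 'X_(rshift n i) - 1 : {mpoly R[i][_]}).@[v 0]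
    = lsubmx v 0 i * rsubmx v 0 i - 1.
  by rewrite mevalB mevalM meval1 !mevalXU !mxE.
apply/seteqP; split=> [_ [v /= v0 <-] p [i ->]|v Sv].
  by rewrite PE row_mxKl row_mxKr mxE divff ?subrr.
have lr i : lsubmx v 0 i * rsubmx v 0 i = 1.
  by apply/eqP; rewrite -subr_eq0 -PE; apply/eqP/Sv; exists i.
have l0 i : lsubmx v 0 i != 0.
  by apply: contra_eq_neq (lr i) => ->; rewrite mul0r eq_sym oner_eq0.
exists (lsubmx v) => //; rewrite /tcoord -[RHS]hsubmxK; congr row_mx.
apply/rowP => i; rewrite mxE; apply: (mulfI (l0 i)).
by rewrite lr divff.
Qed.

Definition torus_variety : affineVariety R 'rV[R[i]]_n :=
  AffineVariety torus_coord_inj torus_coord_closed.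

End Torus.

Record indVariety (R : realType) (T : Type) := IndVariety {
  filt :> nat -> affineVariety R T;
  filtS : forall i, closed_subvariety (filt i) (filt i.+1)
}.

Definition ind_pts (R : realType) (T : Type) (V : indVariety R T) : set T :=
  \bigcup_i pts (V i).

Definition ind_morphism (R : realType) (T1 T2 : Type)
    (V : indVariety R T1) (W : indVariety R T2) (f : T1 -> T2) :=
  forall i, exists j, var_morphism (V i) (W j) f.

Definition same_ind_structure (R : realType) (T : Type)
    (V W : indVariety R T) :=
  [/\ ind_pts V = ind_pts W, ind_morphism V W id & ind_morphism W V id].

Lemma prod_filtS (R : realType) (T1 T2 : Type)
    (V : indVariety R T1) (W : indVariety R T2) i :
  closed_subvariety (prod_variety (V i) (W i))
                    (prod_variety (V i.+1) (W i.+1)).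
Proof.
have [[sV cV] [_ [P1 E1]] [Q1 F1]] := filtS V i.
have [[sW cW] [_ [P2 E2]] [Q2 F2]] := filtS W i.
split.
- split; first by move=> [x y] [/= /sV ? /sW ?].
  exact: zariski_closedX.
- split; first by move=> [x y] [/= /sV ? /sW ?].
  exists (fun k => match split k with
    | inl a => mpoly_l _ (P1 a) | inr b => mpoly_r _ (P2 b) end).
  move=> [x y] [/= Vx Wy] k; rewrite mxE; case: split => a.
    by rewrite mpoly_lE row_mxKl -E1.
  by rewrite mpoly_rE row_mxKr -E2.
exists (fun k => match split k with
  | inl a => mpoly_l _ (Q1 a) | inr b => mpoly_r _ (Q2 b) end).
move=> [x y] [/= Vx Wy] k; rewrite mxE; case: split => a.
  by rewrite mpoly_lE row_mxKl -F1.
by rewrite mpoly_rE row_mxKr -F2.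
Qed.

Definition prod_ind (R : realType) (T1 T2 : Type)
    (V : indVariety R T1) (W : indVariety R T2) : indVariety R (T1 * T2) :=
  IndVariety (prod_filtS V W).

Definition is_subgroup (G : groupType) (H : set G) :=
  H 1%g /\ forall x y, H x -> H y -> H (x * y^-1)%g.

(* F is a structure of ind-group on the subgroup H of G; for H = setT, it is a
   structure of ind-group on G. *)
Definition ind_group (R : realType) (G : groupType) (H : set G)
    (F : indVariety R G) :=
  [/\ is_subgroup H, ind_pts F = H &
      ind_morphism (prod_ind F F) F (fun z => z.1 * z.2^-1)%g].

Definition ind_group_isomorphism (R : realType) (G1 G2 : groupType)
    (F1 : indVariety R G1) (F2 : indVariety R G2) (f : G1 -> G2) :=
  [/\ forall x y, ind_pts F1 x -> ind_pts F1 y -> f (x * y)%g = (f x * f y)%g,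
      ind_morphism F1 F2 f &
      exists g : G2 -> G1, [/\ ind_morphism F2 F1 g,
        forall x, ind_pts F1 x -> g (f x) = x &
        forall y, ind_pts F2 y -> f (g y) = y]].

Definition ind_closed (R : realType) (T : Type) (V : indVariety R T)
    (A : set T) :=
  A `<=` ind_pts V /\ forall i, var_closed (V i) (A `&` pts (V i)).

(* FH turns H into an ind-subgroup of the ind-group given by FG. *)
Definition ind_subgroup_structure (R : realType) (G : groupType)
    (FG : indVariety R G) (H : set G) (FH : indVariety R G) :=
  ind_group H FH /\ forall k, exists i, closed_subvariety (FH k) (FG i).

(* H is an algebraic subgroup of the ind-group given by FG, and X is H with
   its induced structure of affine variety. *)
Definition algebraic_subgroup (R : realType) (G : groupType)
    (FG : indVariety R G) (H : set G) (X : affineVariety R G) :=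
  [/\ is_subgroup H, ind_closed FG H, pts X = H &
      exists i, closed_subvariety X (FG i)].

Definition closed_torus (R : realType) (G : groupType) (FG : indVariety R G)
    (H : set G) :=
  exists X : affineVariety R G, algebraic_subgroup FG H X /\
  exists (n : nat) (f : G -> 'rV[R[i]]_n),
    var_isomorphism X (torus_variety R n) f /\
    forall x y, H x -> H y -> forall i, f (x * y)%g 0 i = f x 0 i * f y 0 i.

Definition algebraic_group (R : realType) (G : groupType)
    (X : affineVariety R G) :=
  is_subgroup (pts X) /\
  var_morphism (prod_variety X X) X (fun z => z.1 * z.2^-1)%g.

(* isomorphic to a closed subgroup of some GL_n that consists of unipotent
   matrices *)
Definition unipotent_algebraic_group (R : realType) (G : groupType)
    (X : affineVariety R G) :=
  algebraic_group X /\
  exists (n : nat) (Y : affineVariety R 'M[R[i]]_n) (f : G -> 'M[R[i]]_n),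
    [/\ closed_subvariety Y (GL_variety R n), var_isomorphism X Y f,
        forall x y, pts X x -> pts X y -> f (x * y)%g = f x *m f y &
        forall x, pts X x -> exists k, (f x - 1%:M) ^+ k = 0].

Definition unipotent_ind_group (R : realType) (G : groupType) (H : set G)
    (F : indVariety R G) :=
  ind_group H F /\
  exists F' : indVariety R G, same_ind_structure F F' /\
    forall i, unipotent_algebraic_group (F' i).

Definition unipotent_ind_subgroup (R : realType) (G : groupType)
    (FG : indVariety R G) (H : set G) :=
  exists FH : indVariety R G,
    ind_subgroup_structure FG H FH /\ unipotent_ind_group H FH.

(* Main.v *)
Require Import Defs.
From HB Require Import structures.
From mathcomp Require Import all_boot all_order all_algebra.
From mathcomp Require Import cyclic separable cyclotomic.
From mathcomp Require Import complex mpoly.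
From mathcomp Require Import mathcomp_extra boolp classical_sets functions cardinality reals.
From mathcomp Require Import ring lra zify.
Import Defs.

Set Implicit Arguments.
Unset Strict Implicit.
Unset Printing Implicit Defensive.

Import Order.TTheory GRing.Theory Num.Theory.

Local Open Scope ring_scope.
Local Open Scope classical_set_scope.

(* Write U as the union of the T-stable cores V of the unipotent groups filtering
   it (a Baire argument over the uncountable field shows that they exhaust U).
   Since T has no fixed point in V, the Lie algebra of V is spanned by weight
   vectors of nonzero weight, hence V is an iterated central extension of
   subgroups exp (c Y). On such a subgroup theta is determined by its value at
   exp Y, because T acts transitively on the elements with c != 0, so that theta
   is Laurent polynomial there, and polynomial by translation. Slices of the
   central extensions then show that theta is a morphism on V. Conversely, the
   regular functions pulled back by theta form a translation invariant algebra
   that separates the points of V, so they are all the regular functions: theta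
   is a closed embedding of V. *)

(** * Polynomial ideals and a Baire theorem for the Zariski topology *)

(** The two directions are not symmetric. As long as the image of U is not known to be an
    ind-subgroup, the argument for [theta] cannot be repeated for its inverse, so the closed
    embedding has to be read off from functions on the source alone. Lie theory is done by
    polynomial interpolation. Integer powers of a unipotent element extend to a polynomial curve,
    and Trotter's limit is the value at r = 0 of a curve polynomial in r that is known at r =
    1/(m+1). A closed subgroup containing infinitely many points of such a curve contains all of it,
    so the logarithms of a closed subgroup form a vector space. Adding one-parameter subgroups one
    by one, as many as the weight vectors require, calls for no independence among them: a subgroup
    already absorbed is skipped, and otherwise a slice measures the new direction. Slices are found
    by taking differences under right translations, a process that stops because regular functions
    on a unipotent group have bounded degree in this sense. *)

Section Uncountable.
Variable R : realType.

(** Cantor's argument: the n-th step keeps a closed subinterval that misses [x n], so the supremum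
    of the left endpoints differs from every [x n]. *)
Lemma nested_intervals (x : nat -> R) : exists y, forall n, y != x n.
Proof.
pose step (I : R * R) (z : R) : R * R :=
  let c := (I.1 + I.2) / 2 in if z <= c then ((c + I.2) / 2, I.2) else (I.1, c).
pose fix I n : R * R := if n is k.+1 then step (I k) (x k) else (0, 1).
have lt n : (I n).1 < (I n).2.
  elim: n => [|n IHn] /=; first by rewrite ltr01.
  rewrite /step; case: ifP => _ /=; lra.
have mono n : (I n).1 <= (I n.+1).1 /\ (I n.+1).2 <= (I n).2.
  by have := lt n; rewrite /= /step; case: ifP => _ /= ?; split; lra.
have out n : x n < (I n.+1).1 \/ (I n.+1).2 < x n.
  have := lt n; rewrite /= /step; case: ifP => /= [|/negbT]; rewrite -?ltNge => ? ?; [left|right]; lra.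
have monoD n k : (I n).1 <= (I (n + k)%N).1 /\ (I (n + k)%N).2 <= (I n).2.
  elim: k => [|k [IH1 IH2]]; first by rewrite addn0.
  have [h1 h2] := mono (n + k)%N; rewrite addnS.
  by split; [apply: le_trans IH1 h1|apply: le_trans h2 IH2].
have cross n m : (I n).1 <= (I m).2.
  have [h1 _] := monoD n m; have [_ h2] := monoD m n.
  rewrite addnC in h2; apply: le_trans h1 _; apply: le_trans h2.
  exact/ltW/lt.
pose E := [set (I n).1 | n in setT].
have Eub n : ubound E (I n).2 by move=> _ [m _ <-]; apply: cross.
have lo n : (I n).1 <= sup E.
  by apply: ub_le_sup; [exists (I 0%N).2; apply: Eub|exists n].
have hi n : sup E <= (I n).2 by apply: ge_sup => //; exists (I 0%N).1, 0%N.
exists (sup E) => n; apply/eqP => e.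
have := lo n.+1; have := hi n.+1; rewrite e => h1 h2.
by case: (out n); rewrite ltNge ?h1 ?h2.
Qed.

Lemma realType_uncountable : ~ countable [set: R].
Proof.
move=> /countable_injP [f finj].
pose g n := xget 0 [set x | f x = n].
have [y yP] := nested_intervals g.
have fz : f (g (f y)) = f y.
  by apply: (@xgetPex _ 0 [set x | f x = f y]); exists y.
have /eqP[] := yP (f y).
by rewrite (finj (g (f y)) y _ _ fz) ?in_setE.
Qed.

Lemma complex_uncountable : ~ countable [set: R[i]].
Proof.
move=> /countable_injP [f finj]; apply: realType_uncountable.
apply/countable_injP; exists (fun x => f (x%:C)%C) => x y _ _ e.
by have [] : (x%:C)%C = (y%:C)%C by apply: finj; rewrite ?in_setE.
Qed.

Lemma complex_pigeonhole (T : countType) (E : T -> set R[i]) :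
  (forall c, exists t, E t c) -> exists t, infinite_set (E t).
Proof.
move=> cov; apply: contrapT => /forallNP fin; apply: complex_uncountable.
have -> : [set: R[i]] = \bigcup_t E t.
  by apply/seteqP; split=> // c _; have [t Et] := cov c; exists t.
apply: bigcup_countable => [|t _]; first exact: countableP.
by apply: finite_set_countable; have /contrapT := fin t.
Qed.

End Uncountable.

(** * Noetherianity of polynomial rings through Dickson's lemma *)

Section Noether.
Variables (F : fieldType) (n : nat).
Implicit Types (J : set {mpoly F[n]}).

(** Each index is chosen where [u] attains its minimum over the remaining tail; the next one lies in
    that tail, so its value is at least as large. *)
Lemma nondecreasing_subseq (u : nat -> nat) :
  exists s : nat -> nat, forall i, (s i < s i.+1)%N && (u (s i) <= u (s i.+1))%N.
Proof.
have nextP N : exists j, (N <= j)%N && `[< forall k, (N <= k)%N -> (u j <= u k)%N >].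
  have ex : exists v, `[< exists2 j, (N <= j)%N & u j = v >].
    by exists (u N); apply/asboolP; exists N.
  case: (ex_minnP ex) => v /asboolP[j Nj <-] vmin.
  by exists j; rewrite Nj; apply/asboolP => k Nk; apply: vmin; apply/asboolP; exists k.
have [nx nxP] := choice nextP.
pose fix s i := if i is k.+1 then nx (s k).+1 else nx 0%N.
exists s => i; have /andP[lt _] /= := nxP (s i).+1; rewrite lt /=.
case: i lt => [|i] lt /=.
  by have /andP[_ /asboolP] := nxP 0%N; apply.
have /andP[ge /asboolP] := nxP (s i).+1; apply.
exact: leq_trans ge (ltnW lt).
Qed.

(** Subsequences are extracted for one coordinate after the other; monotonicity in the coordinates
    already treated survives every extraction. *)
Lemma dickson (m : nat -> 'X_{1..n}) :
  exists i j, (i < j)%N /\ (m i <= m j)%MM.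
Proof.
suff [s sP] : exists s : nat -> nat, forall a, (s a < s a.+1)%N /\
    forall l, l \in enum 'I_n -> (m (s a) l <= m (s a.+1) l)%N.
  exists (s 0%N), (s 1%N); have [lt le] := sP 0%N; split=> //.
  by apply/mnm_lepP => l; apply: le; rewrite mem_enum.
elim: (enum 'I_n) => [|l ls [s sP]]; first by exists id => a; split.
have [t tP] := nondecreasing_subseq (fun a => m (s a) l).
have smono : {homo s : a b / (a < b)%N >-> (a < b)%N}.
  by apply: homo_ltn; [apply: ltn_trans|move=> a; have [] := sP a].
have lmono l' : l' \in ls -> {homo (fun a => m (s a) l') : a b / (a <= b)%N >-> (a <= b)%N}.
  move=> ll; apply: homo_leq => //; first exact: leq_trans.
  by move=> a; have [_] := sP a; apply.
exists (s \o t) => a /=; have /andP[lt le] := tP a; split; first exact: smono.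
move=> l'; rewrite inE => /orP[/eqP->//|/lmono]; apply; exact: ltnW.
Qed.

Definition ideal_spec J :=
  [/\ J 0, forall p q, J p -> J q -> J (p + q) & forall p q, J q -> J (p * q)].

Lemma idealN J p : ideal_spec J -> J p -> J (- p).
Proof. by move=> [_ _ M] /(M (-1)); rewrite mulN1r. Qed.

Lemma idealB J p q : ideal_spec J -> J p -> J q -> J (p - q).
Proof. by move=> Ji Jp Jq; have [_ D _] := Ji; apply: D => //; apply: idealN. Qed.

Lemma ideal_sum J (I : Type) (r : seq I) (P : pred I) (f : I -> {mpoly F[n]}) :
  ideal_spec J -> (forall i, P i -> J (f i)) -> J (\sum_(i <- r | P i) f i).
Proof. by move=> [J0 JD _] h; elim/big_ind: _. Qed.

Lemma mlead_cancel (p q : {mpoly F[n]}) : p != 0 -> q != 0 -> (mlead q <= mlead p)%MM ->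
  exists r, p - r * q = 0 \/ (mlead (p - r * q) < mlead p)%O.
Proof.
move=> p0 q0 le.
pose c := mleadc p / mleadc q.
have c0 : c != 0 by rewrite mulf_neq0 ?invr_eq0 ?mleadc_eq0.
pose d := (mlead p - mlead q)%MM.
have X0 : 'X_[d] != 0 :> {mpoly F[n]}.
  by rewrite -mleadc_eq0 mleadXm mcoeffX eqxx oner_eq0.
pose r := c *: 'X_[d]; exists r.
have r0 : r != 0 by rewrite -mleadc_eq0 mleadZ // mcoeffZ mleadXm mcoeffX eqxx mulr1.
have lead : mlead (r * q) = mlead p.
  by rewrite mleadM // mleadZ // mleadXm submK.
have lc : mleadc (r * q) = mleadc p.
  rewrite mleadM // mleadcM mleadZ // mleadXm mcoeffZ mcoeffX eqxx mulr1.
  by rewrite /c mulfVK // mleadc_eq0.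
have [->|nz] := eqVneq (p - r * q) 0; [by left|right].
rewrite lt_neqAle; apply/andP; split.
  apply: contra_neq nz => e; apply/eqP; rewrite -mleadc_eq0 e mcoeffB -{2}lead lc.
  by rewrite subrr.
by apply: le_trans (mleadB_le _ _) _; rewrite lead joinxx.
Qed.

(** Otherwise reduce each [p k] modulo its predecessors to a nonzero remainder with least leading
    monomial. By [dickson] the leading monomial of some remainder divides that of a later one, and
    cancelling it contradicts minimality. *)
Lemma mpoly_noether (p : nat -> {mpoly F[n]}) :
  exists k, exists c : nat -> {mpoly F[n]}, p k = \sum_(i < k) c i * p i.
Proof.
pose I k (q : {mpoly F[n]}) := exists c : nat -> _, q = \sum_(i < k) c i * p i.
suff : exists k, I k (p k) by [].
have Ii k : ideal_spec (I k).
  split=> [|q r [c ->] [d ->]|q r [c ->]].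
  - by exists (fun=> 0); rewrite big1 // => i _; rewrite mul0r.
  - exists (fun i => c i + d i); rewrite -big_split.
    by apply: eq_bigr => i _; rewrite mulrDl.
  - by exists (fun i => q * c i); rewrite mulr_sumr; apply: eq_bigr => i _; rewrite mulrA.
have Ip k j : (j < k)%N -> I k (p j).
  move=> jk; exists (fun i => (i == j)%:R); rewrite (bigD1 (Ordinal jk)) //= eqxx mul1r.
  by rewrite big1 ?addr0 // => i /negPf; rewrite -val_eqE /= => ->; rewrite mul0r.
have ISub k l q : (k <= l)%N -> I k q -> I l q.
  move=> kl [c ->]; apply: ideal_sum => // i _.
  by have [_ _] := Ii l; apply; apply: Ip; apply: leq_trans kl.
apply: contrapT => /forallNP nI.
have minP k : exists q, I k (p k - q) /\ forall q', I k (p k - q') -> ~~ (mlead q' < mlead q)%O.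
  apply: contrapT => /forallNP h.
  have h2 m : forall q, mlead q = m -> ~ I k (p k - q).
    elim/(well_founded_ind (@ltom_wf n)): m => m IHm q qm Iq.
    apply: (h q); split=> // q' Iq'; apply/negP => lt.
    by apply: (IHm (mlead q')) Iq' => //; rewrite -qm.
  by apply: (h2 _ (p k) erefl); rewrite subrr; have [] := Ii k.
have [q qP] := choice minP.
have [i [j [ij le]]] := dickson (fun k => mlead (q k)).
have q0 k : q k != 0.
  by apply/eqP => e; apply: (nI k); have [] := qP k; rewrite e subr0.
have Iqi : I j (q i).
  have Ipq : I j (p i - q i) by have [h _] := qP i; apply: ISub h; apply: ltnW.
  by rewrite -[q i](subKr (p i)); apply: idealB => //; apply: Ip.
have [r rP] := mlead_cancel (q0 j) (q0 i) le.
have Ir : I j (p j - (q j - r * q i)).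
  rewrite opprB addrA addrAC; have [_ D M] := Ii j; apply: D; last exact: M.
  by have [] := qP j.
case: rP => [e|lt]; first by apply: (nI j); rewrite e subr0 in Ir.
by have [_ /(_ _ Ir)] := qP j; rewrite lt.
Qed.

(** If every member were properly contained in another, the elements gained along an ascending chain
    would form a sequence contradicting [mpoly_noether]. *)
Lemma ideal_maximal (P : set (set {mpoly F[n]})) J0 :
  (forall J, P J -> ideal_spec J) -> P J0 ->
  exists2 J, P J & forall J', P J' -> J `<=` J' -> J' `<=` J.
Proof.
move=> Pi PJ0; apply: contrapT => /forall2NP h.
have {}h J : exists x : set {mpoly F[n]} * {mpoly F[n]},
    P J -> [/\ P x.1, J `<=` x.1, x.1 x.2 & ~ J x.2].
  have [PJ|nPJ] := pselect (P J); last by exists (J, 0).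
  have [//|/existsNP [J' /not_implyP [PJ' /not_implyP [JJ' /existsNP [p]]]]] := h J.
  by move=> /not_implyP[J'p Jp]; exists (J', p).
have [f fP] := choice h.
pose K k := iter k (fun J => (f J).1) J0.
have PK k : P (K k) by elim: k => //= k /fP [].
have sub k : K k `<=` K k.+1 by have [] := fP _ (PK k).
have subD k l : (k <= l)%N -> K k `<=` K l.
  move=> /subnK <-; elim: (l - k)%N => // a IHa q /IHa; rewrite addSn; exact: sub.
have [k [c e]] := mpoly_noether (fun k => (f (K k)).2).
have [_ _ _] := fP _ (PK k); apply; rewrite e.
apply: ideal_sum => [|i _]; first exact/Pi/PK.
have [_ _] := Pi _ (PK k); apply; apply: (subD i.+1) => //.
by have [] := fP _ (PK i).
Qed.

End Noether.

(** * Increasing unions of closed sets over an uncountable field *)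

Section Baire.
Variables (R : realType) (n : nat).
Notation C := (R[i]).
Notation mp := {mpoly C[n]}.
Implicit Types (X : set 'rV[C]_n) (J : set mp) (p q : mp).

Definition prime_spec J := forall p q, J (p * q) -> J p \/ J q.

Definition ideal_add J p : set mp := [set x | exists j c, J j /\ x = j + c * p].

Lemma ideal_addP J p : ideal_spec J ->
  [/\ ideal_spec (ideal_add J p), J `<=` ideal_add J p & ideal_add J p p].
Proof.
move=> [J0 JD JM]; split.
- split.
  + by exists 0, 0; rewrite mul0r addr0.
  + move=> _ _ [j [c [Jj ->]]] [j' [c' [Jj' ->]]].
    by exists (j + j'), (c + c'); split; [apply: JD|rewrite mulrDl addrACA].
  + move=> q _ [j [c [Jj ->]]].
    by exists (q * j), (q * c); split; [apply: JM|rewrite mulrDr mulrA].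
- by move=> j Jj; exists j, 0; rewrite mul0r addr0.
- by exists 0, 1; rewrite mul1r add0r.
Qed.

(** The univariate polynomial splits over the algebraically closed field, and a prime ideal contains
    one of the factors of a product it contains. *)
Lemma prime_root J (k : 'I_n) (g : {poly C}) : ideal_spec J -> prime_spec J -> ~ J 1 ->
  g != 0 -> J (horner_alg 'X_k g) -> exists c, J ('X_k - c%:MP).
Proof.
move=> [_ _ JM] Jp J1 g0; have [rs ->] := closed_field_poly_normal g.
rewrite linearZ rmorph_prod /= mulr_algl => Jg.
have {}Jg : J (\prod_(z <- rs) horner_alg 'X_k ('X - z%:P)).
  have l0 : lead_coef g != 0 by rewrite lead_coef_eq0.
  by rewrite -[X in J X](scalerK l0) -mul_mpolyC; apply: JM.
elim: rs Jg => [|r rs IHrs]; first by rewrite big_nil => h; case: J1.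
rewrite big_cons => /Jp [|/IHrs//].
by rewrite rmorphB /= horner_algX horner_algC alg_mpolyC => h; exists r.
Qed.

Lemma linear_dependence (d : nat) (a : nat -> mp) : (forall i, (msize (a i) <= d)%N) ->
  exists N (mu : 'I_N -> C), (exists i, mu i != 0) /\ \sum_i mu i *: a i = 0.
Proof.
move=> ad; pose T : finType := 'X_{1..n < d}; pose N := #|T|.+1.
pose M : 'M[C]_(N, #|T|) := \matrix_(i, j) (a i)@_(enum_val j : 'X_{1..n < d}).
have : kermx M != 0.
  by rewrite kermx_eq0 /row_free; apply: contraTneq (rank_leq_col M) => ->; rewrite ltnn.
move=> /rowV0Pn [v /sub_kermxP vM v0].
exists N, (v 0); split; first by have /rV0Pn := v0.
apply/mpolyP => m; rewrite mcoeff0 raddf_sum /=.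
under eq_bigr do rewrite mcoeffZ.
have [md|dm] := ltnP (mdeg m) d.
  have /rowP /(_ (enum_rank (BMultinom md : T))) := vM.
  rewrite !mxE => e; rewrite -[RHS]e; apply: eq_bigr => i _.
  by rewrite !mxE enum_rankK.
rewrite big1 // => i _; rewrite memN_msupp_eq0 ?mulr0 //.
exact/msize_mdeg_ge/(leq_trans (ad i)).
Qed.

Definition vanishing X : set mp := [set p | forall v : 'rV[C]_n, X v -> p.@[v 0] = 0].

Lemma vanishing_ideal X : ideal_spec (vanishing X).
Proof.
split=> [v _|p q hp hq v Xv|p q hq v Xv]; first by rewrite meval0.
  by rewrite mevalD hp // hq // addr0.
by rewrite mevalM hq // mulr0.
Qed.

Lemma zariski_closedP X (v : 'rV[C]_n) :
  zariski_closed X -> (forall p, vanishing X p -> p.@[v 0] = 0) -> X v.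
Proof. by move=> [S ->] h /= p Sp; apply: h => w /= ; apply. Qed.

(* A maximal ideal J among those over the vanishing ideal of X whose radical
   contains no vanishing ideal of a Z i is prime. As the field is uncountable
   while polynomials of bounded degree form a finite-dimensional space, J
   contains some 'X_k - c for every k, hence is the ideal of a point of X lying
   in no Z i. *)
Theorem zariski_baire X (Z : nat -> set 'rV[C]_n) :
  zariski_closed X -> (forall i, zariski_closed (Z i)) ->
  (forall i, Z i `<=` Z i.+1) -> X `<=` \bigcup_i Z i -> exists i, X `<=` Z i.
Proof.
move=> Xc Zc Zs XZ; apply: contrapT => /forallNP XnZ.
have ZsD i j : (i <= j)%N -> Z i `<=` Z j.
  move=> /subnK <-; elim: (j - i)%N => // a IHa q /IHa; rewrite addSn; exact: Zs.
pose P J := [/\ ideal_spec J, vanishing X `<=` J &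
  forall i, exists2 f, vanishing (Z i) f & forall m, ~ J (f ^+ m)].
have PX : P (vanishing X).
  split=> //; first exact: vanishing_ideal.
  move=> i; have /existsNP [v /not_implyP [Xv nZv]] := XnZ i.
  have /existsNP [f /not_implyP [Zf fv]] : ~ (forall p, vanishing (Z i) p -> p.@[v 0] = 0).
    by move=> /(zariski_closedP (Zc i)).
  exists f => // m /(_ v Xv); rewrite rmorphXn /= => /eqP.
  by rewrite expf_eq0 => /andP[_ /eqP].
have [J [Ji XJ JZ] Jmax] := ideal_maximal (fun J (PJ : P J) => let: And3 h _ _ := PJ in h) PX.
have [J0 JD JM] := Ji.
have J1 : ~ J 1 by have [f _ /(_ 0%N)] := JZ 0%N; rewrite expr0.
have addJ p : ~ J p -> exists i, forall f, vanishing (Z i) f -> exists m, ideal_add J p (f ^+ m).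
  move=> nJp; have [Ai JA Ap] := ideal_addP p Ji.
  apply: contrapT => /forallNP h; apply: nJp; apply: (Jmax (ideal_add J p)) => //.
  split=> //; first exact: subset_trans JA.
  move=> i; have /existsNP [f /not_implyP [Zf /forallNP nf]] := h i.
  by exists f.
(* If p and q were both outside J, maximality would put powers of every function vanishing on a
   large [Z] into J + (p) and into J + (q). The product of two such powers of the same f then lies
   in J, since p * q does. *)
have Jp : prime_spec J.
  move=> p q Jpq; apply: contrapT => /not_orP[/addJ [i hi] /addJ [j hj]].
  have [f Zf nJf] := JZ (maxn i j).
  have [|m [a [b [Ja ea]]]] := hi f.
    by move=> v /(ZsD _ _ (leq_maxl i j)); apply: Zf.
  have [|m' [a' [b' [Ja' ea']]]] := hj f.
    by move=> v /(ZsD _ _ (leq_maxr i j)); apply: Zf.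
  apply: (nJf (m + m')%N); rewrite exprD ea ea'.
  have -> : (a + b * p) * (a' + b' * q) = (a' + b' * q) * a + ((b * p) * a' + (b * b') * (p * q)).
    by ring.
  by apply: (JD); [|apply: JD]; apply: JM.
have [f fP] := choice (fun i => let: ex_intro2 f a b := JZ i in ex_intro _ f (conj a b)).
have JX k : exists c, J ('X_k - c%:MP).
  have [//|/forallNP nJX] := pselect (exists c, J ('X_k - c%:MP)).
  (* For each c some power of an [f i] is a multiple of ['X_k - c] modulo J. There are countably
     many choices of index, exponent and size bound, so one choice serves infinitely many c. *)
  pose E (t : nat * nat * nat) : set C := [set c | exists a, (msize a <= t.2)%N /\
    J (f t.1.1 ^+ t.1.2 - a * ('X_k - c%:MP))].
  have [c|[[i m] d] Einf] := @complex_pigeonhole _ _ E.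
    have [i hi] := addJ _ (nJX c).
    have [m [b [a [Jb e]]]] := hi (f i) (proj1 (fP i)).
    by exists (i, m, msize a), a; split=> //=; rewrite e addrK.
  have /infiniteP/card_leP[e0] := Einf.
  pose e j : C := val (e0 (SigSub (in_setT j))).
  have einj : injective e.
    by move=> a b /val_inj /(inj (in_setT _) (in_setT _)) /(congr1 val).
  have eE j : E (i, m, d) (e j) by have := valP (e0 (SigSub (in_setT j))); rewrite in_setE.
  have [a aP] := choice eE.
  have [N [mu [[j0 mu0] dep]]] := linear_dependence (fun j => (aP j).1).
  (* Modulo J, [f i ^+ m] times the sum of the [mu j *: q j] at ['X_k] equals the vanishing
     combination of the [a j] times the product of all factors. The sum of the [mu j *: q j] is
     nonzero because only the term of [j0] survives at [e j0]. *)
  pose q j : {poly C} := \prod_(l < N | l != j) ('X - (e l)%:P).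
  apply: (@prime_root J k (\sum_j mu j *: q j)) => //.
    apply/eqP => /(congr1 (horner^~ (e j0))) /=; rewrite horner0 horner_sum (bigD1 j0) //=.
    rewrite big1 => [|j jj0].
      rewrite addr0 hornerZ horner_prod => /eqP; rewrite mulf_eq0 (negPf mu0) /=.
      apply/negP/prodf_neq0 => l lj.
      by rewrite !hornerE subr_eq0; apply: contra_neq lj => /einj /val_inj ->.
    rewrite hornerZ horner_prod (bigD1 j0) 1?eq_sym //=.
    by rewrite hornerXsubC subrr mul0r mulr0.
  have qE j : horner_alg 'X_k (q j) = \prod_(l < N | l != j) ('X_k - (e l)%:MP).
    rewrite rmorph_prod; apply: eq_bigr => l _.
    by rewrite rmorphB /= horner_algX horner_algC alg_mpolyC.
  have Js : ~ J (f i ^+ m) by have [_] := fP i.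
  have [//|//] : J (f i ^+ m) \/ J (horner_alg 'X_k (\sum_j mu j *: q j)).
  apply: Jp; rewrite linear_sum mulr_sumr.
  have -> : \sum_j f i ^+ m * horner_alg 'X_k (mu j *: q j) =
      \sum_j (mu j *: horner_alg 'X_k (q j)) * (f i ^+ m - a j * ('X_k - (e j)%:MP)).
    have dep0 : \sum_j (mu j *: a j) * \prod_(l < N) ('X_k - (e l)%:MP) = 0.
      by rewrite -mulr_suml dep mul0r.
    rewrite -[LHS]subr0 -[X in _ - X = _]dep0 -sumrB; apply: eq_bigr => j _; rewrite linearZ /= mulr_algl (bigD1 j) //= qE.
    set Q := \prod_(_ < _ | _) _; rewrite -!mul_mpolyC.
    by ring.
  by apply: ideal_sum => // j _; apply: JM; apply: (aP j).2.
have [c cP] := choice JX; pose v : 'rV[C]_n := \row_k c k.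
have Jv p : J (p - (p.@[v 0])%:MP).
  elim/mpolyind: p => [|b m p _ _ IHp]; first by rewrite meval0 mpolyC0 subrr.
  rewrite mevalD mevalZ mevalX mpolyCD mpolyCM opprD addrACA; apply: (JD) => //.
  rewrite -mul_mpolyC -mulrBr; apply: (JM); rewrite mpolyXE_id rmorph_prod.
  elim/big_rec2: _ => [|k x y _ IH]; first by rewrite subrr.
  rewrite rmorphXn /= mxE.
  have {}IH := JM ((c k)%:MP ^+ m k) _ IH.
  have -> : 'X_k ^+ m k * x - (c k)%:MP ^+ m k * y =
      x * ('X_k ^+ m k - (c k)%:MP ^+ m k) + (c k)%:MP ^+ m k * (x - y) by ring.
  by apply: (JD) => //; apply: (JM); rewrite subrXX mulrC; apply: (JM).
have Jev p : J p -> p.@[v 0] = 0.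
  move=> Jp'; apply/eqP; apply: contra_notT J1 => pv.
  have := idealB Ji Jp' (Jv p); rewrite subKr => /(JM (((p.@[v 0])^-1)%:MP)).
  by rewrite -mpolyCM mulVf.
have [i _ Zv] : (\bigcup_i Z i) v.
  by apply: XZ; apply: zariski_closedP => // p /XJ /Jev.
have [/(_ v Zv) fv /(_ 1%N)] := fP i; apply; rewrite expr1.
by have := Jv (f i); rewrite fv mpolyC0 subr0.
Qed.

End Baire.

(** * Exponential and logarithm of matrices *)

Section PolyFun.
Variable F : numFieldType.
Implicit Types (f g : F -> F).

Definition polyfun f := exists p : {poly F}, forall c, f c = p.[c].

Lemma polyfun_const a : polyfun (fun=> a).
Proof. by exists a%:P => c; rewrite hornerC. Qed.

Lemma polyfun_id : polyfun id.
Proof. by exists 'X => c; rewrite hornerX. Qed.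

Lemma polyfunD f g : polyfun f -> polyfun g -> polyfun (fun c => f c + g c).
Proof. by move=> [p pE] [q qE]; exists (p + q) => c; rewrite hornerD pE qE. Qed.

Lemma polyfunM f g : polyfun f -> polyfun g -> polyfun (fun c => f c * g c).
Proof. by move=> [p pE] [q qE]; exists (p * q) => c; rewrite hornerM pE qE. Qed.

Lemma polyfun_comp f g : polyfun f -> polyfun g -> polyfun (fun c => f (g c)).
Proof.
by move=> [p pE] [q qE]; exists (p \Po q) => c; rewrite horner_comp pE qE.
Qed.

Lemma polyfun_ext f g : f =1 g -> polyfun f -> polyfun g.
Proof. by move=> /funext ->. Qed.

Lemma polyfun_sum (I : Type) (r : seq I) (P : pred I) (f : I -> F -> F) :
  (forall i, P i -> polyfun (f i)) -> polyfun (fun c => \sum_(i <- r | P i) f i c).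
Proof.
move=> h; elim: r => [|i r IHr].
  by apply: (@polyfun_ext (fun=> 0)); [move=> c; rewrite big_nil|apply: polyfun_const].
apply: (@polyfun_ext (fun c => (if P i then f i c else 0) + \sum_(i <- r | P i) f i c)).
  by move=> c; rewrite big_cons; case: (P i); rewrite ?add0r.
apply: polyfunD => //; have := h i; case: (P i) => [/(_ isT) //|_].
exact: polyfun_const.
Qed.

Lemma polyfun_prod (I : Type) (r : seq I) (f : I -> F -> F) :
  (forall i, polyfun (f i)) -> polyfun (fun c => \prod_(i <- r) f i c).
Proof.
move=> h; elim: r => [|i r IHr].
  by apply: (@polyfun_ext (fun=> 1)); [move=> c; rewrite big_nil|apply: polyfun_const].
apply: (@polyfun_ext (fun c => f i c * \prod_(i <- r) f i c)) => [c|].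
  by rewrite big_cons.
exact: polyfunM.
Qed.

Lemma poly_eq_inj (p q : {poly F}) (s : nat -> F) : injective s ->
  (forall m, p.[s m] = q.[s m]) -> p = q.
Proof.
move=> sinj e; apply/eqP; rewrite -subr_eq0; apply/eqP.
apply: (@roots_geq_poly_eq0 _ _ [seq s i | i <- iota 0 (size (p - q))]).
- by apply/allP => _ /mapP[i _ ->]; rewrite /root hornerD hornerN e subrr.
- by rewrite map_inj_uniq ?iota_uniq.
- by rewrite size_map size_iota.
Qed.

Lemma polyfun_eq_inj f g (s : nat -> F) : injective s -> polyfun f -> polyfun g ->
  (forall m, f (s m) = g (s m)) -> f =1 g.
Proof.
move=> sinj [p pE] [q qE] e c; rewrite pE qE (@poly_eq_inj p q s) // => m.
by rewrite -pE -qE.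
Qed.

Lemma natr_injective : injective (fun m : nat => m%:R : F).
Proof. by move=> m m' /eqP; rewrite eqr_nat => /eqP. Qed.

Lemma invS_injective : injective (fun m : nat => m.+1%:R^-1 : F).
Proof. by move=> m m' /invr_inj /eqP; rewrite eqr_nat => /eqP []. Qed.

Lemma polyfun_eq_nat f g : polyfun f -> polyfun g ->
  (forall m : nat, f m%:R = g m%:R) -> f =1 g.
Proof. exact/polyfun_eq_inj/natr_injective. Qed.

(** This takes the place of a limit: an identity checked at r = 1/(m+1), where it concerns integer
    powers, carries over to r = 0. *)
Lemma polyfun_eq_invS f g : polyfun f -> polyfun g ->
  (forall m : nat, f m.+1%:R^-1 = g m.+1%:R^-1) -> f =1 g.
Proof. exact/polyfun_eq_inj/invS_injective. Qed.

Definition polymx m n (H : F -> 'M[F]_(m, n)) := forall i j, polyfun (fun c => H c i j).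

Lemma polymx_const m n (A : 'M[F]_(m, n)) : polymx (fun=> A).
Proof. by move=> i j; apply: polyfun_const. Qed.

Lemma polymxD m n (H K : F -> 'M[F]_(m, n)) : polymx H -> polymx K ->
  polymx (fun c => H c + K c).
Proof.
move=> h k i j; apply: (@polyfun_ext (fun c => H c i j + K c i j)) => [c|].
  by rewrite mxE.
exact: polyfunD.
Qed.

Lemma polymxZ m n f (H : F -> 'M[F]_(m, n)) : polyfun f -> polymx H ->
  polymx (fun c => f c *: H c).
Proof.
move=> hf h i j; apply: (@polyfun_ext (fun c => f c * H c i j)) => [c|].
  by rewrite mxE.
exact: polyfunM.
Qed.

Lemma polymxM n (H K : F -> 'M[F]_n) : polymx H -> polymx K ->
  polymx (fun c => H c * K c).
Proof.
move=> h k i j; apply: (@polyfun_ext (fun c => \sum_l H c i l * K c l j)) => [c|].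
  by rewrite mxE.
by apply: polyfun_sum => l _; apply: polyfunM.
Qed.

Lemma polymxX n (H : F -> 'M[F]_n) k : polymx H -> polymx (fun c => H c ^+ k).
Proof.
move=> h; elim: k => [|k IHk]; first exact: polymx_const.
by under eq_fun do rewrite exprS; apply: polymxM.
Qed.

Lemma polymx_sum m n (I : Type) (r : seq I) (H : I -> F -> 'M[F]_(m, n)) :
  (forall i, polymx (H i)) -> polymx (fun c => \sum_(i <- r) H i c).
Proof.
move=> h i j; apply: (@polyfun_ext (fun c => \sum_(k <- r) H k c i j)) => [c|].
  by rewrite summxE.
by apply: polyfun_sum => k _; apply: h.
Qed.

Lemma polymx_comp m n f (H : F -> 'M[F]_(m, n)) : polymx H -> polyfun f ->
  polymx (fun c => H (f c)).
Proof. by move=> h hf i j; apply: (polyfun_comp (h i j) hf). Qed.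

Lemma polymx_eq_nat m n (H K : F -> 'M[F]_(m, n)) : polymx H -> polymx K ->
  (forall k : nat, H k%:R = K k%:R) -> H =1 K.
Proof.
move=> h k e c; apply/matrixP => i j.
by apply: (polyfun_eq_nat (h i j) (k i j)) => l; rewrite e.
Qed.

Lemma polymx_eq_invS m n (H K : F -> 'M[F]_(m, n)) : polymx H -> polymx K ->
  (forall k : nat, H k.+1%:R^-1 = K k.+1%:R^-1) -> H =1 K.
Proof.
move=> h k e c; apply/matrixP => i j.
by apply: (polyfun_eq_invS (h i j) (k i j)) => l; rewrite e.
Qed.

End PolyFun.

(** * Complex powers, exponential and logarithm of unipotent matrices *)

Section MatrixExp.
Variables (F : numFieldType) (n : nat).
Notation M := 'M[F]_n.
Implicit Types (u v X N : M) (r s a b : F).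

(** [r * bincoef k r] is the binomial coefficient of r over k+1, so [bincoef k 0] is the coefficient
    (-1)^k/(k+1) of the logarithm. [powcoef k r] is r^(k+1) times the binomial coefficient of 1/r
    over k+1, with value 1/(k+1)! at r = 0. *)
Definition bincoef (k : nat) r : F := (\prod_(j < k) (r - j.+1%:R)) / k.+1`!%:R.
Definition powcoef (k : nat) r : F := (\prod_(j < k) (1 - j.+1%:R * r)) / k.+1`!%:R.

(* (u ^ r - 1) / r, from the binomial series of u ^ r *)
Definition mxpow1 u r : M := \sum_(k < n) bincoef k r *: (u - 1) ^+ k.+1.
Definition mxpow u r : M := 1 + r *: mxpow1 u r.
(* (1 + r N) ^ (1 / r), which tends to exp N as r tends to 0 *)
Definition mxpowinv r N : M := 1 + \sum_(k < n) powcoef k r *: N ^+ k.+1.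
Definition mxexp X : M := mxpowinv 0 X.
Definition mxlog u : M := mxpow1 u 0.

Definition mxunip u := (u - 1) ^+ n = 0.

Lemma polyfun_bincoef k : polyfun (bincoef k).
Proof.
apply: polyfunM (polyfun_const _); apply: polyfun_prod => j.
by apply: polyfunD (polyfun_const _); apply: polyfun_id.
Qed.

Lemma polyfun_powcoef k : polyfun (powcoef k).
Proof.
apply: polyfunM (polyfun_const _); apply: polyfun_prod => j.
apply: polyfunD (polyfun_const _) _.
apply: (@polyfun_ext _ (fun r => (- j.+1%:R) * r)) => [r|]; first by rewrite mulNr.
by apply: polyfunM (polyfun_const _) _; apply: polyfun_id.
Qed.

Lemma polymx_mxpow1 u : polymx (mxpow1 u).
Proof.
apply: polymx_sum => k; apply: polymxZ; first exact: polyfun_bincoef.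
exact: polymx_const.
Qed.

Lemma polymx_mxpow u : polymx (mxpow u).
Proof.
apply: polymxD (polymx_const _) _; apply: polymxZ (polymx_mxpow1 u).
exact: polyfun_id.
Qed.

Lemma polymx_mxpowinv f (H : F -> M) : polyfun f -> polymx H -> polymx (fun r => mxpowinv (f r) (H r)).
Proof.
move=> hf h; apply: polymxD (polymx_const _) _; apply: polymx_sum => k.
by apply: polymxZ; [apply: polyfun_comp hf; apply: polyfun_powcoef|apply: polymxX].
Qed.

Lemma sum_truncate (V : nmodType) (a : nat -> V) p q : (forall i, (p <= i)%N -> a i = 0) ->
  (forall i, (q <= i)%N -> a i = 0) -> \sum_(i < p) a i = \sum_(i < q) a i.
Proof.
move=> pa qa; rewrite (@big_ord_widen _ _ _ p (maxn p q) a) ?leq_maxl //.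
rewrite [RHS](@big_ord_widen _ _ _ q (maxn p q) a) ?leq_maxr //.
rewrite [LHS]big_mkcond [RHS]big_mkcond /=; apply: eq_bigr => i _.
by case: ltnP => hp; case: ltnP => hq //; rewrite ?(pa _ hp) ?(qa _ hq).
Qed.

Lemma natr_bin (m k : nat) : 'C(m, k.+1)%:R = m%:R * bincoef k m%:R.
Proof.
rewrite /bincoef mulrA.
apply: (canRL (mulfK _)); first by rewrite pnatr_eq0 -lt0n fact_gt0.
rewrite -natrM bin_ffact.
have E l : (m ^_ l)%:R = \prod_(j < l) (m%:R - j%:R) :> F.
  elim: l => [|l IHl]; first by rewrite big_ord0.
  rewrite ffactnSr natrM IHl big_ord_recr /=.
  have [lm|ml] := leqP l m; first by rewrite natrB.
  by rewrite (bigD1 (Ordinal ml)) //= subrr !mul0r.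
by rewrite E big_ord_recl subr0.
Qed.

Lemma mxpow_nat u (m : nat) : mxunip u -> mxpow u m%:R = u ^+ m.
Proof.
move=> hu; pose a i := (u - 1) ^+ i *+ 'C(m, i).
have -> : u ^+ m = \sum_(i < m.+1) a i by rewrite -{1}(subrK 1 u) exprD1n.
rewrite (@sum_truncate _ a _ n.+1).
- rewrite big_ord_recl /a bin0 expr0 mulr1n /mxpow /mxpow1 scaler_sumr.
  by congr (_ + _); apply: eq_bigr => i _; rewrite scalerA -natr_bin scaler_nat.
- by move=> i; rewrite /a => /bin_small ->; rewrite mulr0n.
- by move=> i /ltnW ni; rewrite /a -(subnKC ni) exprD hu mul0r mul0rn.
Qed.

Lemma scalemxMl a N X : a *: N * X = a *: (N * X).
Proof. exact/esym/scalemxAl. Qed.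

Lemma scalemxMr a N X : N * (a *: X) = a *: (N * X).
Proof. exact/esym/scalemxAr. Qed.

Lemma scalemx_exp a N k : (a *: N) ^+ k = a ^+ k *: N ^+ k.
Proof.
elim: k => [|k IHk]; first by rewrite !expr0 scale1r.
by rewrite !exprS IHk scalemxMl scalemxMr scalerA.
Qed.

Lemma mxpowinvE r N : r != 0 -> mxpowinv r N = mxpow (1 + r *: N) r^-1.
Proof.
move=> r0; rewrite /mxpowinv /mxpow /mxpow1 [1 + r *: N]addrC addrK scaler_sumr.
congr (_ + _); apply: eq_bigr => k _; rewrite scalemx_exp !scalerA; congr (_ *: _).
have E : \prod_(j < k) (1 - j.+1%:R * r) = r ^+ k * \prod_(j < k) (r^-1 - j.+1%:R).
  rewrite -[k in r ^+ k]card_ord -prodr_const -big_split /=.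
  by apply: eq_bigr => j _; rewrite mulrBr mulfV // mulrC.
rewrite /powcoef /bincoef E exprSr; set P := \prod_(_ < _) _; set f := _%:R^-1.
transitivity ((r^-1 * r) * (r ^+ k * P * f)); first by rewrite mulVf // mul1r.
by ring.
Qed.

Lemma mxunip_pow u a : mxunip u -> mxunip (mxpow u a).
Proof.
move=> hu; rewrite /mxunip /mxpow addrAC subrr add0r scalemx_exp.
pose q : M := \sum_(k < n) bincoef k a *: (u - 1) ^+ k.
have cq : GRing.comm (u - 1) q.
  rewrite /GRing.comm mulr_sumr mulr_suml; apply: eq_bigr => k _.
  by rewrite scalemxMl scalemxMr -exprS -exprSr.
have -> : mxpow1 u a = (u - 1) * q.
  by rewrite mulr_sumr; apply: eq_bigr => k _; rewrite scalemxMr -exprS.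
by rewrite exprMn_comm // hu mul0r scaler0.
Qed.

(** For r different from 0, [mxpow1 u r] is a multiple of the nilpotent matrix [mxpow u r - 1]; the
    vanishing of its n-th power extends to r = 0. *)
Lemma mxlog_nilp u : mxunip u -> mxlog u ^+ n = 0.
Proof.
move=> hu; pose H (r : F) := (mxpow1 u r) ^+ n.
have -> : mxlog u ^+ n = H 0 by [].
apply: (@polymx_eq_invS _ _ _ H (fun=> 0)) => [||k].
- exact/polymxX/polymx_mxpow1.
- exact: polymx_const.
have k0 : k.+1%:R^-1 ^+ n != 0 :> F by rewrite expf_neq0 // invr_eq0 pnatr_eq0.
apply: (scalerI k0); rewrite scaler0 -scalemx_exp.
have /mxunip_pow := hu; move=> /(_ k.+1%:R^-1).
by rewrite /mxunip /mxpow addrAC subrr add0r.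
Qed.

(** Both sides are polynomial in each exponent separately, and the identity is clear when both are
    natural numbers. *)
Lemma mxpowD u a b : mxunip u -> mxpow u (a + b) = mxpow u a * mxpow u b.
Proof.
move=> hu; have shift c : polyfun (fun r : F => r + c).
  by apply: polyfunD (polyfun_const _); apply: polyfun_id.
have h (m : nat) : forall a, mxpow u (a + m%:R) = mxpow u a * mxpow u m%:R.
  apply: polymx_eq_nat => [||k].
  - by apply: polymx_comp (shift _); apply: polymx_mxpow.
  - by apply: polymxM (polymx_const _); apply: polymx_mxpow.
  - by rewrite -natrD !mxpow_nat // exprD.
move: b; apply: polymx_eq_nat => [||k //].
- apply: polymx_comp (polymx_mxpow _) _.
  by apply: polyfunD; [apply: polyfun_const|apply: polyfun_id].
- by apply: polymxM (polymx_const _) _; apply: polymx_mxpow.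
Qed.

Lemma mxpow0 u : mxpow u 0 = 1.
Proof. by rewrite /mxpow scale0r addr0. Qed.

Lemma mxpow_expr u a (m : nat) : mxunip u -> mxpow u a ^+ m = mxpow u (m%:R * a).
Proof.
move=> hu; elim: m => [|m IHm]; first by rewrite expr0 mul0r mxpow0.
by rewrite exprSr IHm -mxpowD // -natr1 mulrDl mul1r.
Qed.

Lemma mxexp_log_scale u s : mxunip u -> mxexp (s *: mxlog u) = mxpow u s.
Proof.
move=> hu; pose N (r : F) := s *: mxpow1 u (s * r).
have -> : s *: mxlog u = N 0 by rewrite /N mulr0.
have sid : polyfun ( *%R s) by apply: polyfunM (polyfun_const _) _; apply: polyfun_id.
apply: (@polymx_eq_invS _ _ _ (fun r => mxpowinv r (N r)) (fun=> mxpow u s)) => [||k].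
- apply: polymx_mxpowinv; first exact: polyfun_id.
  apply: polymxZ (polyfun_const _) _; apply: polymx_comp sid; exact: polymx_mxpow1.
- exact: polymx_const.
have k0 : k.+1%:R != 0 :> F by rewrite pnatr_eq0.
rewrite mxpowinvE ?invr_eq0 // invrK /N scalerA.
have -> : 1 + (k.+1%:R^-1 * s) *: mxpow1 u (s / k.+1%:R) = mxpow u (s / k.+1%:R).
  by rewrite /mxpow mulrC.
rewrite (mxpow_nat _ (mxunip_pow _ hu)) (mxpow_expr _ _ hu); congr (mxpow u _).
by rewrite mulrCA mulfV // mulr1.
Qed.

Lemma mxlogK u : mxunip u -> mxexp (mxlog u) = u.
Proof. by move=> hu; rewrite -[mxlog u]scale1r mxexp_log_scale // (mxpow_nat 1). Qed.

Lemma mxlog_expr u (m : nat) : mxunip u -> mxlog (u ^+ m) = m%:R *: mxlog u.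
Proof.
move=> hu; have um : mxunip (u ^+ m) by rewrite -mxpow_nat //; apply: mxunip_pow.
have mid : polyfun (fun r : F => m%:R * r).
  by apply: polyfunM (polyfun_const _) _; apply: polyfun_id.
have E : forall r, mxpow (u ^+ m) r = mxpow u (m%:R * r).
  apply: polymx_eq_nat => [||k]; first exact: polymx_mxpow.
    by apply: polymx_comp mid; apply: polymx_mxpow.
  by rewrite mxpow_nat // -natrM mxpow_nat // exprM.
suff /(_ 0) : forall r, mxpow1 (u ^+ m) r = m%:R *: mxpow1 u (m%:R * r) by rewrite mulr0.
apply: polymx_eq_invS => [||k]; first exact: polymx_mxpow1.
  by apply: polymxZ (polyfun_const _) _; apply: polymx_comp mid; apply: polymx_mxpow1.
have k0 : k.+1%:R^-1 != 0 :> F by rewrite invr_eq0 pnatr_eq0.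
apply: (scalerI k0); rewrite scalerA [_ * m%:R]mulrC.
by have := E k.+1%:R^-1 => /addrI.
Qed.

Lemma mxexpK X : X ^+ n = 0 -> mxlog (mxexp X) = X.
Proof.
(* [H r] is log(1 + rX)/r, which for r = 1/(k+1) is the logarithm of (1 + rX)^(1/r). *)
move=> hX; pose H (r : F) : M := \sum_(k < n) (bincoef k 0 * r ^+ k) *: X ^+ k.+1.
have log_poly (K : F -> M) : polymx K -> polymx (fun r => mxlog (K r)).
  move=> h; apply: polymx_sum => k; apply: polymxZ (polyfun_const _) _.
  by apply: polymxX; apply: polymxD h _; apply: polymx_const.
have H0 : H 0 = X.
  apply/matrixP => i j; have n0 : (0 < n)%N by apply: leq_ltn_trans (ltn_ord i).
  rewrite /H (bigD1 (Ordinal n0)) //= big1 => [|k k0].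
    by rewrite addr0 /bincoef big_ord0 mul1r invr1 mulr1 scale1r.
  have {}k0 : (k != 0 :> nat)%N by apply: contra_neq k0 => e; apply: val_inj.
  by rewrite expr0n (negPf k0) mulr0 scale0r.
rewrite -[RHS]H0 -[mxlog _]/((fun r => mxlog (mxpowinv r X)) 0).
apply: (@polymx_eq_invS _ _ _ (fun r => mxlog (mxpowinv r X)) H) => [||k].
- by apply/log_poly/polymx_mxpowinv; [apply: polyfun_id|apply: polymx_const].
- apply: polymx_sum => k; apply: polymxZ; last exact: polymx_const.
  apply: polyfunM (polyfun_const _) _.
  by exists 'X^k => c; rewrite hornerXn.
have k0 : k.+1%:R != 0 :> F by rewrite pnatr_eq0.
have hu : mxunip (1 + k.+1%:R^-1 *: X).
  by rewrite /mxunip [1 + _]addrC addrK scalemx_exp hX scaler0.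
rewrite mxpowinvE ?invr_eq0 // invrK mxpow_nat // mxlog_expr //.
rewrite /mxlog /mxpow1 [1 + _ *: X]addrC addrK scaler_sumr; apply: eq_bigr => j _.
rewrite scalemx_exp !scalerA; congr (_ *: _).
have mx := mulfV k0; move: k0 mx; set y := k.+1%:R; set x := y^-1 => k0 mx.
transitivity ((y * x) * (bincoef j 0 * x ^+ j)); last by rewrite mx mul1r.
by rewrite exprS; ring.
Qed.

(* Trotter's formula: H r is ((u ^ r) (v ^ r)) ^ (1 / r). *)
Lemma mx_trotter u v : mxunip u -> mxunip v ->
  (forall r, mxunip (mxpow u r * mxpow v r)) ->
  (mxlog u + mxlog v) ^+ n = 0 /\ exists H : F -> M, [/\ polymx H,
    forall m : nat, H m.+1%:R^-1 = (mxpow u m.+1%:R^-1 * mxpow v m.+1%:R^-1) ^+ m.+1 &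
    H 0 = mxexp (mxlog u + mxlog v)].
Proof.
move=> hu hv huv.
(* [N r] is (u^r v^r - 1)/r; it is polynomial in r and its value at 0 is the sum of the
   logarithms. *)
pose N r := mxpow1 u r + mxpow1 v r + r *: (mxpow1 u r * mxpow1 v r).
have NE r : 1 + r *: N r = mxpow u r * mxpow v r.
  rewrite /N /mxpow mulrDl mul1r mulrDr mulr1 scalemxMl scalemxMr !scalerDr !scalerA.
  by rewrite -!addrA; congr (_ + _); rewrite addrCA.
have N0 : N 0 = mxlog u + mxlog v by rewrite /N scale0r addr0.
have Npoly : polymx N.
  apply: polymxD; first by apply: polymxD; apply: polymx_mxpow1.
  by apply: polymxZ; [apply: polyfun_id|apply: polymxM; apply: polymx_mxpow1].
split.
  rewrite -N0; apply: (@polymx_eq_invS _ _ _ (fun r => N r ^+ n) (fun=> 0)) => [||k].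
  - exact: polymxX.
  - exact: polymx_const.
  have k0 : k.+1%:R^-1 ^+ n != 0 :> F by rewrite expf_neq0 // invr_eq0 pnatr_eq0.
  apply: (scalerI k0); rewrite scaler0 -scalemx_exp.
  by have := huv k.+1%:R^-1; rewrite -NE /mxunip [1 + _]addrC addrK.
exists (fun r => mxpowinv r (N r)); split; last by rewrite N0.
  by apply: polymx_mxpowinv => //; apply: polyfun_id.
move=> m; have m0 : m.+1%:R != 0 :> F by rewrite pnatr_eq0.
by rewrite mxpowinvE ?invr_eq0 // invrK NE mxpow_nat.
Qed.

End MatrixExp.

(** * Nilpotent matrices and Kolchin's theorem *)

Section Nilpotent.
Variable F : numClosedFieldType.

Lemma nilpotent_char_poly n k (A : 'M[F]_n) : A ^+ k = 0 -> char_poly A = 'X^n.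
Proof.
move=> hA; have [rs] := closed_field_poly_normal (char_poly A).
have /monicP -> := char_poly_monic A; rewrite scale1r => E.
have srs : size rs = n.
  by have := size_char_poly A; rewrite E size_prod_XsubC => - [].
rewrite E -[X in 'X^X]srs.
have : forall z, z \in rs -> z = 0.
  move=> z zrs; have : root (char_poly A) z by rewrite E root_prod_XsubC.
  rewrite -eigenvalue_root_char => /eigenvalueP [v vA v0].
  have vAk l : v *m A ^+ l = z ^+ l *: v.
    elim: l => [|l IHl]; first by rewrite !expr0 mulmx1 scale1r.
    by rewrite exprS mulmxA vA -scalemxAl IHl scalerA -exprS.
  have /esym/eqP := vAk k; rewrite hA mulmx0 scaler_eq0 (negPf v0) orbF.
  by rewrite expf_eq0 => /andP[_ /eqP].
elim: rs {E srs} => [|z s IHs] h; first by rewrite big_nil.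
rewrite big_cons (h z) ?mem_head // subr0 IHs ?exprS // => y ys.
by apply: h; rewrite inE ys orbT.
Qed.

Lemma nilpotent_mx n k (A : 'M[F]_n) : A ^+ k = 0 -> A ^+ n = 0 /\ \tr A = 0.
Proof.
case: n A => [|n] A hA.
  by split; [apply/matrixP => - []|rewrite /mxtrace big_ord0].
have E := nilpotent_char_poly hA; split.
  by have := Cayley_Hamilton A; rewrite E rmorphXn /= horner_mx_X.
have := char_poly_trace A isT; rewrite E coefXn /= ltn_eqF // => /eqP.
by rewrite eq_sym oppr_eq0 => /eqP.
Qed.

(** The characteristic polynomial of [1 - A] is ['X^n]; its value at 1 is the determinant of A. *)
Lemma unipotent_det n k (A : 'M[F]_n) : (A - 1) ^+ k = 0 -> \det A = 1.
Proof.
move=> hA; have hN : (1 - A) ^+ k = 0.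
  by rewrite -opprB -scaleN1r scalemx_exp hA scaler0.
have := congr1 (horner_eval 1) (nilpotent_char_poly hN).
rewrite {2}/horner_eval hornerXn expr1n -det_map_mx => <-; congr (\det _).
apply/matrixP => i j; rewrite !mxE /= /horner_eval !hornerE hornerMn hornerX.
by rewrite opprB addrC subrK.
Qed.

Lemma idempotent_trace n (e : 'M[F]_n) : e *m e = e -> \tr e = (\rank e)%:R.
Proof.
move=> ee; have bc : row_base e *m col_base e = 1%:M.
  apply: (row_free_inj (row_base_free e)); apply: (row_full_inj (col_base_full e)).
  rewrite mul1mx -[X in _ = X]/(col_base e *m row_base e) mulmx_base.
  transitivity ((col_base e *m row_base e) *m (col_base e *m row_base e)).
    by rewrite !mulmxA.
  by rewrite mulmx_base.
by rewrite -[X in \tr X]mulmx_base mxtrace_mulC bc mxtrace1.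
Qed.

(** The projection [e] onto the part where A is invertible is a polynomial in A without constant
    term, so its trace vanishes; the trace of an idempotent is its rank, hence [e = 0] in
    characteristic 0. *)
Lemma trace_nilpotent n (A : 'M[F]_n) :
  (forall k, \tr (A ^+ k.+1) = 0) -> exists k, A ^+ k = 0.
Proof.
case: n A => [|n] A hA; first by exists 0%N; apply/matrixP => - [].
have [d [g + E]] := multiplicity_XsubC (char_poly A) 0.
rewrite (monic_neq0 (char_poly_monic A)) /= => g0.
have : coprimep ('X ^+ d.+1) g.
  by apply: coprimep_expl; rewrite coprimep_sym -[X in coprimep _ X]subr0 coprimep_XsubC.
move=> /Bezout_eq1_coprimepP [[u v] /= uv1].
pose hm := horner_mx A; pose e : 'M_n.+1 := hm (u * 'X^(d.+1)).
have e1 : 1 - e = hm (v * g) by rewrite -[X in X - e](rmorph1 hm) -uv1 rmorphD addrAC subrr add0r.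
have CH : hm (g * 'X^d) = 0.
  by rewrite -(Cayley_Hamilton A) E subr0.
have ee : e * e = e.
  apply/esym/eqP; rewrite -subr_eq0 -{1}[e]mulr1 -mulrBr e1 -rmorphM.
  have -> : u * 'X^(d.+1) * (v * g) = (u * v * 'X) * (g * 'X^d) by rewrite exprS; ring.
  by rewrite rmorphM /= -/hm CH mulr0.
have tre : \tr e = 0.
  have -> : e = \sum_(i < size u) u`_i *: A ^+ (i + d).+1.
    rewrite /e /hm -{1}[u]coefK poly_def mulr_suml raddf_sum; apply: eq_bigr => i _.
    by rewrite -scalerAl -exprD addnS /= horner_mxZ rmorphXn /= horner_mx_X.
  by rewrite raddf_sum big1 //= => i _; rewrite linearZ /= hA mulr0.
have e0 : e = 0.
  by apply/eqP; rewrite -mxrank_eq0 -(eqr_nat F) -idempotent_trace // tre.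
exists d; have : hm ('X^d) * (1 - e) = 0.
  by rewrite e1 -rmorphM mulrCA [_ * g]mulrC rmorphM /= -/hm CH mulr0.
by rewrite e0 subr0 mulr1 /hm rmorphXn /= horner_mx_X.
Qed.

End Nilpotent.

Section LinearSet.
Variables (F : fieldType) (m : nat).

(** A row space inside S of maximal rank absorbs every vector of S. This turns sets of logarithms
    into row spaces. *)
Lemma linear_set_mx (S : set 'rV[F]_m) : S 0 ->
  (forall a u v, S u -> S v -> S (a *: u + v)) ->
  exists B : 'M[F]_m, forall v, S v <-> (v <= B)%MS.
Proof.
move=> S0 SD; pose P (B : 'M[F]_m) := forall v, (v <= B)%MS -> S v.
pose Q k := `[< exists2 B, P B & \rank B = k >].
have exQ : exists k, Q k.
  exists 0%N; apply/asboolP; exists 0; last by rewrite mxrank0.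
  by move=> v; rewrite submx0 => /eqP ->.
have Qle k : Q k -> (k <= m)%N by move=> /asboolP [B _ <-]; apply: rank_leq_col.
case: (ex_maxnP exQ Qle) => r /asboolP [B PB Br] rmax.
exists B => v; split=> [Sv|/PB//]; apply: contrapT => /negP vB.
have : P (B + v)%MS.
  move=> w /sub_addsmxP [[a b] /= ->].
  rewrite [b]mx11_scalar mul_scalar_mx addrC; apply: SD => //.
  by apply: PB; rewrite submxMl.
move=> PB'; have := rmax (\rank (B + v)%MS) (asboolT (ex_intro2 _ _ _ PB' erefl)).
rewrite -Br leqNgt ltn_neqAle mxrankS ?addsmxSl // andbT.
rewrite negbK eqn_leq => /andP[_ le].
have := (mxrank_leqif_sup (addsmxSl B v)).2; rewrite eqn_leq le mxrankS ?addsmxSl //=.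
by move=> /esym; rewrite addsmx_sub (negPf vB) andbF.
Qed.

End LinearSet.

(** * Kolchin's theorem on common flags of unipotent matrices *)

Section Kolchin.
Variables (F : numClosedFieldType) (n : nat) (D : set 'M[F]_n).
Hypothesis DM : forall A B, D A -> D B -> D (A * B).
Hypothesis Dunip : forall A, D A -> exists k, (A - 1) ^+ k = 0.

(** The span of the [A - 1] with A in D. It is closed under products because (A - 1)(B - 1) = (AB -
    1) - (A - 1) - (B - 1). *)
Inductive augmentation : 'M[F]_n -> Prop :=
 | aug0 : augmentation 0
 | aug_gen a A B : D A -> augmentation B -> augmentation (a *: (A - 1) + B).

Lemma augD A B : augmentation A -> augmentation B -> augmentation (A + B).
Proof.
move=> hA hB; elim: hA => [|a A' B' DA' _ IH]; first by rewrite add0r.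
by rewrite -addrA; apply: aug_gen.
Qed.

Lemma augZ a A : augmentation A -> augmentation (a *: A).
Proof.
elim=> [|b A' B' DA' _ IH]; first by rewrite scaler0; apply: aug0.
by rewrite scalerDr scalerA; apply: aug_gen.
Qed.

Lemma aug1 A : D A -> augmentation (A - 1).
Proof. by move=> DA; have := aug_gen 1 DA aug0; rewrite scale1r addr0. Qed.

Lemma augM A B : augmentation A -> augmentation B -> augmentation (A * B).
Proof.
elim=> [|a A' B' DA' _ IH] hB; first by rewrite mul0r; apply: aug0.
rewrite mulrDl; apply: augD (IH hB); rewrite scalemxMl; apply: augZ => {B' IH A a}.
elim: hB => [|b B' C' DB' _ IH]; first by rewrite mulr0; apply: aug0.
rewrite mulrDr; apply: augD IH; rewrite scalemxMr; apply: augZ.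
have -> : (A' - 1) * (B' - 1) = (A' * B' - 1) + (-1) *: (A' - 1) + (-1) *: (B' - 1).
  by rewrite !scaleN1r mulrBr mulr1 mulrBl mul1r [RHS]addrAC [- (B' - 1)]opprB addrA subrK.
by apply: augD; [apply: augD|]; try apply: augZ; apply: aug1 => //; apply: DM.
Qed.

(** All positive powers of A stay in the span of the [A' - 1], whose traces vanish, so the trace
    criterion applies. *)
Lemma aug_nilpotent A : augmentation A -> exists k, A ^+ k = 0.
Proof.
move=> hA; apply: trace_nilpotent => k.
have : augmentation (A ^+ k.+1).
  elim: k => [//|k IHk]; rewrite exprS; exact: augM.
move: (A ^+ k.+1) => {hA k A} B; elim=> [|a A' B' DA' _ IH]; first exact: raddf0.
rewrite raddfD /= IH addr0 linearZ /=.
by have [k' /nilpotent_mx [_ ->]] := Dunip DA'; rewrite mulr0.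
Qed.

Definition aug_stable (W V : 'M[F]_n) := forall A, augmentation A -> (W *m A <= V)%MS.

(** Take V stable, strictly above W and of minimal rank. For w in V outside W, the translates of w
    by the augmentation together with W form a stable space. If it were larger than W it would be V,
    giving w = w a + u with a nilpotent and u in W; iterating this puts w into W. *)
Lemma kolchin_step (W : 'M[F]_n) : aug_stable W W -> (\rank W < n)%N ->
  exists V : 'M[F]_n, [/\ (W <= V)%MS, (\rank W < \rank V)%N & aug_stable V W].
Proof.
move=> Wst Wn.
pose Q k := `[< exists V : 'M[F]_n, [/\ (W <= V)%MS, (\rank W < \rank V)%N,
   aug_stable V V & \rank V = k] >].
have exQ : exists k, Q k.
  exists n; apply/asboolP; exists 1%:M.
  by rewrite submx1 mxrank1; split=> // A _; apply: submx1.
case: (ex_minnP exQ) => r /asboolP [V [WV rWV Vst <-]] rmin {exQ r}.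
exists V; split=> // A hA; apply/row_subP => i; rewrite row_mul.
have : (row i V <= V)%MS by apply: row_sub.
move: (row i V) => w wV {i}.
have [wW|nwW] := boolP (w <= W)%MS; first by apply: submx_trans (Wst _ hA); apply: submxMr.
pose S : set 'rV[F]_n := [set v | exists a u, [/\ augmentation a, (u <= W)%MS & v = w *m a + u]].
have [B BE] : exists B : 'M[F]_n, forall v, S v <-> (v <= B)%MS.
  apply: linear_set_mx => [|c _ _ [a [u [ha hu ->]]] [b [v [hb hv ->]]]].
    by exists 0, 0; rewrite mulmx0 addr0 sub0mx; split=> //; apply: aug0.
  exists (c *: a + b), (c *: u + v); split.
  - by apply: augD => //; apply: augZ.
  - by apply: addmx_sub => //; apply: scalemx_sub.
  - by rewrite mulmxDr -scalemxAr scalerDr addrACA.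
have WB : (W <= B)%MS.
  apply/row_subP => i; apply/BE; exists 0, (row i W).
  by rewrite mulmx0 add0r row_sub; split=> //; apply: aug0.
have BV : (B <= V)%MS.
  apply/rV_subP => v /BE [a [u [ha uW ->]]]; apply: addmx_sub.
    by apply: submx_trans (Vst _ ha); apply: submxMr.
  exact: submx_trans WV.
have Bst : aug_stable B B.
  move=> C hC; apply/rV_subP => v /submxP [x ->]; rewrite mulmxA.
  have /BE [a [u [ha uW ->]]] : (x *m B <= B)%MS by apply: submxMl.
  apply/BE; exists (a * C), (u *m C); split; first exact: augM.
    by apply: submx_trans (Wst _ hC); apply: submxMr.
  by rewrite mulmxDl mulmxA.
have wAB : (w *m A <= B)%MS by apply/BE; exists A, 0; rewrite addr0 sub0mx.
have [lt|ge] := ltnP (\rank W) (\rank B); last first.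
  apply: submx_trans wAB _; have := (mxrank_leqif_sup WB).2.
  by rewrite eqn_leq ge mxrankS // => /esym.
have VB : (V <= B)%MS.
  have := rmin (\rank B) (asboolT (ex_intro _ B (And4 WB lt Bst erefl))) => le.
  have := (mxrank_leqif_sup BV).2.
  by rewrite eqn_leq le mxrankS // => /esym.
have /BE [a [u [ha uW e]]] := submx_trans wV VB.
exfalso; move/negP: nwW; apply; have [k ak] := aug_nilpotent ha.
suff [u' [u'W ->]] : exists u', (u' <= W)%MS /\ w = w *m a ^+ k + u'.
  by rewrite ak mulmx0 add0r.
elim: {ak} k => [|k [u' [u'W e']]]; first by exists 0; rewrite expr0 mulmx1 addr0 sub0mx.
exists (u' *m a + u); split; first by apply: addmx_sub => //; apply: submx_trans (Wst _ ha); apply: submxMr.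
by rewrite {1}e {1}e' mulmxDl exprSr mulmxA addrA.
Qed.

Theorem kolchin : exists W : nat -> 'M[F]_n, [/\ W 0%N = 0,
  forall i, (W i <= W i.+1)%MS, row_full (W n) &
  forall i A, D A -> (W i.+1 *m (A - 1) <= W i)%MS].
Proof.
(* The rank grows by one at each step until it reaches n and then stays there, so the n-th space is
   full whatever the actual length of the flag. *)
have next (W : 'M[F]_n) : exists V : 'M[F]_n, aug_stable W W ->
    [/\ (W <= V)%MS, (minn n (\rank W).+1 <= \rank V)%N & aug_stable V W].
  have [Wst|] := pselect (aug_stable W W); last by exists 0.
  have [lt|ge] := ltnP (\rank W) n.
    have [V [WV rk Vst]] := kolchin_step Wst lt; exists V => _; split=> //.
    by rewrite geq_min rk orbT.
  by exists W => _; split=> //; rewrite geq_min ge.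
have [nx nxP] := choice next; pose W i := iter i nx 0.
have Wst i : aug_stable (W i) (W i).
  elim: i => [|i IHi] A hA; first by rewrite mul0mx sub0mx.
  have [WV _ Vst] := nxP _ IHi; exact: submx_trans (Vst _ hA) WV.
have rk i : (minn n i <= \rank (W i))%N.
  elim: i => [|i IHi]; first by rewrite minn0.
  have [_ h _] := nxP _ (Wst i); apply: leq_trans h.
  by move: IHi; rewrite -/(W i); lia.
exists W; split=> // [i||i A DA].
- by have [] := nxP _ (Wst i).
- by rewrite /row_full eqn_leq rank_leq_row; have := rk n; rewrite minnn.
- by have [_ _] := nxP _ (Wst i); apply; apply: aug1.
Qed.

End Kolchin.

(** * The filtration of matrices by how far they lower a flag *)

Section FlagFiltration.
Variables (F : fieldType) (n : nat) (W : nat -> 'M[F]_n).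
Hypotheses (W0 : W 0%N = 0) (WS : forall i, (W i <= W i.+1)%MS) (Wn : row_full (W n)).
Implicit Types A B : 'M[F]_n.

(** A lowers the flag by a steps, acting on row vectors from the right. The same count bounds the
    nilpotency class of the group and the degree of its matrix coefficients. *)
Definition flagfilt a A := forall i, (W (i + a) *m A <= W i)%MS.

Lemma flagfiltM a b A B : flagfilt a A -> flagfilt b B -> flagfilt (a + b) (A * B).
Proof.
move=> hA hB i; rewrite addnA addnAC mulmxA.
exact: submx_trans (submxMr _ (hA _)) (hB _).
Qed.

Lemma flagfiltD a A B : flagfilt a A -> flagfilt a B -> flagfilt a (A + B).
Proof. by move=> hA hB i; rewrite mulmxDr addmx_sub. Qed.

Lemma flagfiltN a A : flagfilt a A -> flagfilt a (- A).
Proof. by move=> hA i; rewrite mulmxN eqmx_opp. Qed.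

Lemma flagfilt1 : flagfilt 0 1.
Proof. by move=> i; rewrite addn0 mulmx1. Qed.

Lemma flagfiltW a A : flagfilt a.+1 A -> flagfilt a A.
Proof.
move=> hA i; apply: submx_trans (hA i); apply: submxMr.
by rewrite addnS; apply: WS.
Qed.

Lemma flagfilt_top A : flagfilt n A -> A = 0.
Proof.
move=> /(_ 0%N); rewrite add0n W0 submx0 => /eqP h.
by apply: (row_full_inj Wn); rewrite h mulmx0.
Qed.

End FlagFiltration.

(** * Functions on iterated central extensions *)

Section FunAlgebra.
Variables (F : numFieldType) (T : Type) (D : set T).

(** Functions are total but matter only on D, whence the closure under equality on D. Regular
    functions, Laurent polynomials and polynomials in one variable are all instances. *)
Definition fun_algebra (A : set (T -> F)) :=
  [/\ forall c, A (fun=> c),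
      forall f g, A f -> A g -> A (fun x => f x + g x),
      forall f g, A f -> A g -> A (fun x => f x * g x) &
      forall f g, (forall x, D x -> f x = g x) -> A f -> A g].

Lemma fun_algebra_sum A (I : Type) (r : seq I) (f : I -> T -> F) : fun_algebra A ->
  (forall i, A (f i)) -> A (fun x => \sum_(i <- r) f i x).
Proof.
move=> [Ac AD _ _] h; elim: r => [|i r IHr].
  by under eq_fun do rewrite big_nil; apply: Ac.
by under eq_fun do rewrite big_cons; apply: AD.
Qed.

Lemma fun_algebra_prod A (I : Type) (r : seq I) (f : I -> T -> F) : fun_algebra A ->
  (forall i, A (f i)) -> A (fun x => \prod_(i <- r) f i x).
Proof.
move=> [Ac _ AM _] h; elim: r => [|i r IHr].
  by under eq_fun do rewrite big_nil; apply: Ac.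
by under eq_fun do rewrite big_cons; apply: AM.
Qed.

Lemma fun_algebra_exp A f k : fun_algebra A -> A f -> A (fun x => f x ^+ k).
Proof.
move=> [Ac _ AM _] Af; elim: k => [|k IHk].
  by under eq_fun do rewrite expr0; apply: Ac.
by under eq_fun do rewrite exprS; apply: AM.
Qed.

Lemma fun_algebra_meval A n (h : 'I_n -> T -> F) (p : {mpoly F[n]}) : fun_algebra A ->
  (forall j, A (h j)) -> A (fun x => p.@[fun j => h j x]).
Proof.
move=> Aalg Ah; have [Ac _ AM _] := Aalg; under eq_fun do rewrite mevalE.
apply: fun_algebra_sum => // m; apply: AM; first exact: Ac.
by apply: fun_algebra_prod => // j; apply: fun_algebra_exp.
Qed.

Lemma fun_algebraB A f g : fun_algebra A -> A f -> A g -> A (fun x => f x - g x).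
Proof.
move=> [Ac AD AM _] Af Ag; apply: AD => //.
by under eq_fun do rewrite -mulN1r; apply: AM => //; apply: Ac.
Qed.

End FunAlgebra.

Lemma fun_algebra_polyfun (F : numFieldType) (D : set F) : (forall c, D c) ->
  fun_algebra D (@polyfun F).
Proof.
move=> Dall; split=> [c|f g|f g|f g h].
- exact: polyfun_const.
- exact: polyfunD.
- exact: polyfunM.
- by apply: polyfun_ext => c; apply: h.
Qed.

Section Subgroups.
Variables (G : groupType) (V : set G).
Hypothesis Vgrp : is_subgroup V.

Lemma subgroup1 : V 1%g. Proof. by have [] := Vgrp. Qed.

Lemma subgroupV x : V x -> V x^-1%g.
Proof. by have [V1 VD] := Vgrp => Vx; rewrite -[x^-1%g]mul1g; apply: VD. Qed.

Lemma subgroupM x y : V x -> V y -> V (x * y)%g.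
Proof.
by have [_ VD] := Vgrp => Vx Vy; rewrite -[y]invgK; apply: VD => //; apply: subgroupV.
Qed.

Lemma subgroupX x m : V x -> V (x ^+ m)%g.
Proof.
move=> Vx; elim: m => [|m IHm]; first by rewrite expg0; apply: subgroup1.
by rewrite expgS; apply: subgroupM.
Qed.

Definition normal_in (W : set G) :=
  [/\ is_subgroup W, W `<=` V & forall v w, V v -> W w -> W (v * w * v^-1)%g].

End Subgroups.

Section Slices.
Variables (F : numFieldType) (G : groupType) (V : set G).
Hypothesis Vgrp : is_subgroup V.
Let V1 := subgroup1 Vgrp.
Let VM := subgroupM Vgrp.
Let VV := subgroupV Vgrp.
Implicit Types (a b f : G -> F) (W : set G) (e : F -> G) (A B M : set (G -> F)).

Definition rdiff w f : G -> F := fun v => f (v * w)%g - f v.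

(* f is polynomial of degree < q on V in the sense of iterated differences *)
Fixpoint degree_lt q f := if q is k.+1 then forall w, V w -> degree_lt k (rdiff w f)
  else forall v, V v -> f v = 0.

Lemma degree_lt_ext q f h : (forall v, V v -> f v = h v) -> degree_lt q f -> degree_lt q h.
Proof.
elim: q f h => [|q IHq] f h e fq; first by move=> v Vv; rewrite -e ?fq.
move=> w Vw; apply: IHq (fq w Vw) => v Vv; rewrite /rdiff !e //; exact: VM.
Qed.

Lemma degree_ltS q f : degree_lt q f -> degree_lt q.+1 f.
Proof.
elim: q f => [|q IHq] f fq w Vw; last by apply: IHq; apply: fq.
by move=> v Vv; rewrite /rdiff !fq ?subrr //; apply: VM.
Qed.

Lemma degree_lt_le p q f : (p <= q)%N -> degree_lt p f -> degree_lt q f.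
Proof.
by move=> /subnK <- h; elim: (q - p)%N => // k IHk; rewrite addSn; apply: degree_ltS.
Qed.

Lemma degree_ltD q f h : degree_lt q f -> degree_lt q h -> degree_lt q (fun v => f v + h v).
Proof.
elim: q f h => [|q IHq] f h fq hq; first by move=> v Vv; rewrite fq ?hq ?addr0.
move=> w Vw; apply: degree_lt_ext (IHq _ _ (fq w Vw) (hq w Vw)) => v Vv.
by rewrite /rdiff; ring.
Qed.

Lemma degree_lt_const c : degree_lt 1 (fun=> c).
Proof. by move=> w Vw v Vv; rewrite /rdiff subrr. Qed.

(** Discrete Leibniz rule, by induction on the sum of the two bounds. *)
Lemma degree_ltM p q f h : degree_lt p f -> degree_lt q h ->
  degree_lt (p + q) (fun v => f v * h v).
Proof.
move eN : (p + q)%N => N; elim: N p q eN f h => [|N IHN] [|p] [|q] // eN f h fp hq;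
  try by apply: (degree_lt_le (leq0n _)) => v Vv; rewrite ?fp ?hq // ?mul0r ?mulr0.
have eN1 : (p + q.+1)%N = N by move: eN; rewrite addSn => - [].
have eN2 : (p.+1 + q)%N = N by rewrite -eN1 addSnnS.
move=> w Vw; have fw := fp w Vw; have hw := hq w Vw.
apply: degree_lt_ext (degree_ltD (IHN _ _ eN1 _ _ fw (degree_ltS hw))
  (degree_ltD (IHN _ _ eN1 _ _ fw hq) (IHN _ _ eN2 _ _ fp hw))) => v Vv.
by rewrite /rdiff; ring.
Qed.

Definition rinvariant W f := forall v w, V v -> W w -> f (v * w)%g = f v.

Definition oneparam e := (forall c, V (e c)) /\ forall c d : F, e (c + d) = (e c * e d)%g.

(** The commutator left behind when [e c] is moved past an element on its right. It stands at the
    right end of the product, where a W-invariant function ignores it. *)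
Definition central_mod W e :=
  forall v c, V v -> W ((e c)^-1 * v^-1 * e c * v)%g.

Definition ext W e : set G := [set x | exists w c, W w /\ x = (w * e c)%g].

Lemma oneparam0 e : oneparam e -> e 0 = 1%g.
Proof. by move=> [_ eD]; apply: (mulgI (e 0)); rewrite -eD addr0 mulg1. Qed.

Lemma oneparamN e c : oneparam e -> e (- c) = (e c)^-1%g.
Proof.
move=> he; have [_ eD] := he; apply: (mulgI (e c)).
by rewrite -eD subrr mulgV oneparam0.
Qed.

Lemma central_mod' W e v c : oneparam e -> is_subgroup W -> central_mod W e -> V v ->
  W (v * e c * v^-1 * (e c)^-1)%g.
Proof.
move=> he Wg cent Vv; have := cent v^-1%g (- c) (VV Vv).
rewrite oneparamN // !invgK => /(subgroupV Wg).
by rewrite !invgM !invgK !mulgA.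
Qed.

Lemma sub_ext W e : oneparam e -> W `<=` ext W e.
Proof. by move=> he w Ww; exists w, 0; rewrite oneparam0 // mulg1. Qed.

Lemma ext_normal W e : normal_in V W -> oneparam e -> central_mod W e ->
  normal_in V (ext W e).
Proof.
move=> [Wg WV Wn] he cent; have [eV eD] := he.
split; first split.
- by exists 1%g, 0; rewrite oneparam0 // mulg1; split=> //; apply: subgroup1.
- move=> _ _ [w [c [Ww ->]]] [w' [c' [Ww' ->]]].
  exists (w * (e (c - c') * w'^-1 * (e (c - c'))^-1))%g, (c - c'); split.
    by apply: (subgroupM Wg) => //; apply: Wn => //; apply: subgroupV.
  by rewrite invgM -!mulgA mulVg mulg1 !mulgA eD oneparamN // !mulgA.
- by move=> _ [w [c [Ww ->]]]; apply: VM => //; apply: WV.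
- move=> v _ Vv [w [c [Ww ->]]].
  exists (v * w * v^-1 * (v * e c * v^-1 * (e c)^-1))%g, c; split.
    by apply: (subgroupM Wg) => //; [apply: Wn|apply: (central_mod' c he Wg cent Vv)].
  by rewrite !mulgA mulgVK mulgVK.
Qed.

Lemma rinvariant_ext W e f : rinvariant W f -> W `<=` V ->
  (forall v c, V v -> f (v * e c)%g = f v) -> rinvariant (ext W e) f.
Proof.
move=> Wf WV ef v _ Vv [w [c [Ww ->]]]; rewrite mulgA ef ?Wf //.
by apply: VM => //; apply: WV.
Qed.

Lemma rdiff_invariant W f w : normal_in V W -> V w -> rinvariant W f ->
  rinvariant W (rdiff w f).
Proof.
move=> [Wg WV Wn] Vw Wf v x Vv Wx; rewrite /rdiff (Wf v x) //; congr (_ - _).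
have -> : (v * x * w = v * w * (w^-1 * x * w))%g by rewrite !mulgA mulgK.
rewrite Wf //; first exact: VM.
by have := Wn _ _ (VV Vw) Wx; rewrite invgK.
Qed.

Definition transl_algebra B := fun_algebra V B /\
  forall b w, B b -> V w -> B (fun v => b (v * w)%g).

Definition invariants B W := [set b | B b /\ rinvariant W b].

Definition separates B W := forall v v', V v -> V v' ->
  (forall b, invariants B W b -> b v = b v') -> W (v^-1 * v')%g.

Lemma rdiff_alg B w b : transl_algebra B -> V w -> B b -> B (rdiff w b).
Proof. by move=> [Balg Btr] Vw Bb; apply: (fun_algebraB Balg (Btr _ _ Bb Vw) Bb). Qed.

Lemma rdiff_invariants B W w b : normal_in V W -> transl_algebra B -> V w ->
  invariants B W b -> invariants B W (rdiff w b).
Proof.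
by move=> Wn Bt Vw [Bb Wb]; split; [apply: rdiff_alg|apply: rdiff_invariant].
Qed.

(** A coordinate along the central direction [e], which trivializes the passage from V modulo W to V
    modulo [ext W e]. *)
Definition slice W e s := forall v c, V v -> s (v * e c)%g = s v + c.

Section Step.
Variables (W : set G) (e : F -> G).
Hypotheses (Wn : normal_in V W) (he : oneparam e) (cent : central_mod W e).
Let eV := proj1 he.
Let eD := proj2 he.

Definition ray_poly B := forall b v, B b -> V v -> polyfun (fun c => b (v * e c)%g).

Lemma eS m : e m.+1%:R = (e m%:R * e 1)%g.
Proof. by rewrite -natr1 eD. Qed.

(** Along integer multiples this is a telescoping sum of equal increments; polynomiality along the
    ray extends it to every c. *)
Lemma ray_linear B b a : ray_poly B -> B b ->
  (forall v, V v -> rdiff (e 1) b v = a v) -> (forall v c, V v -> a (v * e c)%g = a v) ->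
  forall v c, V v -> b (v * e c)%g = b v + c * a v.
Proof.
move=> Bp Bb ba ae v c Vv; move: c; apply: polyfun_eq_nat => [||m].
- exact: Bp.
- apply: polyfunD (polyfun_const _) _; apply: polyfunM; last exact: polyfun_const.
  exact: polyfun_id.
elim: m => [|m IHm]; first by rewrite oneparam0 // mulg1 mul0r addr0.
have /eqP := ba _ (VM Vv (eV m%:R)).
rewrite /rdiff subr_eq => /eqP; rewrite eS mulgA => ->.
by rewrite ae // IHm -natr1; ring.
Qed.

(** If the slope a is constant, dividing by it gives a slice. Otherwise b and a are replaced by
    their differences under some w: the affine relation persists because [e] is central modulo W,
    and the degree of the slope drops. *)
Lemma slice_normalize B q b a : transl_algebra B ->
  invariants B W b -> invariants B W a -> (forall v c, V v -> b (v * e c)%g = b v + c * a v) ->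
  degree_lt q a -> (exists2 v, V v & a v != 0) -> exists2 s, invariants B W s & slice W e s.
Proof.
move=> Bt; have [Balg Btr] := Bt; have [BC _ BM _] := Balg.
elim: q b a => [|q IHq] b a Bb Ba ba aq [v0 Vv0 av0]; first by rewrite aq ?eqxx in av0.
have [ac|] := pselect (forall w v, V w -> V v -> rdiff w a v = 0).
  have a1 v : V v -> a v = a 1%g.
    by move=> Vv; have := ac v 1%g Vv V1; rewrite /rdiff mul1g => /eqP; rewrite subr_eq0 => /eqP.
  exists (fun v => (a 1%g)^-1 * b v).
    split; first by apply: BM => //; case: Bb.
    by case: Bb => _ h v w Vv Ww; rewrite h.
  move=> v c Vv; rewrite ba // a1 // mulrDr mulrCA mulVf ?mulr1 //.
  by rewrite -(a1 v0).
move=> /existsNP [w /existsNP [v /not_implyP [Vw /not_implyP [Vv /eqP nz]]]].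
apply: (IHq (rdiff w b) (rdiff w a)); rewrite ?rdiff_invariants //.
- exact: rdiff_invariants.
- exact: rdiff_invariants.
- move=> v' c Vv'; rewrite /rdiff ba //.
  have -> : (v' * e c * w = v' * w * e c * ((e c)^-1 * w^-1 * e c * w))%g.
    by rewrite !mulgA mulgK mulgK.
  have [_ ->] := Bb; rewrite ?ba //; first by ring.
  + exact: VM.
  + by apply: VM => //; apply: VM.
  + exact: cent.
- exact: aq.
- by exists v.
Qed.

(** As B separates the cosets of W, some W-invariant b varies along [e]. Differences under [e 1]
    lower its degree until the next difference is constant along [e]; then b is affine along [e]
    with nonzero slope. *)
Lemma slice_exists B c0 : transl_algebra B -> ray_poly B ->
  (forall b, B b -> exists q, degree_lt q b) -> separates B W -> ~ W (e c0) ->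
  exists2 s, invariants B W s & slice W e s.
Proof.
move=> Bt Bp Bdeg sep We.
have [b Bb be] : exists2 b, invariants B W b & ~ (forall v c, V v -> b (v * e c)%g = b v).
  apply: contrapT => /forall2NP h; apply: We.
  have := sep 1%g (e c0) V1 (eV c0); rewrite invg1 mul1g; apply=> b Bb.
  have [//|/contrapT hb] := h b; rewrite -[e c0]mul1g hb //.
have [q bq] := Bdeg b (proj1 Bb).
elim: q b bq Bb be => [|q IHq] b bq Bb be.
  by exfalso; apply: be => v c Vv; rewrite !bq //; apply: VM.
have Ba : invariants B W (rdiff (e 1) b) by apply: rdiff_invariants.
have aq : degree_lt q (rdiff (e 1) b) by apply: bq.
have [ae|] := pselect (forall v c, V v -> rdiff (e 1) b (v * e c)%g = rdiff (e 1) b v);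
  last exact: IHq.
have lin := ray_linear Bp (proj1 Bb) (fun v _ => erefl) ae.
apply: (slice_normalize Bt Bb Ba lin aq); apply: contrapT => /forall2NP nz.
apply: be => v c Vv; rewrite lin //; have [//|/negP] := nz v.
by rewrite negbK => /eqP ->; rewrite mulr0 addr0.
Qed.

Fixpoint binpoly k (x : F) : F := if k is j.+1 then binpoly j x * (x - j%:R) / j.+1%:R else 1.

Lemma binpolyE k x : binpoly k.+1 x = binpoly k x * (x - k%:R) / k.+1%:R.
Proof. by []. Qed.

Lemma binpolyS k x : binpoly k.+1 (x + 1) = binpoly k.+1 x + binpoly k x.
Proof.
elim: k => [|k IHk]; first by rewrite /= invr1 !mulr1 !mul1r !subr0.
have k0 : k.+2%:R != 0 :> F by rewrite pnatr_eq0.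
apply: (mulIf k0); rewrite mulrDl [binpoly k.+2 (x + 1)]binpolyE [binpoly k.+2 x]binpolyE.
rewrite !mulfVK // IHk mulrDl.
have k1 : k.+1%:R != 0 :> F by rewrite pnatr_eq0.
have -> : binpoly k x * (x + 1 - k.+1%:R) = binpoly k.+1 x * k.+1%:R.
  by rewrite binpolyE mulfVK // -natr1; ring.
by rewrite -[k.+2%:R]natr1; ring.
Qed.

Lemma iter_rdiff_eq j f g w : V w -> (forall v, V v -> f v = g v) ->
  forall v, V v -> iter j (rdiff w) f v = iter j (rdiff w) g v.
Proof.
move=> Vw fg; elim: j => [//|j IHj] v Vv /=.
by rewrite /rdiff !IHj //; apply: VM.
Qed.

Lemma iter_rdiff_degree q b w : V w -> degree_lt q b -> forall v, V v -> iter q (rdiff w) b v = 0.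
Proof.
move=> Vw; elim: q b => [//|q IHq] b bq v Vv; rewrite iterSr; exact: (IHq _ (bq w Vw)).
Qed.

Lemma iter_rdiff_sub j f g w v : iter j (rdiff w) (fun v => f v - g v) v =
  iter j (rdiff w) f v - iter j (rdiff w) g v.
Proof.
elim: j v => [//|j IHj] v /=; rewrite /rdiff !IHj; ring.
Qed.

(** Newton expansion along [e]: a W-invariant function is a polynomial in the slice with
    coefficients invariant under [ext W e]. Leaving K free allows K to be a subalgebra as well as
    the condition of taking equal values at two points. *)
Lemma slice_decomposition M K s : transl_algebra M -> ray_poly M ->
  (forall b, M b -> exists q, degree_lt q b) ->
  invariants M W s -> slice W e s -> fun_algebra V K -> K s ->
  invariants M (ext W e) `<=` K -> invariants M W `<=` K.
Proof.
move=> Mt Mp Mdeg Ms sl Kalg Ks MK b Mb.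
have [KC KD KM Kext] := Kalg; have [Malg Mtr] := Mt.
have [q bq] := Mdeg b (proj1 Mb).
have {bq} := iter_rdiff_degree (eV 1) bq.
elim: q b Mb => [|j IHj] b Mb bj.
  by apply: (Kext (fun=> 0)) => // v Vv; apply/esym/bj.
pose a := iter j (rdiff (e 1)) b.
have Ma : invariants M W a.
  rewrite /a; elim: (j) => [//|k IHk]; exact: rdiff_invariants.
have ae v c : V v -> a (v * e c)%g = a v.
  move=> Vv; have := @ray_linear M a (fun=> 0) Mp (proj1 Ma) bj (fun _ _ _ => erefl) v c Vv.
  by rewrite mulr0 addr0.
(* The j-th difference of [a * sg j] along [e 1] is again a, so subtracting this product from b
   removes its leading term in s. *)
pose sg k v := binpoly k (s v).
have alg_sg (N : set (G -> F)) k : fun_algebra V N -> N s -> N (sg k).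
  move=> [NC ND NM _] Ns; elim: k => [|k IHk]; first exact: NC.
  rewrite /sg /=; apply: (NM _ _ _ (NC _)); apply: NM => //.
  exact: (ND _ _ Ns (NC _)).
have asg k v : V v -> iter k (rdiff (e 1)) (fun v => a v * sg k v) v = a v.
  elim: k v => [|k IHk] v Vv; first by rewrite /sg /= mulr1.
  rewrite iterSr -[RHS]IHk //; apply: iter_rdiff_eq => // v' Vv'.
  by rewrite /rdiff ae // /sg sl // binpolyS; ring.
have Msg : M (sg j) by apply: alg_sg => //; case: Ms.
have [MC MD MM Mext] := Malg.
have Kb1 : K (fun v => b v - a v * sg j v).
  apply: IHj.
    split; first by apply: (fun_algebraB Malg); [case: Mb|apply: MM => //; case: Ma].
    move=> v w Vv Ww; have [_ ->] // := Mb; have [_ ->] // := Ma.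
    by rewrite /sg; have [_ ->] := Ms.
  by move=> v Vv; rewrite iter_rdiff_sub asg // subrr.
apply: (Kext (fun v => (b v - a v * sg j v) + a v * sg j v)).
  by move=> v _; rewrite subrK.
apply: KD => //; apply: KM; last exact: alg_sg.
apply: MK; split; first by case: Ma.
by apply: rinvariant_ext => //; [case: Ma|case: Wn].
Qed.

Lemma separates_ext B s : transl_algebra B -> ray_poly B ->
  (forall b, B b -> exists q, degree_lt q b) -> separates B W ->
  invariants B W s -> slice W e s -> separates B (ext W e).
Proof.
move=> Bt Bp Bdeg sep Bs sl v v' Vv Vv' eqB.
have [Wg WV _] := Wn.
(* Moving v' along [e] until the slice agrees with its value at v; every W-invariant function then
   agrees at v and v''. *)
pose c := s v - s v'; pose v'' := (v' * e c)%g.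
have Vv'' : V v'' by apply: VM.
have sv : s v = s v'' by rewrite sl // addrCA subrr addr0.
exists (v^-1 * v'')%g, (- c); split; last first.
  by rewrite oneparamN // -!mulgA mulgV mulg1.
apply: sep => // b Bb.
apply: (@slice_decomposition B [set k | k v = k v''] s) b Bb => //.
- split=> //= [f g -> -> //|f g -> -> //|f g fg]; by rewrite !fg.
- move=> b [Bb be] /=; rewrite eqB; last by split.
  rewrite /v'' be //; exists 1%g, c; rewrite mul1g; split=> //; exact: subgroup1.
Qed.

Lemma ext_id : (forall c, W (e c)) -> ext W e = W.
Proof.
have [Wg _ _] := Wn; move=> eW; apply/seteqP; split; last exact: sub_ext.
by move=> _ [w [c [Ww ->]]]; apply: subgroupM.
Qed.

End Step.

(** W' arises from W by adjoining one-parameter subgroups, each central modulo what has been built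
    so far. The subgroup at the top is a fixed index of the induction, which assumes the claim for
    [ext W e] and proves it for W. *)
Inductive reach (P : (F -> G) -> Prop) : set G -> set G -> Prop :=
 | reach_refl W : reach P W W
 | reach_step W e W' : P e -> central_mod W e -> reach P (ext W e) W' -> reach P W W'.

Lemma reach_trans P W1 W2 W3 : reach P W1 W2 -> reach P W2 W3 -> reach P W1 W3.
Proof.
by elim=> // W e W' Pe cent _ IH /IH; exact: reach_step Pe cent.
Qed.

(** At the top all invariants are constants. One step below, the slice can be taken in B because B
    itself separates cosets, and the coefficients of the expansion lie in B by induction. *)
Theorem separating_subalgebra A B P W : transl_algebra A ->
  (forall e, P e -> oneparam e /\ ray_poly e A) ->
  (forall a, A a -> exists q, degree_lt q a) -> transl_algebra B -> B `<=` A ->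
  reach P W V -> normal_in V W -> separates B W -> invariants A W `<=` B.
Proof.
move=> At hP Adeg Bt BA; move eV0 : {1}V => V0 h; elim: h eV0 => [W0|W0 e W' Pe cent _ IH] eV0 Wn sep.
  move=> a [Aa ai]; have [[BC _ _ Bext] _] := Bt.
  apply: (Bext (fun=> a 1%g)) (BC _) => v Vv.
  by rewrite -[v]mul1g ai // -eV0.
have [he ep] := hP _ Pe.
have epB : ray_poly e B by move=> b v /BA Ab Vv; apply: ep.
have Bdeg b : B b -> exists q, degree_lt q b by move=> /BA; apply: Adeg.
have [eW|/existsNP [c0 nW]] := pselect (forall c, W0 (e c)).
  by rewrite (ext_id Wn he eW) in IH; apply: IH.
have [s Bs sl] := slice_exists Wn he cent Bt epB Bdeg sep nW.
apply: (@slice_decomposition _ _ Wn he A B s) => //.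
- by case: Bs => Bs si; split=> //; apply: BA.
- by case: Bt.
- by case: Bs.
- apply: IH => //; first exact: ext_normal.
  exact: (separates_ext Wn he Bt epB Bdeg sep Bs sl).
Qed.

(** The map psi is defined on all of V but agrees with [theta] only on W. Splitting off the factor
    [e (s v)], where [theta] is under control, enlarges the agreement to [ext W e]. *)
Theorem extend_along_reach A P W (theta : G -> G) (Mor : set (G -> G)) : transl_algebra A ->
  (forall e, P e -> oneparam e /\ ray_poly e A) ->
  (forall a, A a -> exists q, degree_lt q a) ->
  {morph theta : x y / (x * y)%g} ->
  (forall e s psi, P e -> A s -> Mor psi ->
    Mor (fun v => psi (v * (e (s v))^-1) * theta (e (s v)))%g) ->
  reach P W V -> normal_in V W -> separates A W ->
  (exists2 psi, Mor psi & forall w, W w -> psi w = theta w) ->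
  exists2 psi, Mor psi & forall v, V v -> psi v = theta v.
Proof.
move=> At hP Adeg thM hMor; move eV0 : {1}V => V0 h.
elim: h eV0 => [W0 <- //|W0 e W' Pe cent _ IH] eV0 Wn sep [psi Mpsi psiE].
have [he ep] := hP _ Pe.
have [eW|/existsNP [c0 nW]] := pselect (forall c, W0 (e c)).
  by rewrite (ext_id Wn he eW) in IH; apply: IH => //; exists psi.
have [s As sl] := slice_exists Wn he cent At ep Adeg sep nW.
apply: IH => //; first exact: ext_normal.
  exact: (separates_ext Wn he At ep Adeg sep As sl).
(* Normalized to vanish at 1, hence on W, so that [s0 (w * e c)] is exactly c. *)
pose s0 v := s v - s 1%g.
exists (fun v => psi (v * (e (s0 v))^-1) * theta (e (s0 v)))%g.
  apply: hMor => //; case: As => As _; case: At => Aalg _.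
  by apply: (fun_algebraB Aalg) => //; have [Ac _ _ _] := Aalg; apply: Ac.
move=> _ [w [c [Ww ->]]].
have [_ WV _] := Wn; have [_ si] := As.
have -> : s0 (w * e c)%g = c.
  have sw : s w = s 1%g by rewrite -(si 1%g w) ?mul1g.
  by rewrite /s0 sl ?sw; [rewrite addrAC subrr add0r|apply: WV].
by rewrite mulgK psiE // thM.
Qed.

End Slices.

(** * Regular functions and morphisms to an ind-group *)

Section Regular.
Variables (R : realType) (T : Type).
Notation C := (R[i]).
Implicit Types (X Y Z : affineVariety R T) (h : T -> C) (A : set T).

Definition regular X : set (T -> C) :=
  [set h | exists p : {mpoly C[vdim X]}, forall x, pts X x -> h x = p.@[coord X x 0]].

Lemma regular_algebra X : fun_algebra (pts X) (regular X).
Proof.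
split=> [c|f g [p pE] [q qE]|f g [p pE] [q qE]|f g fg [p pE]].
- by exists c%:MP => x _; rewrite mevalC.
- by exists (p + q) => x Xx; rewrite mevalD pE ?qE.
- by exists (p * q) => x Xx; rewrite mevalM pE ?qE.
- by exists p => x Xx; rewrite -fg ?pE.
Qed.

Lemma regular_coord X j : regular X (fun x => coord X x 0 j).
Proof. by exists 'X_j => x _; rewrite mevalXU. Qed.

Lemma var_closedP X A : var_closed X A <-> exists S : set (T -> C),
  S `<=` regular X /\ A = [set x | pts X x /\ forall h, S h -> h x = 0].
Proof.
split=> [[AX [S AE]]|[S [Sreg ->]]].
  exists [set h | exists2 p, S p & h = fun x => p.@[coord X x 0]]; split.
    by move=> _ [p _ ->]; exists p.
  apply/seteqP; split=> x /=.
    move=> Ax; split=> [|_ [p Sp ->]]; first exact: AX.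
    have : (coord X @` A) (coord X x) by exists x.
    by rewrite AE; apply.
  move=> [Xx xS]; have : (coord X @` A) (coord X x).
    by rewrite AE => p Sp; apply: (xS (fun x => p.@[coord X x 0])); exists p.
  by move=> [y Ay /(coord_inj (AX _ Ay) Xx) <-].
split; first by move=> x [].
have [S0 XE] := coord_closed X.
exists (S0 `|` [set p | exists2 h, S h & forall x, pts X x -> h x = p.@[coord X x 0]]).
apply/seteqP; split=> [_ [x [Xx xS] <-] p|v vS].
  case=> [S0p|[h Sh hE]]; last by rewrite -hE // xS.
  have : (coord X @` pts X) (coord X x) by exists x.
  by rewrite XE; apply.
have : (coord X @` pts X) v by rewrite XE => p S0p; apply: vS; left.
move=> [x Xx xv]; exists x => //; split=> // h Sh.
by have [p pE] := Sreg _ Sh; rewrite pE // xv; apply: vS; right; exists h.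
Qed.

Lemma var_closed_pts X : var_closed X (pts X).
Proof. by split=> //; apply: coord_closed. Qed.

Lemma var_morphism_regular (T2 : Type) X (Y : affineVariety R T2) (f : T -> T2) :
  var_morphism X Y f <-> (forall x, pts X x -> pts Y (f x)) /\
    forall j, regular X (fun x => coord Y (f x) 0 j).
Proof.
split=> [[fXY [P PE]]|[fXY freg]]; split=> //.
  by move=> j; exists (P j) => x Xx; rewrite PE.
by have [P PE] := choice freg; exists P => x Xx j; apply: PE.
Qed.

(** The coordinates of X are recovered from phi by polynomials P, so the image is cut out by the
    equations of A composed with P together with the relations [Q j] of P equal to the j-th
    coordinate. *)
Lemma zariski_closed_image X A n (phi : T -> 'rV[C]_n) : var_closed X A ->
  (forall j, regular X (fun x => phi x 0 j)) ->
  (forall i, exists p : {mpoly C[n]}, forall x, pts X x -> coord X x 0 i = p.@[phi x 0]) ->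
  zariski_closed (phi @` A).
Proof.
move=> [AX [S AE]] /choice [Q QE] /choice [P PE].
pose Psub := [tuple P i | i < vdim X].
have PsubE (v : 'rV[C]_n) q : (q \mPo Psub).@[v 0] = q.@[(\row_i (P i).@[v 0] : 'rV_(vdim X)) 0].
  by rewrite comp_mpoly_meval; apply: meval_eq => i; rewrite tnth_mktuple mxE.
exists ([set p | exists2 q, S q & p = q \mPo Psub] `|`
        [set p | exists j, p = (Q j \mPo Psub) - 'X_j]).
have coordE x : pts X x -> coord X x = \row_i (P i).@[phi x 0].
  by move=> Xx; apply/rowP => i; rewrite mxE PE.
apply/seteqP; split=> [_ [x Ax <-] p|v vS].
  have Xx := AX _ Ax; case=> [[q Sq ->]|[j ->]].
    rewrite PsubE -coordE //.
    have : (coord X @` A) (coord X x) by exists x.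
    by rewrite AE; apply.
  by rewrite mevalB PsubE -coordE // mevalXU -QE // subrr.
have : (coord X @` A) (\row_i (P i).@[v 0]).
  by rewrite AE => q Sq; rewrite -PsubE; apply: vS; left; exists q.
move=> [x Ax xv]; exists x => //; apply/rowP => j.
rewrite QE; last exact: AX.
apply/eqP; rewrite -subr_eq0 xv -PsubE -[v 0 j](mevalXU (v 0)) -mevalB; apply/eqP/vS.
by right; exists j.
Qed.

Lemma closed_subvariety_crit X Y : pts X `<=` pts Y ->
  (forall j, regular X (fun x => coord Y x 0 j)) ->
  (forall i, exists p : {mpoly C[vdim Y]}, forall x, pts X x -> coord X x 0 i = p.@[coord Y x 0]) ->
  closed_subvariety X Y.
Proof.
move=> XY Yreg XP; split.
- by split=> //; apply: zariski_closed_image (var_closed_pts X) _ _.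
- exact/var_morphism_regular.
- by have [P PE] := choice XP; exists P => x Xx i; apply: PE.
Qed.

Lemma closed_subvariety_sub X Y : closed_subvariety X Y -> pts X `<=` pts Y.
Proof. by move=> [[]]. Qed.

Lemma closed_subvariety_regular X Y h : closed_subvariety X Y -> regular Y h -> regular X h.
Proof.
move=> [[XY _] /var_morphism_regular [_ Yreg] _] [p pE].
have [_ _ _ ext] := regular_algebra X.
apply: (ext (fun x => p.@[fun j => coord Y x 0 j])) => [x Xx|].
  by rewrite pE //; apply: XY.
exact: fun_algebra_meval (regular_algebra X) _.
Qed.

Lemma closed_subvariety_extend X Y h : closed_subvariety X Y -> regular X h ->
  exists p : {mpoly C[vdim Y]}, forall x, pts X x -> h x = p.@[coord Y x 0].
Proof.
move=> [_ _ [P PE]] [p pE]; exists (p \mPo [tuple P i | i < vdim X]) => x Xx.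
rewrite comp_mpoly_meval pE //; apply: meval_eq => i.
by rewrite tnth_mktuple PE.
Qed.

Lemma closed_subvariety_refl X : closed_subvariety X X.
Proof.
apply: closed_subvariety_crit => // [j|i]; first exact: regular_coord.
by exists 'X_i => x _; rewrite mevalXU.
Qed.

Lemma closed_subvariety_trans X Y Z : closed_subvariety X Y -> closed_subvariety Y Z ->
  closed_subvariety X Z.
Proof.
move=> XY YZ; apply: closed_subvariety_crit.
- exact: subset_trans (closed_subvariety_sub XY) (closed_subvariety_sub YZ).
- move=> j; apply: closed_subvariety_regular XY _.
  by apply: closed_subvariety_regular YZ _; apply: regular_coord.
- move=> i; have [p pE] := closed_subvariety_extend XY (regular_coord i).
  have Yp : regular Y (fun x => p.@[coord Y x 0]) by exists p.
  have [q qE] := closed_subvariety_extend YZ Yp.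
  by exists q => x Xx; rewrite pE // qE //; apply: (closed_subvariety_sub XY).
Qed.

Section Restrict.
Variables (X : affineVariety R T) (A : set T) (Aclosed : var_closed X A).

Lemma restrict_inj x y : A x -> A y -> coord X x = coord X y -> x = y.
Proof. by move=> /(proj1 Aclosed) Xx /(proj1 Aclosed) Xy; apply: coord_inj. Qed.

Definition restrict_variety : affineVariety R T :=
  AffineVariety restrict_inj (proj2 Aclosed).

Lemma restrict_closed_subvariety : closed_subvariety restrict_variety X.
Proof.
apply: closed_subvariety_crit => [|j|i]; first by case: Aclosed.
  exact: (@regular_coord restrict_variety).
by exists 'X_i => x _; rewrite mevalXU.
Qed.

End Restrict.

Lemma var_baire X (Z : nat -> set T) : (forall i, var_closed X (Z i)) ->
  (forall i, Z i `<=` Z i.+1) -> pts X `<=` \bigcup_i Z i -> exists i, pts X `<=` Z i.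
Proof.
move=> Zc ZS XZ.
have [||i v|_ [x Xx <-]|i iP] := @zariski_baire R _ (coord X @` pts X) (fun i => coord X @` Z i).
- exact: coord_closed.
- by move=> i; case: (Zc i).
- by move=> [x Zx <-]; exists x => //; apply: ZS.
- by have [i _ Zx] := XZ x Xx; exists i => //; exists x.
exists i => x Xx; have [y Zy e] : (coord X @` Z i) (coord X x) by apply: iP; exists x.
by rewrite -(coord_inj _ Xx e) //; apply: (proj1 (Zc i)).
Qed.

End Regular.

(** * Maps into an ind-group, described by the functions on their source *)

Section GMorphism.
Variables (R : realType) (G : groupType) (FG : indVariety R G).
Hypothesis hG : ind_group setT FG.
Notation C := (R[i]).

Definition embedded (X : affineVariety R G) := exists i, closed_subvariety X (FG i).

Lemma filt_le (V : indVariety R G) i j : (i <= j)%N -> closed_subvariety (V i) (V j).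
Proof.
move=> /subnK <-; elim: (j - i)%N => [|k IHk]; first exact: closed_subvariety_refl.
by apply: closed_subvariety_trans IHk _; rewrite addSn; apply: filtS.
Qed.

Lemma embedded_le X i : embedded X -> exists2 j, (i <= j)%N & closed_subvariety X (FG j).
Proof.
move=> [k Xk]; exists (maxn i k); first exact: leq_maxl.
by apply: closed_subvariety_trans Xk (filt_le _ (leq_maxr _ _)).
Qed.

Lemma ind_pts_all x : exists i, pts (FG i) x.
Proof. by have [_ e _] := hG; have [i _ Vx] : ind_pts FG x by [rewrite e]; exists i. Qed.

Section Class.
Variables (S : Type) (D : set S) (K : set (S -> C)).
Hypothesis Kalg : fun_algebra D K.
Implicit Types phi psi : S -> G.

(** The source is known only through an algebra K of functions on D. One set of lemmas thus covers
    maps from affine varieties, from the line ([polyfun]) and from the punctured line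
    ([laurent]). *)
Definition gmor_at phi i := (forall s, D s -> pts (FG i) (phi s)) /\
  forall j, K (fun s => coord (FG i) (phi s) 0 j).

Definition gmor phi := exists i, gmor_at phi i.

Lemma fun_algebra_regular (T : Type) (X : affineVariety R T) (phi : S -> T) h :
  (forall s, D s -> pts X (phi s)) -> (forall j, K (fun s => coord X (phi s) 0 j)) ->
  regular X h -> K (fun s => h (phi s)).
Proof.
have [_ _ _ ext] := Kalg => phiX Kphi [p pE].
apply: (ext (fun s => p.@[fun j => coord X (phi s) 0 j])) => [s Ds|].
  by rewrite pE //; apply: phiX.
exact: fun_algebra_meval Kalg _.
Qed.

Lemma gmor_at_le phi i j : (i <= j)%N -> gmor_at phi i -> gmor_at phi j.
Proof.
move=> ij [phiV Kphi]; have sub := filt_le FG ij; split=> [s Ds|k].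
  by apply: (closed_subvariety_sub sub); apply: phiV.
apply: (fun_algebra_regular phiV Kphi (h := fun x => coord (FG j) x 0 k)).
by apply: closed_subvariety_regular sub _; apply: regular_coord.
Qed.

Lemma gmor_const x : gmor (fun=> x).
Proof.
have [i ix] := ind_pts_all x; have [KC _ _ _] := Kalg.
by exists i; split=> [//|j]; apply: KC.
Qed.

Lemma gmor_ext phi psi : (forall s, D s -> phi s = psi s) -> gmor phi -> gmor psi.
Proof.
have [_ _ _ ext] := Kalg => e [i [phiV Kphi]]; exists i; split=> [s Ds|j].
  by rewrite -e //; apply: phiV.
by apply: ext (Kphi j) => s Ds; rewrite e.
Qed.

Lemma gmorF phi psi : gmor phi -> gmor psi -> gmor (fun s => phi s * (psi s)^-1)%g.
Proof.
move=> [i hi] [j hj]; pose m := maxn i j.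
have [phiV Kphi] := gmor_at_le (leq_maxl i j) hi.
have [psiV Kpsi] := gmor_at_le (leq_maxr i j) hj.
have [_ _ /(_ m) [l /var_morphism_regular [divV divreg]]] := hG.
exists l; split=> [s Ds|k].
  by apply: (divV (phi s, psi s)); split; [apply: phiV|apply: psiV].
apply: (fun_algebra_regular (X := prod_variety (FG m) (FG m)) (phi := fun s => (phi s, psi s))
  _ _ (divreg k)) => [s Ds|a] /=; first by split; [apply: phiV|apply: psiV].
have [_ _ _ ext] := Kalg.
have [b|b] := split_ordP a => ->.
  by apply: ext (Kphi b) => s Ds; rewrite row_mxEl.
by apply: ext (Kpsi b) => s Ds; rewrite row_mxEr.
Qed.

Lemma gmorV phi : gmor phi -> gmor (fun s => (phi s)^-1)%g.
Proof.
move=> h; apply: gmor_ext (gmorF (gmor_const 1%g) h) => s _; exact: mul1g.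
Qed.

Lemma gmorM phi psi : gmor phi -> gmor psi -> gmor (fun s => phi s * psi s)%g.
Proof.
move=> h1 h2; apply: gmor_ext (gmorF h1 (gmorV h2)) => s _; by rewrite invgK.
Qed.

(** The filtration members containing X and the values of phi may differ, so h is first extended to
    a polynomial on a common larger member. *)
Lemma gmor_regular X phi h : embedded X -> gmor phi -> (forall s, D s -> pts X (phi s)) ->
  regular X h -> K (fun s => h (phi s)).
Proof.
move=> Xe [i hi] phiX hreg; have [j ij Xj] := embedded_le i Xe.
have [phiV Kphi] := gmor_at_le ij hi; have [_ _ _ ext] := Kalg.
have [p pE] := closed_subvariety_extend Xj hreg.
apply: (ext (fun s => p.@[coord (FG j) (phi s) 0])) => [s Ds|].
  by rewrite pE //; apply: phiX.
exact: fun_algebra_meval Kalg _.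
Qed.

Lemma fun_algebra_horner (p : {poly C}) f : K f -> K (fun s => p.[f s]).
Proof.
have [KC KD KM _] := Kalg => Kf; elim/poly_ind: p => [|p c IHp].
  by under eq_fun do rewrite horner0; apply: KC.
by under eq_fun do rewrite hornerMXaddC; apply: (KD _ _ (KM _ _ IHp Kf) (KC c)).
Qed.

End Class.

Lemma gmor_comp_poly (S : Type) (D : set S) (K : set (S -> C)) (e : C -> G) f :
  fun_algebra D K -> gmor setT (@polyfun C) e -> K f -> gmor D K (fun s => e (f s)).
Proof.
move=> Kalg [i [eV epoly]] Kf; exists i; split=> [s _|j]; first exact: eV.
have [p pE] := epoly j; under eq_fun do rewrite pE.
exact: fun_algebra_horner Kalg _ _ Kf.
Qed.

Lemma gmor_comp (S T : Type) (D : set S) (K : set (S -> C)) (X : affineVariety R T)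
    (phi : S -> T) (psi : T -> G) :
  (forall s, D s -> pts X (phi s)) -> (forall h, regular X h -> K (fun s => h (phi s))) ->
  gmor (pts X) (regular X) psi -> gmor D K (fun s => psi (phi s)).
Proof.
move=> phiX Kphi [i [psiV psireg]]; exists i; split=> [s Ds|j].
  by apply: psiV; apply: phiX.
exact: Kphi (psireg j).
Qed.

Lemma gmor_id (X : affineVariety R G) : embedded X -> gmor (pts X) (regular X) id.
Proof.
move=> [i Xi]; exists i; split=> [s|j]; first exact: closed_subvariety_sub Xi _.
by apply: closed_subvariety_regular Xi _; apply: regular_coord.
Qed.

Lemma embedded_sub (X Y : affineVariety R G) : closed_subvariety X Y -> embedded Y -> embedded X.
Proof. by move=> XY [i Yi]; exists i; apply: closed_subvariety_trans XY Yi. Qed.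

Lemma closed_preimage (T : Type) (X : affineVariety R T) (Y : affineVariety R G) A (f : T -> G) :
  embedded Y -> var_closed Y A -> gmor (pts X) (regular X) f ->
  var_closed X [set x | pts X x /\ A (f x)].
Proof.
move=> Ye Ac [i fi].
pose YA := restrict_variety Ac.
have YAe : embedded YA by apply: embedded_sub Ye; apply: restrict_closed_subvariety.
have [j ij YAj] := embedded_le i YAe.
have [fV freg] := gmor_at_le (regular_algebra X) ij fi.
have [cl _ _] := YAj; have /var_closedP [S [Sreg AE]] := cl.
apply/var_closedP; exists [set h | exists2 g, S g & h = fun x => g (f x)]; split.
  by move=> _ [g Sg ->]; apply: (fun_algebra_regular (regular_algebra X) fV freg (Sreg _ Sg)).
apply/seteqP; split=> x /= [Xx]; rewrite -[A (f x)]/(pts YA (f x)) AE /=.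
  by move=> [_ hS]; split=> // _ [g Sg ->]; apply: hS.
move=> hS; split=> //; split=> [|g Sg]; first exact: fV.
by apply: (hS (fun x => g (f x))); exists g.
Qed.

(** By Baire each member of the first filtration lies in a member of the second, and both carry the
    structure induced from [FG]. Applied both ways it gives the uniqueness of the structure of an
    ind-subgroup. *)
Lemma ind_morphism_id (H1 H2 : indVariety R G) : (forall k, embedded (H1 k)) ->
  (forall k, embedded (H2 k)) -> ind_pts H1 `<=` ind_pts H2 -> ind_morphism H1 H2 id.
Proof.
move=> e1 e2 sub k.
have [i|i x [Hx Hx']|x Hx|j jP] := @var_baire _ _ (H1 k) (fun i => [set x | pts (H1 k) x /\ pts (H2 i) x]).
- exact: closed_preimage (e2 i) (var_closed_pts _) (gmor_id (e1 k)).
- by split=> //; apply: (closed_subvariety_sub (filtS H2 i)).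
- have [i _ Hi] : ind_pts H2 x by apply: sub; exists k.
  by exists i.
exists j; apply/var_morphism_regular; split=> [x /jP []//|l].
have h := @gmor_regular _ _ _ (regular_algebra (H1 k)) (H2 j) id
  (fun x => coord (H2 j) x 0 l) (e2 j) (gmor_id (e1 k)).
by apply: h => [x /jP []//|]; apply: regular_coord.
Qed.

End GMorphism.

(** * Laurent polynomials *)

Section Laurent.
Variable F : numClosedFieldType.
Implicit Types (h : F -> F) (p q : {poly F}).

Definition laurent h := exists M p, forall z, z != 0 -> z ^+ M * h z = p.[z].

Lemma laurent_algebra : fun_algebra [set z : F | z != 0] laurent.
Proof.
split=> [c|f g [M [p pE]] [N [q qE]]|f g [M [p pE]] [N [q qE]]|f g fg [M [p pE]]].
- by exists 0%N, c%:P => z _; rewrite expr0 mul1r hornerC.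
- exists (M + N)%N, ('X^N * p + 'X^M * q) => z z0.
  by rewrite !hornerE -pE // -qE // exprD; ring.
- by exists (M + N)%N, (p * q) => z z0; rewrite hornerM -pE // -qE // exprD; ring.
- by exists M, p => z z0; rewrite -fg // pE.
Qed.

Lemma laurent_id : laurent id.
Proof. by exists 0%N, 'X => z _; rewrite expr0 mul1r hornerX. Qed.

Lemma laurent_inv : laurent (fun z => z^-1).
Proof. by exists 1%N, 1 => z z0; rewrite expr1 divff // hornerC. Qed.

Lemma poly_eq_nonzero p q (l : seq F) : (forall z, z \notin l -> p.[z] = q.[z]) -> p = q.
Proof.
move=> e; pose r := \prod_(z <- l) ('X - z%:P) : {poly F}.
have r0 : r != 0 by apply/monic_neq0/monic_prod_XsubC.
apply: (mulIf r0); apply: (poly_eq_inj (@natr_injective F)) => m.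
rewrite !hornerM; have [ml|/e -> //] := boolP (m%:R \in l).
have -> : r.[m%:R] = 0 by apply/eqP; rewrite -/(root r _) root_prod_XsubC.
by rewrite !mulr0.
Qed.

Lemma prim_root_exists k : (0 < k)%N -> exists z : F, k.-primitive_root z.
Proof.
move=> k0; pose p : {poly F} := 'X^k - 1; have [r Dp] := closed_field_poly_normal p.
rewrite (monicP _) ?monicXnsubC // scale1r in Dp.
have rn1 : all k.-unity_root r by apply/allP => z; rewrite -root_prod_XsubC -Dp.
have sz_r : (k < (size r).+1)%N.
  by rewrite -(size_prod_XsubC r id) -Dp size_XnsubC.
have [|z] := hasP (has_prim_root k0 rn1 _ sz_r); last by exists z.
by rewrite -separable_prod_XsubC -Dp separable_Xn_sub_1 // pnatr_eq0 -lt0n.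
Qed.

(** The numerator p is unchanged when w is multiplied by a primitive k-th root of unity, so only
    exponents divisible by k occur and p is a polynomial in w^k. *)
Lemma laurent_root_power k h : (0 < k)%N -> laurent (fun w => h (w ^+ k)) -> laurent h.
Proof.
(* The extra factor turns the denominator w^M into (w^k)^M, itself a function of w^k. *)
move=> k0 [M [p0 p0E]]; pose p := 'X^(k.-1 * M) * p0.
have pE w : w != 0 -> (w ^+ k) ^+ M * h (w ^+ k) = p.[w].
  move=> w0; rewrite /p hornerM hornerXn -p0E // mulrA -exprD -exprM.
  by rewrite -mulSnr prednK.
have [z zk] := prim_root_exists k0.
have z0 : z != 0.
  apply/eqP => e; have /eqP := prim_expr_order zk.
  by rewrite e expr0n gtn_eqF // eq_sym oner_eq0.
have pz : p \Po (z *: 'X) = p.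
  apply: (@poly_eq_nonzero _ _ [:: 0]) => w; rewrite inE => w0.
  rewrite horner_comp hornerZ hornerX -!pE //; last by rewrite mulf_neq0.
  by rewrite exprMn (prim_expr_order zk) mul1r.
have pk j : ~~ (k %| j)%N -> p`_j = 0.
  move=> kj; have /polyP /(_ j) := pz.
  have -> : (p \Po (z *: 'X))`_j = z ^+ j * p`_j.
    rewrite comp_polyE coef_sum.
    under eq_bigr do rewrite exprZn coefZ coefZ coefXn.
    have [jp|pj] := ltnP j (size p).
      rewrite (bigD1 (Ordinal jp)) //= eqxx mulr1 big1 ?addr0 1?mulrC // => i ij.
      by rewrite eq_sym -val_eqE /= in ij; rewrite (negPf ij) !mulr0.
    rewrite [p`_j]nth_default // mulr0 big1 // => i _.
    by rewrite gtn_eqF ?mulr0 // (leq_trans (ltn_ord i)).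
  move=> e; apply/eqP; apply: contraNT kj => pj0.
  rewrite (prim_order_dvd zk); apply/eqP; apply: (mulIf pj0).
  by rewrite mul1r.
pose q := \poly_(j < size p) p`_(k * j).
have pq : p = q \Po 'X^k.
  apply/polyP => j; rewrite coef_comp_poly_Xn //; case: ifP => [/dvdnP [i ->]|/negbT/pk //].
  rewrite mulnK // coef_poly mulnC; case: ltnP => // pi; apply: nth_default.
  by apply: leq_trans pi _; rewrite leq_pmull.
exists M, q => c c0; pose w := k.-root c.
have wk : w ^+ k = c by rewrite rootCK.
have w0 : w != 0 by apply: contra_neq c0 => w0; rewrite -wk w0 expr0n gtn_eqF.
by rewrite -wk pE // pq horner_comp hornerXn.
Qed.

(** One hypothesis allows a pole at 0 only, the other at 1 only. Comparing them, coprimality of the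
    denominators makes ['X^M] divide p. The second hypothesis also controls the value of h at 0. *)
Lemma laurent_translate_polyfun h : laurent h -> laurent (fun z => h (z + 1)) -> polyfun h.
Proof.
move=> [M [p pE]] [N [q qE]]; pose q1 := q \Po ('X - 1).
have q1E c : c != 1 -> (c - 1) ^+ N * h c = q1.[c].
  move=> c1; rewrite horner_comp !hornerE -qE ?subr_eq0 // subrK //.
have E : 'X^M * q1 = ('X - 1%:P) ^+ N * p.
  apply: (@poly_eq_nonzero _ _ [:: 0; 1]) => c; rewrite !inE negb_or => /andP[c0 c1].
  by rewrite !hornerM hornerXn horner_exp hornerXsubC -q1E // -pE //; ring.
have cop : coprimep ('X^M : {poly F}) (('X - 1%:P) ^+ N).
  apply: coprimep_expl; apply: coprimep_expr.
  by rewrite coprimep_XsubC /root hornerX oner_eq0.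
have : ('X^M %| p)%R by rewrite -(Gauss_dvdpr _ cop) -E dvdp_mulr.
move=> /dvdpP [r rE].
have XM : ('X^M : {poly F}) != 0 by rewrite -size_poly_eq0 size_polyXn.
have q1r : q1 = ('X - 1%:P) ^+ N * r.
  by apply: (mulfI XM); rewrite E rE; ring.
exists r => c; have [->|c0] := eqVneq c 0.
  have : (0 - 1) ^+ N * h 0 = (0 - 1) ^+ N * r.[0].
    by rewrite q1E ?q1r ?hornerM ?horner_exp ?hornerXsubC // eq_sym oner_eq0.
  by apply: mulfI; rewrite expf_neq0 // sub0r oppr_eq0 oner_eq0.
by apply: (mulfI (expf_neq0 M c0)); rewrite pE // rE hornerM hornerXn mulrC.
Qed.

Lemma coef_vanish m n (Y : nat -> 'M[F]_(m, n)) N :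
  (forall k : nat, \sum_(j < N) k.+1%:R ^+ j *: Y j = 0) -> forall j, (j < N)%N -> Y j = 0.
Proof.
move=> h j jN; apply/matrixP => a b; rewrite mxE.
pose p := \poly_(j < N) Y j a b.
have -> : Y j a b = p`_j by rewrite coef_poly jN.
suff -> : p = 0 by rewrite coef0.
apply: (@poly_eq_inj _ _ _ (fun k => k.+1%:R)) => [k k' /natr_injective [] //|k].
rewrite horner0 horner_poly; have /matrixP /(_ a b) := h k.
rewrite summxE mxE => e; rewrite -[RHS]e; apply: eq_bigr => i _.
by rewrite !mxE mulrC.
Qed.

Lemma laurent_matrix n (H : F -> 'M[F]_n) : (forall i j, laurent (fun z => H z i j)) ->
  exists M N (Y : nat -> 'M[F]_n), (M < N)%N /\
    forall z, z != 0 -> z ^+ M *: H z = \sum_(j < N) z ^+ j *: Y j.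
Proof.
move=> h; have {}h (ij : 'I_n * 'I_n) : exists Mp : nat * {poly F}, forall z, z != 0 ->
    z ^+ Mp.1 * H z ij.1 ij.2 = Mp.2.[z].
  by have [M [p pE]] := h ij.1 ij.2; exists (M, p).
have [Mp MpE] := choice h; pose M := (\sum_ij (Mp ij).1)%N.
have MM ij : ((Mp ij).1 <= M)%N by rewrite /M (bigD1 ij) //= leq_addr.
pose p ij := 'X^(M - (Mp ij).1) * (Mp ij).2.
(* N exceeds M so that the coefficient of index M, the part of weight zero, is among the Y j. *)
pose N := (M.+1 + \sum_ij size (p ij))%N.
have pN ij : (size (p ij) <= N)%N.
  by rewrite /N (bigD1 ij) //= addnCA leq_addr.
exists M, N, (fun j => \matrix_(a, b) (p (a, b))`_j); split; first by rewrite ltn_addr.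
move=> z z0; apply/matrixP => a b; rewrite !mxE summxE.
have -> : z ^+ M * H z a b = (p (a, b)).[z].
  rewrite /p hornerM hornerXn -MpE // mulrA -exprD subnK //.
by rewrite (horner_coef_wide _ (pN _)); apply: eq_bigr => j _; rewrite !mxE mulrC.
Qed.

End Laurent.

(** * Unipotent groups normalized by a torus *)

(* Locking keeps unification from unfolding these matrix power series. *)
Fact unipotent_key : unit. Proof. exact: tt. Qed.

Section UnipotentGroup.
Variables (R : realType) (G : groupType) (FG : indVariety R G).
Hypothesis hG : ind_group setT FG.
Notation C := (R[i]).
Variables (X : affineVariety R G) (n : nat) (f : G -> 'M[C]_n) (g : 'M[C]_n -> G).
Hypothesis Xe : embedded FG X.
Hypothesis Xgrp : is_subgroup (pts X).
Hypothesis fM : forall x y, pts X x -> pts X y -> f (x * y)%g = f x * f y.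
Hypothesis fnil : forall x, pts X x -> exists k, (f x - 1) ^+ k = 0.
Hypothesis freg : forall i j, regular X (fun x => f x i j).
Hypothesis fK : forall x, pts X x -> g (f x) = x.
Hypothesis Xpoly : forall h, regular X h ->
  exists p : {mpoly C[n * n]}, forall x, pts X x -> h x = p.@[mxvec (f x) 0].
Notation V := (pts X).
Notation rt m := ((m.+1%:R : C)^-1)%R.
Let V1 : V 1%g := subgroup1 Xgrp.
Let VM := subgroupM Xgrp.
Let VV := subgroupV Xgrp.
Let VX := subgroupX Xgrp.
Let Xalg := regular_algebra X.
Implicit Types (x y t : G) (Y Z : 'M[C]_n).

Lemma f_unip x : V x -> mxunip (f x).
Proof. by move=> /fnil [k /nilpotent_mx []]. Qed.

Lemma f_inj x y : V x -> V y -> f x = f y -> x = y.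
Proof. by move=> Vx Vy e; rewrite -(fK Vx) e fK. Qed.

(** Only multiplicativity of f is given. Since [f 1] is idempotent, N = [f 1 - 1] satisfies N =
    -N^2, so N equals each of its positive powers up to sign and vanishes. *)
Lemma f1 : f 1%g = 1.
Proof.
have f11 : f 1%g * f 1%g = f 1%g by rewrite -fM // mulg1.
pose N := f 1%g - 1.
have NN : N = - (N * N).
  rewrite /N mulrBr mulr1 mulrBl mul1r f11.
  by rewrite [f 1%g - f 1%g]subrr sub0r opprK.
have Nk k : N = (-1) ^+ k * N ^+ k.+1.
  elim: k => [|k IHk]; first by rewrite mul1r.
  rewrite {1}NN [in X in - (N * X)]IHk !exprS mulN1r mulNr; congr (- _).
  by rewrite !mulrA (commrX k (commrN1 N)).
have [k Nk0] := fnil V1.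
by apply/eqP; rewrite -subr_eq0 -/N (Nk k) exprS -/N Nk0 !mulr0.
Qed.

Lemma fX x m : V x -> f (x ^+ m)%g = f x ^+ m.
Proof.
move=> Vx; elim: m => [|m IHm]; first by rewrite expg0 expr0 f1.
by rewrite expgS exprS fM ?IHm //; apply: VX.
Qed.

Definition curve (h : C -> G) :=
  (forall r, V (h r)) /\ forall a, regular X a -> polyfun (fun r => a (h r)).

Lemma curve_gmor h : curve h -> gmor FG setT (@polyfun C) h.
Proof.
move=> [hV hreg]; have [i Xi] := Xe; exists i; split=> [r _|j].
  exact: closed_subvariety_sub Xi _ (hV r).
apply: (hreg (fun x => coord (FG i) x 0 j)).
by apply: closed_subvariety_regular Xi _; apply: regular_coord.
Qed.

Lemma curve_closed h A (s : nat -> C) : injective s -> curve h -> var_closed X A ->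
  (forall m, A (h (s m))) -> forall r, A (h r).
Proof.
move=> sinj [hV hreg] /var_closedP [S [Sreg ->]] hA r; split=> // k Sk.
apply: (polyfun_eq_inj sinj (hreg _ (Sreg _ Sk)) (polyfun_const 0)) => m.
by have [_] := hA m; apply.
Qed.

Lemma curve_eq h h' (s : nat -> C) : injective s -> curve h -> curve h' ->
  (forall m, h (s m) = h' (s m)) -> h =1 h'.
Proof.
move=> sinj [hV hreg] [hV' hreg'] e r.
apply: (coord_inj (hV r) (hV' r)); apply/rowP => j.
have rc := @regular_coord R G X j.
by apply: (polyfun_eq_inj sinj (hreg _ rc) (hreg' _ rc)) => m; rewrite e.
Qed.

Lemma polyfun_mxvec (H : C -> 'M[C]_n) k : polymx H -> polyfun (fun r => mxvec (H r) 0 k).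
Proof.
by case/mxvec_indexP: k => i j h; apply: polyfun_ext (h i j) => r; rewrite mxvecE.
Qed.

(** The image of V under f is closed, so a polynomial curve of matrices that meets it at infinitely
    many parameters stays in it and lifts through g. *)
Lemma matrix_curve (H : C -> 'M[C]_n) (s : nat -> C) : injective s -> polymx H ->
  (forall m, exists2 x, V x & H (s m) = f x) ->
  exists2 h, curve h & forall r, f (h r) = H r.
Proof.
move=> sinj Hpoly Hs.
have cl : zariski_closed ((fun x => mxvec (f x)) @` V).
  apply: (zariski_closed_image (var_closed_pts X)) => [j|i].
    have [i k] := mxvec_indexP j.
    have [_ _ _ ext] := Xalg; apply: ext (freg i k) => x _; by rewrite mxvecE.
  by have [p pE] := Xpoly (@regular_coord R G X i); exists p.
have Hpol (p : {mpoly C[n * n]}) : polyfun (fun r => p.@[mxvec (H r) 0]).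
  apply: (fun_algebra_meval p (@fun_algebra_polyfun C setT (fun _ => I))) => k.
  exact: polyfun_mxvec.
have HV r : exists2 x, V x & H r = f x.
  have : ((fun x => mxvec (f x)) @` V) (mxvec (H r)).
    have [S E] := cl; rewrite E => p Sp.
    apply: (polyfun_eq_inj sinj (Hpol p) (polyfun_const 0)) => m.
    have [x Vx ->] := Hs m.
    have : ((fun x => mxvec (f x)) @` V) (mxvec (f x)) by exists x.
    by rewrite E; apply.
  by move=> [x Vx /(can_inj mxvecK) e]; exists x.
have gH r : V (g (H r)) /\ f (g (H r)) = H r.
  by have [x Vx ->] := HV r; rewrite fK.
exists (fun r => g (H r)) => [|r]; last by case: (gH r).
split=> [r|a /Xpoly [p pE]]; first by case: (gH r).
by apply: polyfun_ext (Hpol p) => r; have [Vg e] := gH r; rewrite pE // e.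
Qed.

Definition uexp : 'M[C]_n -> G := locked_with unipotent_key (fun Y => g (mxexp Y)).
Definition ulog : G -> 'M[C]_n := locked_with unipotent_key (fun x => mxlog (f x)).
Definition upow : G -> C -> G := locked_with unipotent_key (fun x s => g (mxpow (f x) s)).

Lemma uexpE Y : uexp Y = g (mxexp Y). Proof. by rewrite /uexp unlock. Qed.
Lemma ulogE x : ulog x = mxlog (f x). Proof. by rewrite /ulog unlock. Qed.
Lemma upowE x s : upow x s = g (mxpow (f x) s). Proof. by rewrite /upow unlock. Qed.

Lemma ulogK x : V x -> uexp (ulog x) = x.
Proof. by move=> Vx; rewrite uexpE ulogE (mxlogK (f_unip Vx)) fK. Qed.

Lemma ulog_regular i j : regular X (fun x => ulog x i j).
Proof.
have [XC XD XM ext] := Xalg.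
have pw k i' j' : regular X (fun x => ((f x - 1) ^+ k) i' j').
  elim: k i' j' => [|k IHk] i' j'; first exact: XC.
  under eq_fun do rewrite exprS mxE.
  apply: fun_algebra_sum Xalg _ => l; apply: XM => //.
  under eq_fun do rewrite mxE.
  by apply: XD; [apply: freg|apply: XC].
under eq_fun do rewrite ulogE summxE.
apply: fun_algebra_sum Xalg _ => k; under eq_fun do rewrite mxE.
by apply: XM; [apply: XC|apply: pw].
Qed.

Lemma upow_curve_f x : V x -> curve (upow x) /\ forall s, f (upow x s) = mxpow (f x) s.
Proof.
move=> Vx; have [|h hc hE] := matrix_curve (@natr_injective C) (polymx_mxpow (f x)).
  move=> m; exists (x ^+ m)%g; first exact: VX.
  by rewrite (fX _ Vx) (mxpow_nat m (f_unip Vx)).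
have [hV _] := hc.
have E s : upow x s = h s by rewrite upowE -hE fK.
have -> : upow x = h by apply/funext.
by [].
Qed.

Lemma upow_curve x : V x -> curve (upow x).
Proof. by move=> /upow_curve_f []. Qed.

Lemma upow_in x s : V x -> V (upow x s).
Proof. by move=> /upow_curve []. Qed.

Lemma f_upow x s : V x -> f (upow x s) = mxpow (f x) s.
Proof. by move=> /upow_curve_f []. Qed.

Lemma uexp_scale x s : V x -> uexp (s *: ulog x) = upow x s.
Proof.
by move=> Vx; rewrite uexpE upowE ulogE; congr g; apply: (mxexp_log_scale s (f_unip Vx)).
Qed.

Lemma ulog_upow x s : V x -> ulog (upow x s) = s *: ulog x.
Proof.
move=> Vx; have fu := f_unip Vx.
rewrite !ulogE (f_upow s Vx) -(mxexp_log_scale s fu); apply: mxexpK.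
by rewrite scalemx_exp (mxlog_nilp fu) scaler0.
Qed.

Lemma upowD x a b : V x -> upow x (a + b) = (upow x a * upow x b)%g.
Proof.
move=> Vx; have Va := upow_in a Vx; have Vb := upow_in b Vx.
apply: (f_inj (upow_in _ Vx) (VM Va Vb)).
rewrite (fM Va Vb); apply: etrans (f_upow _ Vx) _.
exact: etrans (mxpowD a b (f_unip Vx)) (esym (congr2 *%R (f_upow a Vx) (f_upow b Vx))).
Qed.

Lemma upow_nat x m : V x -> upow x m%:R = (x ^+ m)%g.
Proof.
move=> Vx; apply: (f_inj (upow_in _ Vx) (VX m Vx)).
rewrite (f_upow _ Vx) (fX _ Vx); exact: (mxpow_nat m (f_unip Vx)).
Qed.

Lemma ulog1 : ulog 1%g = 0.
Proof.
by have := ulog_upow 0 V1; rewrite (upow_nat 0 V1) expg0 scale0r.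
Qed.

Lemma uexp0 : uexp 0 = 1%g.
Proof. by rewrite -ulog1 (ulogK V1). Qed.

Lemma upow_upow x a b : V x -> upow (upow x a) b = upow x (b * a).
Proof.
move=> Vx; rewrite -(uexp_scale b (upow_in a Vx)) (ulog_upow a Vx) scalerA.
exact: uexp_scale.
Qed.

Lemma upow_root x m : V x -> (upow x (rt m) ^+ m.+1)%g = x.
Proof.
move=> Vx; rewrite -(upow_nat _ (upow_in (rt m) Vx)) (upow_upow _ _ Vx).
have -> : m.+1%:R * rt m = 1%:R by apply: divff; rewrite pnatr_eq0.
by rewrite (upow_nat 1 Vx).
Qed.

Lemma trotter x y : V x -> V y -> exists2 h, curve h &
  (forall m, h (rt m) = ((upow x (rt m) * upow y (rt m)) ^+ m.+1)%g) /\
  ulog (h 0) = ulog x + ulog y.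
Proof.
move=> Vx Vy.
have Vxy r : V (upow x r * upow y r)%g by apply: (VM (upow_in r Vx) (upow_in r Vy)).
have fxy r : f (upow x r * upow y r)%g = mxpow (f x) r * mxpow (f y) r.
  exact: etrans (fM (upow_in r Vx) (upow_in r Vy)) (congr2 *%R (f_upow r Vx) (f_upow r Vy)).
have uxy r : mxunip (mxpow (f x) r * mxpow (f y) r).
  by have := f_unip (Vxy r); rewrite fxy.
have [nil [H [Hpoly Hm H0]]] := mx_trotter (f_unip Vx) (f_unip Vy) uxy.
have Hf m : H (rt m) = f ((upow x (rt m) * upow y (rt m)) ^+ m.+1)%g.
  by rewrite Hm (fX _ (Vxy _)) fxy.
have [|h hc hE] := matrix_curve (@invS_injective C) Hpoly.
  by move=> m; exact: (ex_intro2 _ _ _ (VX m.+1 (Vxy _)) (Hf m)).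
have [hV _] := hc; exists h => //; split.
  by move=> m; apply: (f_inj (hV _) (VX _ (Vxy _))); rewrite hE Hf.
rewrite !ulogE hE H0; exact: mxexpK nil.
Qed.

(** For a closed subgroup A this is its Lie algebra in the representation f. *)
Definition Lie (A : set G) : set 'M[C]_n := [set Y | exists2 x, A x & Y = ulog x].

Lemma Lie_uexp A Y : A `<=` V -> Lie A Y -> A (uexp Y) /\ ulog (uexp Y) = Y.
Proof. by move=> AV [x Ax ->]; rewrite ulogK //; apply: AV. Qed.

Lemma upow_closed A x s : var_closed X A -> is_subgroup A -> A x -> A (upow x s).
Proof.
move=> Ac Ag Ax; have Vx : V x by case: Ac => /(_ x Ax).
apply: (curve_closed (@natr_injective C) (upow_curve Vx) Ac) => m.
by rewrite (upow_nat m Vx); apply: subgroupX.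
Qed.

Lemma LieZ A a Y : var_closed X A -> is_subgroup A -> Lie A Y -> Lie A (a *: Y).
Proof.
move=> Ac Ag [x Ax ->]; exists (upow x a); first exact: upow_closed.
by rewrite ulog_upow //; case: Ac => /(_ x Ax).
Qed.

(** Trotter's curve lies in A at the parameters 1/(m+1), hence at 0, where its logarithm is Y +
    Z. *)
Lemma LieD A Y Z : var_closed X A -> is_subgroup A -> Lie A Y -> Lie A Z -> Lie A (Y + Z).
Proof.
move=> Ac Ag [x Ax ->] [y Ay ->]; have [AV _] := Ac.
have [h hc [hm h0]] := trotter (AV _ Ax) (AV _ Ay).
exists (h 0) => //; apply: (curve_closed (@invS_injective C) hc Ac) => m.
rewrite hm; apply: (subgroupX Ag); apply: (subgroupM Ag); exact: upow_closed.
Qed.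

Lemma conj_regular t h : regular X h -> (forall x, V x -> V (t * x * t^-1)%g) ->
  regular X (fun x => h (t * x * t^-1)%g).
Proof.
move=> hreg tV; apply: (gmor_regular Xalg Xe (phi := fun x => t * x * t^-1)%g) => //.
apply: (gmorM hG Xalg); last exact: gmor_const.
by apply: (gmorM hG Xalg); [apply: gmor_const|apply: gmor_id].
Qed.

Section Conj.
Variable t : G.
Hypothesis tV : forall x, V x -> V (t * x * t^-1)%g.

Definition uact Y := ulog (t * uexp Y * t^-1)%g.

Lemma conjM x y : (t * (x * y) * t^-1 = (t * x * t^-1) * (t * y * t^-1))%g.
Proof. by rewrite !mulgA mulgVK. Qed.

Lemma conjX x m : (t * (x ^+ m) * t^-1 = (t * x * t^-1) ^+ m)%g.
Proof.
elim: m => [|m IHm]; first by rewrite !expg0 mulg1 mulgV.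
by rewrite !expgS conjM IHm.
Qed.

Lemma conj_curve h : curve h -> curve (fun r => t * h r * t^-1)%g.
Proof.
move=> [hV hreg]; split=> [r|a areg]; first exact: tV.
by apply: (hreg (fun x => a (t * x * t^-1)%g)); apply: conj_regular.
Qed.

Lemma conj_upow x s : V x -> (t * upow x s * t^-1)%g = upow (t * x * t^-1)%g s.
Proof.
move=> Vx; move: s.
apply: (curve_eq (@natr_injective C) (conj_curve (upow_curve Vx)) (upow_curve (tV Vx))) => m.
by rewrite (upow_nat m Vx) (upow_nat m (tV Vx)) conjX.
Qed.

Lemma uactE x : V x -> uact (ulog x) = ulog (t * x * t^-1)%g.
Proof. by move=> Vx; rewrite /uact ulogK. Qed.

Lemma uactZ a Y : Lie V Y -> uact (a *: Y) = a *: uact Y.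
Proof.
move=> [x Vx ->]; rewrite (uactE Vx) {1}/uact uexp_scale // conj_upow //.
exact: ulog_upow (tV Vx).
Qed.

(** Conjugation maps the Trotter curve of x and y to that of their conjugates, as the two agree at
    1/(m+1); their values at 0 give additivity. *)
Lemma uactD Y Z : Lie V Y -> Lie V Z -> uact (Y + Z) = uact Y + uact Z.
Proof.
move=> [x Vx eY] [y Vy eZ].
have eYa : uact Y = ulog (t * x * t^-1)%g := etrans (congr1 uact eY) (uactE Vx).
have eZa : uact Z = ulog (t * y * t^-1)%g := etrans (congr1 uact eZ) (uactE Vy).
have [h hc [hm h0]] := trotter Vx Vy.
have [h' hc' [hm' h0']] := trotter (tV Vx) (tV Vy).
have E : (fun r => t * h r * t^-1)%g =1 h'.
  apply: (curve_eq (@invS_injective C) (conj_curve hc) hc') => m.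
  by rewrite hm hm' conjX conjM (conj_upow _ Vx) (conj_upow _ Vy).
have eYZ : Y + Z = ulog (h 0) := etrans (congr2 +%R eY eZ) (esym h0).
have [hV _] := hc; apply: etrans (congr1 uact eYZ) _; apply: etrans (uactE (hV 0)) _.
apply: etrans (congr1 ulog (E 0)) (etrans h0' (esym (congr2 +%R eYa eZa))).
Qed.

End Conj.

Section Quotient.
Variables (W A : set G).
Hypotheses (Wc : var_closed X W) (Wn : normal_in V W) (Ac : var_closed X A) (Ag : is_subgroup A).
Hypothesis AW : forall x y, A x -> A y -> W (x^-1 * y^-1 * x * y)%g.

Lemma expgM_mod x y m : A x -> A y -> W ((y ^+ m)^-1 * (x ^+ m)^-1 * (x * y) ^+ m)%g.
Proof.
have [Wg WV Wconj] := Wn; have [AV _] := Ac.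
move=> Ax Ay; elim: m => [|m IHm]; first by rewrite !expg0 !invg1 !mulg1; apply: subgroup1.
set w := (_ * _)%g in IHm.
have -> : ((x * y) ^+ m.+1 = x ^+ m * y ^+ m * w * (x * y))%g.
  by rewrite expgSr /w !mulgA mulgK mulgV mul1g.
have -> : ((y ^+ m.+1)^-1 * (x ^+ m.+1)^-1 * (x ^+ m * y ^+ m * w * (x * y)) =
   (y^-1 * ((y ^+ m)^-1 * x^-1 * y ^+ m * x) * y) * ((x * y)^-1 * w * (x * y)))%g.
  by rewrite !expgSr !invgM !mulgA !mulgK.
have conjV u v : V u -> W v -> W (u^-1 * v * u)%g.
  by move=> Vu Wv; have := Wconj _ _ (VV Vu) Wv; rewrite invgK.
apply: (subgroupM Wg); apply: conjV => //; try exact: AV.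
  by apply: AW => //; apply: (subgroupX Ag).
by apply: VM; apply: AV.
Qed.

(** Commutators of A lie in W, so at 1/(m+1) the Trotter curve is congruent to x y modulo W. This is
    a closed condition, hence it also holds at 0, where the curve takes the value z. *)
Lemma Lie_add_mod x y : A x -> A y -> exists2 z, A z &
  ulog z = ulog x + ulog y /\ W (y^-1 * x^-1 * z)%g.
Proof.
move=> Ax Ay; have [AV _] := Ac; have [Vx Vy] := (AV _ Ax, AV _ Ay).
have [h hc [hm h0]] := trotter Vx Vy.
have root m : A (upow x (rt m) * upow y (rt m))%g.
  by apply: (subgroupM Ag); apply: upow_closed.
have Bc : var_closed X [set z | V z /\ W (y^-1 * x^-1 * z)%g].
  apply: (closed_preimage Xe Wc); apply: (gmorM hG Xalg); first exact: gmor_const.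
  exact: gmor_id.
exists (h 0%R).
  apply: (curve_closed (@invS_injective C) hc Ac) => m.
  by rewrite hm; apply: (subgroupX Ag).
split=> //; apply: (proj2 (curve_closed (@invS_injective C) hc Bc _ 0%R)) => m.
split; first by case: hc.
rewrite hm -[in (y^-1)%g](upow_root m Vy) -[in (x^-1)%g](upow_root m Vx).
by apply: expgM_mod; apply: upow_closed.
Qed.

End Quotient.

(** * Weight vectors of a torus in the Lie algebra of a unipotent group *)

Section Torus.
Variables (d : nat) (lam : 'I_d -> C -> G).
Hypothesis lam_gmor : forall i, gmor FG [set z : C | z != 0] (@laurent C) (lam i).
Hypothesis lamM : forall i (z w : C), z != 0 -> w != 0 -> lam i (z * w) = (lam i z * lam i w)%g.
Hypothesis lamC : forall i j (z w : C), z != 0 -> w != 0 ->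
  (lam i z * lam j w = lam j w * lam i z)%g.
Hypothesis lamV : forall i (z : C) x, z != 0 -> V x -> V (lam i z * x * (lam i z)^-1)%g.
Hypothesis lam_fix : forall x, V x ->
  (forall i (z : C), z != 0 -> (lam i z * x * (lam i z)^-1)%g = x) -> x = 1%g.

Lemma lam1 i : lam i 1 = 1%g.
Proof.
by apply: (mulgI (lam i 1)); rewrite -lamM ?oner_eq0 // mulr1 mulg1.
Qed.

Lemma lam_inv i (z : C) : z != 0 -> lam i z^-1 = (lam i z)^-1%g.
Proof.
move=> z0; apply: (mulgI (lam i z)).
by rewrite -lamM ?invr_eq0 // divff // lam1 mulgV.
Qed.

Lemma uact_comp t u Y : (forall x, V x -> V (t * x * t^-1)%g) ->
  (forall x, V x -> V (u * x * u^-1)%g) -> Lie V Y ->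
  uact t (uact u Y) = uact (t * u)%g Y.
Proof.
move=> tV uV [x Vx eY]; have tuV y : V y -> V (t * u * y * (t * u)^-1)%g.
  by move=> Vy; rewrite invgM !mulgA; have := tV _ (uV _ Vy); rewrite !mulgA.
apply: etrans (congr1 (uact t) (etrans (congr1 (uact u) eY) (uactE u Vx))) _.
apply: etrans (uactE t (uV _ Vx)) _; apply: esym.
apply: etrans (congr1 (uact _) eY) (etrans (uactE _ Vx) (congr1 ulog _)).
by rewrite invgM !mulgA.
Qed.

Let VS : is_subgroup V := Xgrp.
Let Vc : var_closed X V := var_closed_pts X.

Lemma Lie_sum A (I : Type) (r : seq I) (Y : I -> 'M[C]_n) : var_closed X A -> is_subgroup A ->
  (forall i, Lie A (Y i)) -> Lie A (\sum_(i <- r) Y i).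
Proof.
move=> Ac Ag h; elim: r => [|i r IHr].
  by rewrite big_nil; exists 1%g; [apply: subgroup1|rewrite ulog1].
by rewrite big_cons; apply: LieD.
Qed.

Lemma uact_sum t N (c : nat -> C) (Y : nat -> 'M[C]_n) :
  (forall x, V x -> V (t * x * t^-1)%g) -> (forall j, Lie V (Y j)) ->
  uact t (\sum_(j < N) c j *: Y j) = \sum_(j < N) c j *: uact t (Y j).
Proof.
move=> tV h; elim: N => [|N IHN].
  rewrite !big_ord0 -[in LHS]ulog1; apply: etrans (uactE t V1) _.
  by rewrite mulg1 mulgV ulog1.
have h1 : Lie V (\sum_(j < N) c j *: Y j).
  by apply: Lie_sum => // j; apply: LieZ.
rewrite !big_ord_recr /=; apply: etrans (uactD tV h1 (LieZ _ Vc VS (h N))) _.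
exact: congr2 IHN (uactZ tV _ (h N)).
Qed.

(** Modulo the row space of Lie A the combination vanishes at infinitely many parameters, hence
    coefficientwise. *)
Lemma Lie_coef A N (Y : nat -> 'M[C]_n) : var_closed X A -> is_subgroup A ->
  (forall k : nat, Lie A (\sum_(j < N) k.+1%:R ^+ j *: Y j)) ->
  forall j, (j < N)%N -> Lie A (Y j).
Proof.
move=> Ac Ag h j jN.
pose S : set 'rV[C]_(n * n) := [set v | Lie A (vec_mx v)].
have [B BE] : exists B : 'M[C]_(n * n), forall v, S v <-> (v <= B)%MS.
  apply: linear_set_mx => [|a u v Su Sv].
    by rewrite /S /= raddf0; exists 1%g; [apply: subgroup1|rewrite ulog1].
  by rewrite /S /= linearP; apply: LieD => //; apply: LieZ.
have : S (mxvec (Y j)); last by rewrite /S /= mxvecK.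
apply/BE; rewrite submxE; apply/eqP.
apply: (@coef_vanish _ _ _ (fun j => mxvec (Y j) *m cokermx B) N) => // k.
have : S (mxvec (\sum_(j < N) k.+1%:R ^+ j *: Y j)) by rewrite /S /= mxvecK.
move=> /BE; rewrite submxE => /eqP e; rewrite -[RHS]e linear_sum mulmx_suml.
by apply: eq_bigr => i _; rewrite linearZ /= scalemxAl.
Qed.

Section Weights.
Variable A : set G.
Hypotheses (Ac : var_closed X A) (Ag : is_subgroup A).
Hypothesis lamA : forall i (z : C) x, z != 0 -> A x -> A (lam i z * x * (lam i z)^-1)%g.
Let AV : A `<=` V := proj1 Ac.

Lemma LieAV Y : Lie A Y -> Lie V Y.
Proof. by move=> [x Ax eY]; exists x => //; apply: AV. Qed.

Lemma uact_Lie i (z : C) Y : z != 0 -> Lie A Y -> Lie A (uact (lam i z) Y).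
Proof.
move=> z0 [x Ax eY]; exists (lam i z * x * (lam i z)^-1)%g; first exact: lamA.
exact: etrans (congr1 _ eY) (uactE _ (AV Ax)).
Qed.

(** The adjoint action of [lam i z] on Y is Laurent polynomial in z. Comparing coefficients in the
    action of [lam i (w * z)] shows that [Yc j] has weight j - M. *)
Lemma weight_expansion i Y : Lie A Y -> exists M N (Yc : nat -> 'M[C]_n),
  [/\ (M < N)%N, forall j, (j < N)%N -> Lie A (Yc j),
   forall z : C, z != 0 -> z ^+ M *: uact (lam i z) Y = \sum_(j < N) z ^+ j *: Yc j &
   forall (w : C) j, w != 0 -> (j < N)%N -> w ^+ M *: uact (lam i w) (Yc j) = w ^+ j *: Yc j].
Proof.
move=> LY; have [x Ax eY] := LY; have Vx := AV Ax.
have lm : gmor FG [set z : C | z != 0] (@laurent C) (fun z => lam i z * x * (lam i z)^-1)%g.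
  apply: (gmorF hG (@laurent_algebra C)) (lam_gmor i).
  by apply: (gmorM hG (@laurent_algebra C)); last exact: (gmor_const hG (@laurent_algebra C)).
have reg a b : laurent (fun z => ulog (lam i z * x * (lam i z)^-1)%g a b).
  apply: (gmor_regular (@laurent_algebra C) Xe lm _ (ulog_regular a b)) => z z0.
  exact: lamV.
have [M [N [Yc0 [MN YcE0]]]] := laurent_matrix reg.
(* Set to zero from N on, since [uact_sum] asks every term of the sequence to lie in the Lie
   algebra. *)
pose Yc j := if (j < N)%N then Yc0 j else 0.
have YcE (z : C) : z != 0 -> z ^+ M *: uact (lam i z) Y = \sum_(j < N) z ^+ j *: Yc j.
  move=> z0; have -> : uact (lam i z) Y = ulog (lam i z * x * (lam i z)^-1)%g.
    exact: etrans (congr1 _ eY) (uactE _ Vx).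
  by rewrite (YcE0 z z0); apply: eq_bigr => j _; rewrite /Yc ltn_ord.
have k0 (k : nat) : k.+1%:R != 0 :> C by rewrite pnatr_eq0.
have LYc j : (j < N)%N -> Lie A (Yc j).
  apply: Lie_coef => // k; rewrite -YcE //; apply: LieZ => //; exact: uact_Lie.
have LYc' j : Lie V (Yc j).
  have [jN|Nj] := ltnP j N; first exact: LieAV (LYc j jN).
  by rewrite /Yc ltnNge Nj /=; exists 1%g; [apply: V1|rewrite ulog1].
exists M, N, Yc; split=> // w j w0 jN; apply/eqP; rewrite -subr_eq0; apply/eqP.
apply: (@coef_vanish _ _ _ (fun j => w ^+ M *: uact (lam i w) (Yc j) - w ^+ j *: Yc j) N) => // k.
set z : C := k.+1%:R; have z0 : z != 0 by apply: k0.
have wV y : V y -> V (lam i w * y * (lam i w)^-1)%g by apply: lamV.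
have zV y : V y -> V (lam i z * y * (lam i z)^-1)%g by apply: lamV.
have E : w ^+ M *: (\sum_(j < N) z ^+ j *: uact (lam i w) (Yc j)) =
    \sum_(j < N) z ^+ j *: (w ^+ j *: Yc j).
  rewrite -(uact_sum _ _ wV LYc') -YcE //.
  have Lz : Lie V (uact (lam i z) Y) by apply: LieAV; apply: uact_Lie.
  rewrite (uactZ wV _ Lz) (uact_comp wV zV (LieAV LY)) -lamM // scalerA -exprMn.
  rewrite YcE ?mulf_neq0 //; apply: eq_bigr => l _.
  by rewrite scalerA -exprMn mulrC.
under eq_bigr do rewrite scalerBr.
rewrite sumrB -E scaler_sumr -sumrB big1 // => l _.
by rewrite !scalerA mulrC subrr.
Qed.

(** A vector of weight j - M for a single cocharacter, this weight being nonzero. Two natural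
    exponents avoid negative powers. *)
Definition rootvec Y := Lie A Y /\ exists i (M j : nat), M <> j /\
  forall w : C, w != 0 -> w ^+ M *: uact (lam i w) Y = w ^+ j *: Y.

Inductive rootsum : 'M[C]_n -> Prop :=
 | rootsum0 : rootsum 0
 | rootsumS Y Z : rootvec Y -> rootsum Z -> rootsum (Y + Z).

Lemma rootsumD Y Z : rootsum Y -> rootsum Z -> rootsum (Y + Z).
Proof.
move=> hY hZ; elim: hY => [|Y1 Y2 r1 _ IH]; first by rewrite add0r.
by rewrite -addrA; apply: rootsumS.
Qed.

(** Subtracting the parts of nonzero weight for one cocharacter after the other leaves the common
    part of weight zero. *)
Lemma rootsum_peel m Y : (m <= d)%N -> Lie A Y -> exists Z, [/\ Lie A Z, rootsum (Y - Z) &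
  forall i : 'I_d, (i < m)%N -> forall w : C, w != 0 -> uact (lam i w) Z = Z].
Proof.
move=> + LY; elim: m => [|m IHm] md.
  by exists Y; rewrite subrr; split=> //; apply: rootsum0.
have [Z [LZ rs fixZ]] := IHm (ltnW md); pose i0 := Ordinal md.
have [M [N [Zc [MN LZc ZE Zw]]]] := weight_expansion i0 LZ.
have Z1 : Z = \sum_(j < N) Zc j.
  have := ZE 1 (oner_neq0 _); rewrite expr1n scale1r lam1.
  have -> : uact 1%g Z = Z.
    have [x Ax eZ] := LZ; apply: etrans (congr1 _ eZ) (etrans (uactE _ (AV Ax)) _).
    by rewrite mul1g invg1 mulg1 eZ.
  by move=> ->; apply: eq_bigr => j _; rewrite expr1n scale1r.
(* The coefficient of index M is the part of weight zero for the current cocharacter. *)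
exists (Zc M); split; first exact: LZc.
  have -> : Y - Zc M = (Y - Z) + (Z - Zc M) by rewrite addrA subrK.
  apply: rootsumD => //; rewrite Z1 (bigD1 (Ordinal MN)) //= addrAC subrr add0r.
  elim/big_rec: _ => [|j Y' jM]; first exact: rootsum0.
  apply: rootsumS; split; first exact: LZc.
  exists i0, M, j; split=> [e|w w0]; last exact: Zw.
  by move/eqP: jM; apply; apply: val_inj.
move=> i im w w0; have [im'|] := ltnP i m; last first.
  move=> mi; have -> : i = i0 by apply: val_inj => /=; apply/eqP; rewrite eqn_leq mi andbT -ltnS.
  by apply: (scalerI (expf_neq0 M w0)); apply: Zw.
pose Zc' j := if (j < N)%N then Zc j else 0.
have LZc' j : Lie V (Zc' j).
  rewrite /Zc'; case: ifP => [jN|_]; first exact: LieAV (LZc j jN).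
  by exists 1%g; [apply: V1|rewrite ulog1].
have ZE' (z : C) : z != 0 -> z ^+ M *: uact (lam i0 z) Z = \sum_(j < N) z ^+ j *: Zc' j.
  by move=> z0; rewrite ZE //; apply: eq_bigr => j _; rewrite /Zc' ltn_ord.
suff : uact (lam i w) (Zc' M) - Zc' M = 0.
  by move/eqP; rewrite subr_eq0 /Zc' MN => /eqP.
(* An earlier cocharacter fixes Z and commutes with [lam i0], so it fixes every coefficient of the
   expansion of Z. *)
apply: (@coef_vanish _ _ _ (fun j => uact (lam i w) (Zc' j) - Zc' j) N) => // k.
set z : C := k.+1%:R; have z0 : z != 0 by rewrite pnatr_eq0.
have wV y : V y -> V (lam i w * y * (lam i w)^-1)%g by apply: lamV.
have zV y : V y -> V (lam i0 z * y * (lam i0 z)^-1)%g by apply: lamV.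
under eq_bigr do rewrite scalerBr.
rewrite sumrB -(uact_sum _ (fun j => z ^+ j) wV LZc') -ZE' //.
have Lz : Lie V (uact (lam i0 z) Z) by apply: LieAV; apply: uact_Lie.
rewrite (uactZ wV _ Lz) (uact_comp wV zV (LieAV LZ)) lamC //.
rewrite -(uact_comp zV wV (LieAV LZ)) fixZ // subrr //.
Qed.

(** What remains after peeling is fixed by all cocharacters, so its exponential is the neutral
    element by [lam_fix]. *)
Lemma Lie_rootsum Y : Lie A Y -> rootsum Y.
Proof.
move=> LY; have [Z [LZ rs fixZ]] := rootsum_peel (leqnn d) LY.
have [x Ax eZ] := LZ; have Vx := AV Ax.
suff x1 : x = 1%g by move: rs; rewrite eZ x1 ulog1 subr0.
apply: lam_fix => // i z z0.
rewrite -[RHS](ulogK Vx) -eZ -(fixZ i (ltn_ord i) z z0).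
have -> : uact (lam i z) Z = ulog (lam i z * x * (lam i z)^-1)%g.
  exact: etrans (congr1 _ eZ) (uactE _ Vx).
by rewrite ulogK //; apply: lamV.
Qed.

End Weights.

(** * Regularity of the automorphism on a unipotent group normalized by the torus *)

Section Extension.
Variable theta : G -> G.
Hypothesis thetaM : forall x y, theta (x * y)%g = (theta x * theta y)%g.
Hypothesis theta_lam : forall i (z : C), z != 0 -> theta (lam i z) = lam i z.

Lemma theta1 : theta 1%g = 1%g.
Proof. by apply: (mulgI (theta 1%g)); rewrite -thetaM !mulg1. Qed.

Lemma thetaV x : theta x^-1%g = (theta x)^-1%g.
Proof. by apply: (mulgI (theta x)); rewrite -thetaM !mulgV theta1. Qed.

Lemma theta_conj i (z : C) x : z != 0 ->
  theta (lam i z * x * (lam i z)^-1)%g = (lam i z * theta x * (lam i z)^-1)%g.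
Proof. by move=> z0; rewrite !thetaM thetaV theta_lam. Qed.

(* E is Laurent polynomial away from 0, and so is E (z + 1) = E z * E 1: the
   possible poles at 0 and at 1 exclude each other. *)
Lemma hom_root_gmor (E q : C -> G) k : (forall a b, E (a + b) = (E a * E b)%g) -> (0 < k)%N ->
  gmor FG [set z : C | z != 0] (@laurent C) q ->
  (forall w : C, w != 0 -> E (w ^+ k) = q w) -> gmor FG setT (@polyfun C) E.
Proof.
move=> ED k0 qg Eq; have La := @laurent_algebra C; have [_ _ _ Lext] := La.
have Eg : gmor FG [set z : C | z != 0] (@laurent C) E.
  have [i [qV qreg]] := qg; exists i; split=> [c c0|j].
    pose w := k.-root c; have wk : w ^+ k = c by rewrite rootCK.
    have w0 : w != 0 by apply: contra_neq c0 => w0; rewrite -wk w0 expr0n gtn_eqF.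
    by rewrite -wk Eq //; apply: qV.
  apply: (laurent_root_power k0); apply: Lext (qreg j) => w w0 /=.
  by rewrite Eq.
have [a Ea] := Eg; have [b E1b] := gmorM hG La Eg (gmor_const hG La (E 1)).
have [EV Ereg] := gmor_at_le La (leq_maxl a b) Ea.
have [E1V E1reg] := gmor_at_le La (leq_maxr a b) E1b.
exists (maxn a b); split=> [c _|j].
  have [->|/EV //] := eqVneq c 0.
  have -> : 0 = -1 + 1 :> C by rewrite addrC subrr.
  by rewrite ED; apply: E1V; rewrite /= oppr_eq0 oner_eq0.
apply: laurent_translate_polyfun; first exact: Ereg.
by apply: Lext (E1reg j) => z _; rewrite ED.
Qed.

Lemma root_conj A i (M j : nat) x : var_closed X A -> A x ->
  (forall w : C, w != 0 -> w ^+ M *: uact (lam i w) (ulog x) = w ^+ j *: ulog x) ->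
  forall w : C, w != 0 -> (lam i w * x * (lam i w)^-1)%g = upow x (w ^+ j / w ^+ M).
Proof.
move=> [AV _] Ax h w w0; have Vx := AV _ Ax.
rewrite -(ulogK (lamV i w0 Vx)) -(uexp_scale _ Vx); congr uexp.
apply: etrans (esym (uactE _ Vx)) _.
by apply: (scalerI (expf_neq0 M w0)); rewrite h // scalerA mulrCA divff ?mulr1 // expf_neq0.
Qed.

(** Conjugating x by [lam i w] gives the power of x with exponent w^(j-M); applying [theta]
    expresses its values there by conjugates of [theta x]. For a negative weight w is replaced by
    its inverse. *)
Lemma rootvec_gmor A Y : var_closed X A -> rootvec A Y -> exists2 x, A x & Y = ulog x /\
  gmor FG setT (@polyfun C) (fun c => theta (upow x c)).
Proof.
move=> Ac [[x Ax eY] [i [M [j [Mj h]]]]]; exists x => //; split=> //.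
have AV := proj1 Ac; have Vx := AV _ Ax.
have cj := root_conj Ac Ax (fun w w0 => etrans (congr1 _ (congr1 _ (esym eY))) (etrans (h w w0) (congr1 _ eY))).
have La := @laurent_algebra C; have cg y := gmor_const hG La y.
have ED a b : theta (upow x (a + b)) = (theta (upow x a) * theta (upow x b))%g.
  by rewrite (upowD _ _ Vx) thetaM.
have [lt|ge] := ltnP M j.
  apply: (@hom_root_gmor _ (fun w => lam i w * theta x * (lam i w)^-1)%g (j - M)) => //.
  - by rewrite subn_gt0.
  - by apply: (gmorF hG La) (lam_gmor i); apply: (gmorM hG La).
  move=> w w0; rewrite -(theta_conj _ _ w0) cj //.
  by congr (theta (upow x _)); rewrite -{2}(subnK (ltnW lt)) exprD mulfK // expf_neq0.
have {Mj}lt : (j < M)%N by rewrite ltn_neqAle ge andbT; apply/eqP => e; apply: Mj.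
apply: (@hom_root_gmor _ (fun w => (lam i w)^-1 * theta x * (lam i w))%g (M - j)) => //.
- by rewrite subn_gt0.
- by apply: (gmorM hG La) (lam_gmor i); apply: (gmorM hG La) => //; apply: (gmorV hG La).
move=> w w0; have w0' : w^-1 != 0 by rewrite invr_eq0.
transitivity (lam i (w^-1)%R * theta x * (lam i (w^-1)%R)^-1)%g; last by rewrite lam_inv // invgK.
rewrite -(theta_conj _ _ w0') cj //.
congr (theta (upow x _)); rewrite !exprVn invrK mulrC.
by rewrite -{2}(subnK (ltnW lt)) exprD mulfK // expf_neq0.
Qed.

Definition good_param (e : C -> G) := (exists2 x, V x & e = upow x) /\
  gmor FG setT (@polyfun C) (fun c => theta (e c)).

Lemma transl_regular : transl_algebra V (regular X).
Proof.
split; first exact: Xalg; move=> b w breg Vw.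
apply: (gmor_regular Xalg Xe (phi := fun v => v * w)%g) => //.
- by apply: (gmorM hG Xalg); [apply: gmor_id|apply: gmor_const].
- by move=> v Vv; apply: VM.
Qed.

Lemma good_oneparam e : good_param e -> oneparam V e /\ ray_poly V e (regular X).
Proof.
move=> [[x Vx ->] _]; split; first by split=> [c|a b]; [apply: upow_in|apply: upowD].
move=> b v breg Vv.
have Pa := @fun_algebra_polyfun C setT (fun _ => I).
apply: (gmor_regular Pa Xe (phi := fun c => v * upow x c)%g) => // [|c _].
  apply: (gmorM hG Pa); first exact: gmor_const.
  exact/curve_gmor/upow_curve.
by apply: VM => //; apply: upow_in.
Qed.

Lemma var_closed_bigcap (I : Type) (A : I -> set G) : (forall i, var_closed X (A i)) ->
  var_closed X [set x | V x /\ forall i, A i x].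
Proof.
move=> h; have {}h i : exists S : set (G -> C), S `<=` regular X /\
    A i = [set x | V x /\ forall h, S h -> h x = 0] by apply/var_closedP.
have [S SE] := choice h; apply/var_closedP; exists (\bigcup_i S i); split.
  by move=> a [i _ Sa]; have [Sreg _] := SE i; apply: Sreg.
apply/seteqP; split=> x /= [Vx hx]; split=> //.
  by move=> a [i _ Sa]; have [_ E] := SE i; have := hx i; rewrite E => -[_]; apply.
move=> i; have [_ ->] := SE i; split=> // a Sa.
by apply: hx; exists i.
Qed.

Lemma var_closed1 : var_closed X [set 1%g].
Proof.
apply/var_closedP.
exists [set h | exists j, h = fun x => coord X x 0 j - coord X 1%g 0 j]; split.
  move=> _ [j ->]; apply: (fun_algebraB Xalg); first exact: regular_coord.
  by have [Xc _ _ _] := Xalg; apply: Xc.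
apply/seteqP; split=> [x -> /=|x /= [Vx hx]].
  by split=> [|_ [j ->]]; [apply: V1|rewrite subrr].
apply: (coord_inj Vx V1); apply/rowP => j; apply/eqP.
by rewrite -subr_eq0; apply/eqP/(hx (fun x => coord X x 0 j - coord X 1%g 0 j)); exists j.
Qed.

Fixpoint upper_central r : set G := if r is k.+1 then
  [set v | V v /\ forall w, V w -> upper_central k (v^-1 * w^-1 * v * w)%g] else [set 1%g].

Lemma conjV_in W v w : normal_in V W -> V v -> W w -> W (v^-1 * w * v)%g.
Proof. by move=> [_ _ Wn] Vv Ww; have := Wn _ _ (VV Vv) Ww; rewrite invgK. Qed.

Lemma upper_central_normal r : normal_in V (upper_central r).
Proof.
elim: r => [|r IHr].
  split=> [|_ -> //|v _ Vv ->]; last by rewrite /= mulg1 mulgV.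
  by split=> // _ _ -> ->; rewrite /= invg1 mulg1.
have [Zg ZV Zn] := IHr.
have ZVg v : upper_central r.+1 v -> upper_central r.+1 v^-1%g.
  move=> [Vv hv]; split; first exact: VV.
  move=> w Vw; have := Zn v _ Vv (subgroupV Zg (hv _ Vw)).
  by rewrite !invgM !invgK !mulgA mulgK.
have ZMg v v' : upper_central r.+1 v -> upper_central r.+1 v' -> upper_central r.+1 (v * v')%g.
  move=> [Vv hv] [Vv' hv']; split; first exact: VM.
  move=> w Vw; have := subgroupM Zg (conjV_in IHr Vv' (hv _ Vw)) (hv' _ Vw).
  by rewrite !invgM !mulgA mulgK mulgK.
split.
- split; first by split=> [|w Vw]; [apply: V1|rewrite invg1 mul1g mulg1 mulVg; apply: subgroup1].
  by move=> x y Zx Zy; apply: ZMg => //; apply: ZVg.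
- by move=> v [].
- move=> v z Vv [Vz hz]; split; first by apply: VM; [apply: VM|apply: VV].
  move=> w Vw; have Vw' : V (v^-1 * w * v)%g by apply: VM => //; apply: VM => //; apply: VV.
  have := Zn v _ Vv (hz _ Vw').
  by rewrite !invgM !invgK !mulgA !mulgK.
Qed.

Lemma upper_central_step r : upper_central r `<=` upper_central r.+1.
Proof.
move=> z Zz; have [Zg ZV Zn] := upper_central_normal r; split; first exact: ZV.
move=> w Vw; have := subgroupM Zg (subgroupV Zg Zz) (conjV_in (upper_central_normal r) Vw Zz).
by rewrite !mulgA.
Qed.

Lemma upper_central_closed r : var_closed X (upper_central r).
Proof.
elim: r => [|r IHr]; first exact: var_closed1.
have -> : upper_central r.+1 = [set v | V v /\
    forall w : {w | V w}, [set v | V v /\ upper_central r (v^-1 * (sval w)^-1 * v * sval w)%g] v].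
  apply/seteqP; split=> v /= [Vv h]; split=> //.
    by move=> [w Vw] /=; split=> //; apply: h.
  by move=> w Vw; have [] := h (exist _ w Vw).
apply: var_closed_bigcap => -[w Vw] /=.
have cg y := gmor_const hG Xalg y; have idg := gmor_id Xe.
apply: (closed_preimage Xe IHr); do 2 apply: (gmorM hG Xalg) => //.
by apply: (gmorM hG Xalg) => //; apply: (gmorV hG Xalg).
Qed.

Lemma upper_central_stable r i (z : C) v : z != 0 -> upper_central r v ->
  upper_central r (lam i z * v * (lam i z)^-1)%g.
Proof.
move=> z0; elim: r v => [|r IHr] v; first by move=> ->; rewrite /= mulg1 mulgV.
move=> [Vv hv]; split; first exact: lamV.
move=> w Vw; have z0' : z^-1 != 0 by rewrite invr_eq0.
have Vw' : V ((lam i z)^-1 * w * lam i z)%g.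
  by have := lamV i z0' Vw; rewrite lam_inv // invgK.
have := IHr _ (hv _ Vw').
by rewrite !invgM !invgK !mulgA !mulgK.
Qed.

Lemma flag_exists : exists W : nat -> 'M[C]_n, [/\ W 0%N = 0,
  forall i, (W i <= W i.+1)%MS, row_full (W n),
  forall v, V v -> flagfilt W 0 (f v) & forall v, V v -> flagfilt W 1 (f v - 1)].
Proof.
have [W [W0 WS Wn WD]] : exists W : nat -> 'M[C]_n, [/\ W 0%N = 0,
    forall i, (W i <= W i.+1)%MS, row_full (W n) &
    forall i A, (f @` V) A -> (W i.+1 *m (A - 1) <= W i)%MS].
  apply: kolchin => [_ _ [x Vx <-] [y Vy <-]|_ [x Vx <-]]; last exact: fnil.
  by exists (x * y)%g; [apply: VM|rewrite fM].
have filt1 v : V v -> flagfilt W 1 (f v - 1).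
  by move=> Vv i; rewrite addn1; apply: WD; exists v.
exists W; split=> // v Vv; rewrite -(subrK 1 (f v)); apply: flagfiltD; last exact: flagfilt1.
exact/(flagfiltW WS)/filt1.
Qed.

(** If [f v - 1] lowers the flag by a, then the commutators of v lower it by a+1, and an element
    lowering it by n is trivial. Hence the induction on r under the bound n <= a + r. *)
Lemma upper_central_top : upper_central n = V.
Proof.
have [W [W0 WS Wn filt0 filt1]] := flag_exists.
suff H r a v : V v -> flagfilt W a (f v - 1) -> (n <= a + r)%N -> upper_central r v.
  apply/seteqP; split; first by have [] := upper_central_normal n.
  by move=> v Vv; apply: (H n 1%N) => //; apply: filt1.
elim: r a v => [|r IHr] a v Vv fv le.
  apply: (f_inj Vv V1); rewrite f1; apply/eqP; rewrite -subr_eq0; apply/eqP.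
  apply: (flagfilt_top W0 Wn); rewrite addn0 in le; rewrite -(subnKC le) in fv.
  by elim: (a - n)%N fv => [|k IHk]; rewrite ?addn0 // addnS => /(flagfiltW WS).
split=> // w Vw; set u := (_ * _)%g.
have uE : u = ((w * v)^-1 * (v * w))%g by rewrite /u invgM !mulgA.
have Vvw := VM Vv Vw; have Vwv := VM Vw Vv; have Vwv' := VV Vwv.
apply: (IHr a.+1); first by rewrite uE; apply: VM.
  have -> : f u - 1 = f (w * v)^-1%g * ((f v - 1) * (f w - 1) - (f w - 1) * (f v - 1)).
    have e1 : f (w * v)^-1%g * f (w * v)%g = 1 by rewrite -fM // mulVg f1.
    rewrite uE fM // -[X in _ - X = _]e1 -mulrBr; congr (_ * _); rewrite !fM //.
    have h (Y Z : 'M[C]_n) : (Y - 1) * (Z - 1) = Y * Z - (Y + Z - 1).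
      by rewrite mulrBl mul1r mulrBr mulr1 -addrA -opprD addrA.
    by rewrite !h [f w + _]addrC; set c := _ + _ - 1; rewrite [- (_ - c)]opprB addrA subrK.
  rewrite -[a.+1]add0n; apply: flagfiltM; first exact: filt0.
  apply: flagfiltD; first by rewrite -addn1; apply: flagfiltM => //; apply: filt1.
  by apply: flagfiltN; rewrite -add1n; apply: flagfiltM => //; apply: filt1.
by rewrite addSnnS.
Qed.

Section Absorb.
Variable r : nat.
Let A := upper_central r.+1.
Let W0 := upper_central r.
Let Ac : var_closed X A := upper_central_closed r.+1.
Let Ag : is_subgroup A. Proof. by have [] := upper_central_normal r.+1. Qed.
Let AV : A `<=` V. Proof. by have [] := upper_central_normal r.+1. Qed.

Lemma upper_central_add x y : A x -> A y -> exists2 z, A z &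
  ulog z = ulog x + ulog y /\ W0 (y^-1 * x^-1 * z)%g.
Proof.
apply: Lie_add_mod => //; first exact: upper_central_closed.
  exact: upper_central_normal.
by move=> u v [_ hu] /AV; apply: hu.
Qed.

Definition absorbed (W : set G) Y := Lie A Y /\ forall c, W (uexp (c *: Y)).

(** Modulo W0 the exponential of c(Y + Z) is the product of those of cY and cZ. *)
Lemma absorbedD W Y Z : is_subgroup W -> W0 `<=` W -> absorbed W Y -> absorbed W Z ->
  absorbed W (Y + Z).
Proof.
move=> Wg WW [LY hY] [LZ hZ]; split=> [|c]; first exact: LieD.
have [Ay ey] := Lie_uexp AV (LieZ c Ac Ag LY).
have [Az ez] := Lie_uexp AV (LieZ c Ac Ag LZ).
have [z Az' [zE Wz]] := upper_central_add Ay Az.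
have -> : uexp (c *: (Y + Z)) = z.
  by rewrite scalerDr -ey -ez -zE ulogK //; apply: AV.
have -> : z = (uexp (c *: Y) * uexp (c *: Z) * ((uexp (c *: Z))^-1 * (uexp (c *: Y))^-1 * z))%g.
  by rewrite !mulgA mulgK mulgV mul1g.
apply: (subgroupM Wg); last exact: WW.
exact: (subgroupM Wg (hY c) (hZ c)).
Qed.

Lemma absorbedZ W a Y : absorbed W Y -> absorbed W (a *: Y).
Proof. by move=> [LY hY]; split=> [|c]; [apply: LieZ|rewrite scalerA]. Qed.

Lemma absorbed0 W : is_subgroup W -> absorbed W 0.
Proof.
move=> Wg; split=> [|c]; first by exists 1%g; [apply: subgroup1|rewrite ulog1].
by rewrite scaler0 uexp0; apply: subgroup1.
Qed.

Definition between W := [/\ normal_in V W, W0 `<=` W & W `<=` A].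

Lemma good_oneparam1 e : good_param e -> oneparam V e.
Proof. by move=> /good_oneparam []. Qed.

(** The one-parameter subgroups of the root vectors in Y are adjoined one at a time; each is central
    modulo W because A is central in V modulo W0. *)
Lemma absorb Y W : Lie A Y -> between W ->
  exists W', [/\ reach V good_param W W', between W', W `<=` W' & absorbed W' Y].
Proof.
move=> /(Lie_rootsum Ac Ag (@upper_central_stable r.+1)) rs.
elim: rs W => {Y} [W Wb|Y Z rY rZ IH W [Wn W0W WA]].
  exists W; split=> //; first exact: reach_refl.
  by have [[Wg _ _] _ _] := Wb; apply: absorbed0.
have [x Ax [eY tg]] := rootvec_gmor Ac rY; have Vx := AV Ax.
have Pe : good_param (upow x) by split=> //; exists x.
have he := good_oneparam1 Pe; have [Wg WV _] := Wn.
have cent : central_mod V W (upow x).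
  by move=> v c Vv; apply: W0W; have [_ ] := upow_closed c Ac Ag Ax; apply.
have W1n := ext_normal Xgrp Wn he cent; have [W1g _ _] := W1n.
have sW1 := @sub_ext _ _ _ W (upow x) he.
have [|W' [re W'b W1W' abZ]] := IH (ext W (upow x)).
  split=> //; first exact: subset_trans sW1.
  move=> _ [w [c [Ww ->]]]; apply: (subgroupM Ag); first exact: WA.
  exact: upow_closed.
exists W'; split=> //; first exact: reach_step Pe cent re.
  exact: subset_trans W1W'.
have [[W'g _ _] W0W' _] := W'b; apply: absorbedD => //.
split=> [|c]; first by exists x.
apply: W1W'; exists 1%g, c; split; first exact: subgroup1.
by rewrite mul1g eY uexp_scale.
Qed.

(** Lie A is spanned by finitely many rows of B; absorbing them absorbs all logarithms of A, and so
    A itself. *)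
Lemma reach_upper_central : reach V good_param W0 A.
Proof.
pose S : set 'rV[C]_(n * n) := [set v | Lie A (vec_mx v)].
have [B BE] : exists B : 'M[C]_(n * n), forall v, S v <-> (v <= B)%MS.
  apply: linear_set_mx => [|a u v Su Sv].
    by rewrite /S /= raddf0; exists 1%g; [apply: subgroup1|rewrite ulog1].
  by rewrite /S /= linearP; apply: LieD => //; apply: LieZ.
have Lrow i : Lie A (vec_mx (row i B)) by have : S (row i B) by apply/BE/row_sub.
have W0b : between W0.
  by split=> //; [apply: upper_central_normal|apply: upper_central_step].
have [W' [re W'b _ abs]] : exists W', [/\ reach V good_param W0 W', between W', W0 `<=` W' &
    forall i, i \in enum 'I_(n * n) -> absorbed W' (vec_mx (row i B))].
  elim: (enum _) => [|i l [W1 [re1 W1b W01 abs1]]].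
    by exists W0; split=> //; apply: reach_refl.
  have [W2 [re2 W2b W12 abs2]] := absorb (Lrow i) W1b.
  exists W2; split=> //; first exact: reach_trans re1 re2.
    exact: subset_trans W12.
  move=> j; rewrite inE => /orP[/eqP -> //|/abs1 [Lj hj]].
  by split=> // c; apply/W12/hj.
have [[W'g _ _] W0W' W'A] := W'b.
suff <- : W' = A by [].
apply/seteqP; split=> // x Ax; have Vx := AV Ax.
have : S (mxvec (ulog x)) by rewrite /S /= mxvecK; exists x.
move=> /BE /submxP [a aE].
have [_ /(_ 1)] : absorbed W' (ulog x); last by rewrite scale1r ulogK.
rewrite -[ulog x]mxvecK aE mulmx_sum_row linear_sum.
apply: (big_ind (absorbed W')) => [|Y Z|i _]; first exact: absorbed0.
  exact: absorbedD.
by rewrite linearZ /=; apply: absorbedZ; apply: abs; rewrite mem_enum.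
Qed.

End Absorb.

Lemma reach_all : reach V good_param [set 1%g] V.
Proof.
rewrite -[X in reach _ _ _ X]upper_central_top.
elim: n => [|r IHr]; first exact: reach_refl.
exact: reach_trans IHr (reach_upper_central r).
Qed.

(** A difference under w turns the entries of [f v * Q] into those of [f v * (f w - 1) * Q], which
    lowers the flag one step further; after n differences nothing is left. *)
Lemma regular_degree a : regular X a -> exists q, degree_lt V q a.
Proof.
have [W [W0 WS Wn filt0 filt1]] := flag_exists.
have dmx q b (Q : 'M[C]_n) i j : flagfilt W b Q -> (n <= b + q)%N ->
    degree_lt V q (fun v => (f v * Q) i j).
  elim: q b Q => [|q IHq] b Q hQ le.
    rewrite addn0 in le; move=> v Vv; suff -> : Q = 0 by rewrite mulr0 mxE.
    apply: (flagfilt_top W0 Wn); rewrite -(subnKC le) in hQ.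
    elim: (b - n)%N hQ => [|k IHk]; first by rewrite addn0.
    by rewrite addnS => /(flagfiltW WS).
  move=> w Vw; apply: (degree_lt_ext Xgrp _ (IHq b.+1 ((f w - 1) * Q) _ _)) => [v Vv||].
  - by rewrite /rdiff fM // mulrBl mul1r mulrBr mulrA !mxE.
  - by rewrite -[b.+1]add1n; apply: flagfiltM => //; apply: filt1.
  - by rewrite addSnnS.
have fdeg i j : degree_lt V n (fun v => f v i j).
  apply: (degree_lt_ext Xgrp _ (dmx n 0%N 1 i j (@flagfilt1 _ _ W) _)) => // v Vv.
  by rewrite mulr1.
pose K : set (G -> C) := [set h | exists q, degree_lt V q h].
have Kalg : fun_algebra V K.
  split=> [c|h k [q hq] [p kp]|h k [q hq] [p kp]|h k hk [q hq]].
  - by exists 1%N; apply: degree_lt_const.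
  - exists (q + p)%N; apply: degree_ltD => //.
      exact: degree_lt_le (leq_addr _ _) hq.
    exact: degree_lt_le (leq_addl _ _) kp.
  - by exists (q + p)%N; apply: degree_ltM.
  - by exists q; apply: degree_lt_ext hq.
move=> /Xpoly [p pE]; have [_ _ _ Kext] := Kalg.
apply: (Kext (fun v => p.@[fun k => mxvec (f v) 0 k])) => [v Vv|].
  by rewrite pE.
apply: (fun_algebra_meval p Kalg) => k; case/mxvec_indexP: k => i j.
by exists n; apply: degree_lt_ext (fdeg i j) => // v Vv; rewrite mxvecE.
Qed.

Lemma normal1 : normal_in V [set 1%g].
Proof. exact: (upper_central_normal 0). Qed.

Lemma separates_inj (B : set (G -> C)) : (forall v v', V v -> V v' ->
  (forall b, B b -> b v = b v') -> v = v') -> separates V B [set 1%g].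
Proof.
move=> h v v' Vv Vv' e; have -> : v = v'; last by rewrite /= mulVg.
apply: h => // b Bb; apply: e; split=> // u w Vu ->; by rewrite mulg1.
Qed.

Theorem theta_gmor : gmor FG V (regular X) theta.
Proof.
have [|||psi psig psiE] := extend_along_reach Xgrp (A := regular X) (theta := theta)
  (Mor := gmor FG V (regular X)) transl_regular good_oneparam regular_degree thetaM _ reach_all
  normal1 _ _.
- move=> e s psi Pe sreg psig; have [[x Vx ee] thg] := Pe; have [[eV _] _] := good_oneparam Pe.
  have esg : gmor FG V (regular X) (fun v => e (s v)).
    by apply: gmor_comp_poly => //; rewrite ee; exact/curve_gmor/upow_curve.
  apply: (gmorM hG Xalg); last exact: (gmor_comp_poly Xalg thg).
  have mg : gmor FG V (regular X) (fun v => v * (e (s v))^-1)%g.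
    by apply: (gmorF hG Xalg) => //; apply: gmor_id.
  have mV v : V v -> V (v * (e (s v))^-1)%g by move=> Vv; apply: VM => //; apply: VV.
  apply: (gmor_comp mV _ psig) => h hreg.
  exact: (gmor_regular Xalg Xe mg mV hreg).
- apply: separates_inj => v v' Vv Vv' e; apply: (coord_inj Vv Vv'); apply/rowP => j.
  by apply: (e (fun x => coord X x 0 j)); apply: regular_coord.
- exists (fun=> 1%g); first exact: (gmor_const hG Xalg).
  by move=> _ ->; rewrite theta1.
exact: gmor_ext Xalg _ _ psiE psig.
Qed.

(* The regular functions on V that are polynomial in theta form a translation
   invariant algebra that separates points, hence contain every regular function. *)
Theorem regular_theta k h : injective theta -> gmor_at FG V (regular X) theta k ->
  regular X h ->
  exists p : {mpoly C[vdim (FG k)]}, forall v, V v -> h v = p.@[coord (FG k) (theta v) 0].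
Proof.
move=> tinj tk hreg; have [tV treg] := tk.
pose B : set (G -> C) := [set b | exists p : {mpoly C[vdim (FG k)]},
  forall v, V v -> b v = p.@[coord (FG k) (theta v) 0]].
have Balg : fun_algebra V B.
  split=> [c|a b [p pE] [q qE]|a b [p pE] [q qE]|a b ab [p pE]].
  - by exists c%:MP => x _; rewrite mevalC.
  - by exists (p + q) => x Vx; rewrite mevalD pE ?qE.
  - by exists (p * q) => x Vx; rewrite mevalM pE ?qE.
  - by exists p => x Vx; rewrite -ab ?pE.
have Bt : transl_algebra V B.
  split=> // b w [p pE] Vw; have [_ _ _ Bext] := Balg.
  have Btheta : gmor FG V B theta.
    by exists k; split=> // j; exists 'X_j => v _; rewrite mevalXU.
  (* Translation by w becomes multiplication by [theta w]. The product may be computed in a larger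
     member of the filtration, but its values stay in [FG k], where [gmor_regular] expresses the
     coordinates. *)
  have Bw : gmor FG V B (fun v => theta (v * w)%g).
    apply: (gmor_ext Balg _ (gmorM hG Balg Btheta (gmor_const hG Balg (theta w)))) => v Vv.
    by rewrite thetaM.
  apply: (Bext (fun v => p.@[fun j => coord (FG k) (theta (v * w)%g) 0 j])) => [v Vv|].
    by rewrite pE //; apply: VM.
  apply: (fun_algebra_meval p Balg) => j.
  have FGe : embedded FG (FG k) by exists k; apply: closed_subvariety_refl.
  have twV v : V v -> pts (FG k) (theta (v * w)%g) by move=> Vv; apply: tV; apply: VM.
  exact: (gmor_regular Balg FGe Bw twV (@regular_coord _ _ (FG k) j)).
have BA : B `<=` regular X.
  move=> b [p pE]; have [_ _ _ ext] := Xalg.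
  apply: (ext (fun v => p.@[fun j => coord (FG k) (theta v) 0 j])) => [v Vv|].
    by rewrite pE.
  exact: (fun_algebra_meval p Xalg).
have sep : separates V B [set 1%g].
  apply: separates_inj => v v' Vv Vv' e; apply: tinj.
  apply: (coord_inj (tV _ Vv) (tV _ Vv')); apply/rowP => j.
  apply: (e (fun x => coord (FG k) (theta x) 0 j)).
  by exists 'X_j => x _; rewrite mevalXU.
apply: (separating_subalgebra Xgrp transl_regular good_oneparam regular_degree Bt BA
  reach_all normal1 sep); split=> // v w Vv ->; by rewrite mulg1.
Qed.

End Extension.

End Torus.

End UnipotentGroup.

(** * Ind-structures *)

Section Representations.
Variables (R : realType) (G : groupType).
Notation C := (R[i]).
Implicit Types (X Y : affineVariety R G).

Definition unipotent_rep X n (f : G -> 'M[C]_n) (g : 'M[C]_n -> G) :=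
  [/\ forall x y, pts X x -> pts X y -> f (x * y)%g = f x * f y,
      forall x, pts X x -> exists k, (f x - 1) ^+ k = 0,
      forall i j, regular X (fun x => f x i j),
      forall x, pts X x -> g (f x) = x &
      forall h, regular X h ->
        exists p : {mpoly C[n * n]}, forall x, pts X x -> h x = p.@[mxvec (f x) 0]].

Lemma unipotent_rep_sub X Y n (f : G -> 'M[C]_n) g : closed_subvariety Y X ->
  unipotent_rep X f g -> unipotent_rep Y f g.
Proof.
move=> YX [fM fnil freg fK Xpoly]; have sub := closed_subvariety_sub YX; split.
- by move=> x y /sub Xx /sub Xy; apply: fM.
- by move=> x /sub Xx; apply: fnil.
- by move=> i j; apply: closed_subvariety_regular YX _.
- by move=> x /sub Xx; apply: fK.
- move=> h hreg; have [p pE] := closed_subvariety_extend YX hreg.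
  have [|q qE] := Xpoly (fun x => p.@[coord X x 0]); first by exists p.
  by exists q => x Yx; rewrite pE // qE //; apply: sub.
Qed.

Lemma GL_coord_entry n (A : 'M[C]_n) i j :
  coord (GL_variety R n) A 0 (lshift 1 (mxvec_index i j)) = A i j.
Proof. by rewrite /= row_mxEl mxvecE. Qed.

Lemma unipotent_rep_exists X : unipotent_algebraic_group X ->
  exists n (f : G -> 'M[C]_n) g, unipotent_rep X f g.
Proof.
move=> [_ [n [Y [f [YGL [/var_morphism_regular [fXY freg] [g [/var_morphism_regular [gYX greg] gf _]]] fM fnil]]]]].
have Xalg := regular_algebra X; have Yalg := regular_algebra Y.
exists n, f, g; split=> //.
  move=> i j; apply: (fun_algebra_regular Xalg fXY freg (h := fun A : 'M[C]_n => A i j)).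
  apply: closed_subvariety_regular YGL _.
  exists ('X_(lshift 1 (mxvec_index i j))) => A _.
  by rewrite mevalXU GL_coord_entry.
move=> h hreg; have hg := fun_algebra_regular Yalg gYX greg hreg.
have [p pE] := closed_subvariety_extend YGL hg.
(* The last coordinate of the general linear group is the inverse determinant, which is 1 on
   unipotent matrices. *)
pose s := [tuple (match fintype.split k with inl a => 'X_a | inr _ => 1 end : {mpoly C[n * n]}) | k < n * n + 1].
exists (p \mPo s) => x Xx; rewrite -{1}(gf _ Xx) pE; last exact: fXY.
rewrite comp_mpoly_meval; apply: meval_eq => k; rewrite tnth_mktuple mxE.
case: fintype.split => a; first by rewrite mevalXU.
have [m hm] := fnil _ Xx.
by rewrite meval1 ord1 mxE (unipotent_det hm) invr1 eqxx mulr1n.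
Qed.

Variable FG : indVariety R G.
Hypothesis hG : ind_group setT FG.

Lemma regular_fst X Y h : regular X h -> regular (prod_variety X Y) (fun z : G * G => h z.1).
Proof.
move=> [p pE]; exists (mpoly_l _ p) => z [Xz _].
by rewrite mpoly_lE row_mxKl pE.
Qed.

Lemma regular_snd X Y h : regular Y h -> regular (prod_variety X Y) (fun z : G * G => h z.2).
Proof.
move=> [p pE]; exists (mpoly_r _ p) => z [_ Yz].
by rewrite mpoly_rE row_mxKr pE.
Qed.

Lemma embedded_algebraic_group X : embedded FG X -> is_subgroup (pts X) -> algebraic_group X.
Proof.
move=> Xe Xg; split=> //; apply/var_morphism_regular; split.
  by move=> [x y] [Xx Xy] /=; have [_] := Xg; apply.
move=> j; have Palg := regular_algebra (prod_variety X X).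
have dm : gmor FG (pts (prod_variety X X)) (regular (prod_variety X X)) (fun z => z.1 * z.2^-1)%g.
  have idg := gmor_id Xe; apply: (gmorF hG Palg).
    by apply: (gmor_comp (X := X) _ _ idg) => [z [] //|h]; apply: regular_fst.
  by apply: (gmor_comp (X := X) _ _ idg) => [z [] //|h]; apply: regular_snd.
have dX (z : G * G) : pts (prod_variety X X) z -> pts X (z.1 * z.2^-1)%g.
  by move: z => [x y] [Xx Xy] /=; have [_] := Xg; apply.
exact: (gmor_regular Palg Xe dm dX (@regular_coord _ _ X j)).
Qed.

Lemma unipotent_rep_group X n (f : G -> 'M[C]_n) g : embedded FG X -> is_subgroup (pts X) ->
  unipotent_rep X f g -> unipotent_algebraic_group X.
Proof.
move=> Xe Xg [fM fnil freg fK Xpoly]; split; first exact: embedded_algebraic_group.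
have Xalg := regular_algebra X; have [Xc _ _ Xext] := Xalg.
have fdet x : pts X x -> \det (f x) = 1.
  by move=> /fnil [k hk]; apply: unipotent_det hk.
have cGL j : regular X (fun x => coord (GL_variety R n) (f x) 0 j).
  have [k|k] := split_ordP j => ->.
    have [a b] := mxvec_indexP k; apply: Xext (freg a b) => x _.
    by rewrite GL_coord_entry.
  apply: Xext (Xc 1) => x Xx.
  by rewrite /= row_mxEr ord1 mxE (fdet _ Xx) invr1 eqxx.
have polyGL h : regular X h -> exists p : {mpoly C[n * n + 1]}, forall x, pts X x ->
    h x = p.@[coord (GL_variety R n) (f x) 0].
  move=> /Xpoly [p pE]; exists (mpoly_l _ p) => x Xx.
  by rewrite mpoly_lE row_mxKl pE.
have Yc : var_closed (GL_variety R n) (f @` pts X).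
  split=> [_ [x Xx <-]|]; first by rewrite /= unitmxE (fdet _ Xx) unitr1.
  rewrite image_comp; apply: zariski_closed_image (var_closed_pts X) cGL _ => i.
  exact/polyGL/regular_coord.
exists n, (restrict_variety Yc), f; split=> //; first exact: restrict_closed_subvariety.
split; first by apply/var_morphism_regular; split=> // x Xx; exists x.
exists g; split=> //; last by move=> _ [x Xx <-]; rewrite fK.
apply/var_morphism_regular; split=> [_ [x Xx <-]|j]; first by rewrite fK.
have [p pE] := polyGL _ (regular_coord (X := X) j).
by exists p => _ [x Xx <-]; rewrite fK // pE.
Qed.

Lemma var_morphism_comp (T1 T2 T3 : Type) (X1 : affineVariety R T1) (X2 : affineVariety R T2)
    (X3 : affineVariety R T3) f1 f2 :
  var_morphism X1 X2 f1 -> var_morphism X2 X3 f2 -> var_morphism X1 X3 (f2 \o f1).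
Proof.
move=> /var_morphism_regular [m1 r1] /var_morphism_regular [m2 r2].
apply/var_morphism_regular; split=> [x X1x|j]; first by apply/m2/m1.
exact: (fun_algebra_regular (regular_algebra X1) m1 r1 (r2 j)).
Qed.

Lemma ind_morphism_comp (T1 T2 T3 : Type) (V1 : indVariety R T1) (V2 : indVariety R T2)
    (V3 : indVariety R T3) f1 f2 :
  ind_morphism V1 V2 f1 -> ind_morphism V2 V3 f2 -> ind_morphism V1 V3 (f2 \o f1).
Proof.
move=> m1 m2 i; have [j hj] := m1 i; have [k hk] := m2 j.
by exists k; apply: var_morphism_comp hj hk.
Qed.

(** [F' i] lies in some [F j], which in turn maps into a later [F' k]. A coordinate of [F' i]
    extends to [F' k], is pulled back to [F j], and extends from there to a member of [FG]. *)
Lemma same_structure_embedded (F F' : indVariety R G) : (forall k, embedded FG (F k)) ->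
  same_ind_structure F F' -> forall k, embedded FG (F' k).
Proof.
move=> Fe [_ FF' F'F] i; have [j /var_morphism_regular [ijpts ijreg]] := F'F i.
have [k0 jk0] := FF' j; pose k := maxn i k0.
have /var_morphism_regular [jkpts jkreg] : var_morphism (F j) (F' k) id.
  have [[_ _] m _] := filt_le F' (leq_maxr i k0); exact: var_morphism_comp jk0 m.
have ik := filt_le F' (leq_maxl i k0); have [l jl] := Fe j.
exists l; apply: closed_subvariety_crit.
- by move=> x /ijpts; apply: (closed_subvariety_sub jl).
- move=> a; apply: (fun_algebra_regular (regular_algebra _) ijpts ijreg
    (h := fun x => coord (FG l) x 0 a)).
  by apply: closed_subvariety_regular jl _; apply: regular_coord.
- move=> a; have [p pE] := closed_subvariety_extend ik (regular_coord a).
  have pr : regular (F j) (fun x => p.@[coord (F' k) x 0]).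
    exact: fun_algebra_meval (regular_algebra _) _.
  have [q qE] := closed_subvariety_extend jl pr.
  by exists q => x Fx; rewrite pE // qE //; apply: ijpts.
Qed.

End Representations.

(** * Transport of a variety along a bijection *)

Section Image.
Variables (R : realType) (T : Type) (X : affineVariety R T) (f g : T -> T).
Hypotheses (fK : cancel f g) (gK : cancel g f).
Notation C := (R[i]).

Lemma image_coord_inj x y : (f @` pts X) x -> (f @` pts X) y ->
  coord X (g x) = coord X (g y) -> x = y.
Proof.
move=> [u Xu <-] [v Xv <-]; rewrite !fK => e; congr f; exact: coord_inj Xu Xv e.
Qed.

Lemma image_coord_closed : zariski_closed ((coord X \o g) @` (f @` pts X)).
Proof.
rewrite image_comp; have -> : (coord X \o g) \o f = coord X.
  by apply/funext => x /=; rewrite fK.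
exact: coord_closed.
Qed.

(** With this structure f is an isomorphism by construction; the substance lies in comparing it with
    the structure induced from an ambient ind-group. *)
Definition image_variety : affineVariety R T := AffineVariety image_coord_inj image_coord_closed.

Lemma regular_image h : regular image_variety h <-> regular X (fun x => h (f x)).
Proof.
split=> - [p pE]; exists p; first by move=> x Xx; rewrite pE /= ?fK //; exists x.
by move=> _ [x Xx <-]; rewrite pE //= fK.
Qed.

Lemma image_morphism : var_morphism X image_variety f.
Proof.
apply/var_morphism_regular; split=> [x Xx|j]; first by exists x.
exact/(regular_image (fun y => coord image_variety y 0 j))/regular_coord.
Qed.

Lemma image_morphism_inv : var_morphism image_variety X g.
Proof.
apply/var_morphism_regular; split=> [_ [x Xx <-]|j]; first by rewrite fK.
exact: (@regular_coord _ _ image_variety j).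
Qed.

End Image.

Lemma image_closed_subvariety (R : realType) (T : Type) (X Y : affineVariety R T) (f g : T -> T)
    (fK : cancel f g) : closed_subvariety X Y ->
  closed_subvariety (image_variety X fK) (image_variety Y fK).
Proof.
move=> XY; apply: closed_subvariety_crit.
- by move=> _ [x /(closed_subvariety_sub XY) Yx <-]; exists x.
- move=> j; apply/regular_image; apply: closed_subvariety_regular XY _.
  exact/(regular_image _ fK (fun y => coord (image_variety Y fK) y 0 j))/regular_coord.
- move=> i; have [p pE] := closed_subvariety_extend XY (@regular_coord _ _ X i).
  by exists p => _ [x Xx <-]; rewrite /= !fK pE.
Qed.

(** * One-parameter subgroups generating a torus *)

Section TorusCocharacters.
Variables (R : realType) (G : groupType) (FG : indVariety R G) (T : set G).
Hypothesis hT : closed_torus FG T.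
Notation C := (R[i]).

Lemma torus_cocharacters : exists d (lam : 'I_d -> C -> G),
  [/\ forall i, gmor FG [set z : C | z != 0] (@laurent C) (lam i),
      forall i (z w : C), z != 0 -> w != 0 -> lam i (z * w) = (lam i z * lam i w)%g,
      forall i j (z w : C), z != 0 -> w != 0 -> (lam i z * lam j w)%g = (lam j w * lam i z)%g,
      forall i (z : C), z != 0 -> T (lam i z) &
      forall x, (forall i (z : C), z != 0 -> (lam i z * x * (lam i z)^-1)%g = x) ->
        forall t, T t -> (t * x * t^-1)%g = x].
Proof.
have [XT [[Tgrp _ XTE [i0 XTF]] [d [f [[/var_morphism_regular [fm freg]
  [g [/var_morphism_regular [gm greg] fK gK]]] fM]]]]] := hT.
have TM := subgroupM Tgrp.
have T_eq x y : T x -> T y -> (forall i, f x 0 i = f y 0 i) -> x = y.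
  rewrite -XTE => Tx Ty e; rewrite -(fK x Tx) -(fK y Ty); congr g.
  by apply/rowP.
have gT (v : 'rV[C]_d) : (forall i, v 0 i != 0) -> T (g v) by rewrite -XTE; apply: gm.
have fg (v : 'rV[C]_d) : (forall i, v 0 i != 0) -> f (g v) = v by apply: gK.
pose e i (z : C) : 'rV[C]_d := \row_j (if j == i then z else 1).
have e0 i (z : C) : z != 0 -> forall j, e i z 0 j != 0.
  by move=> z0 j; rewrite mxE; case: ifP => // _; apply: oner_neq0.
exists d, (fun i z => g (e i z)); split.
- move=> i; exists i0; have La := @laurent_algebra C; have [Lc _ _ Lext] := La.
  split=> [z z0|j].
    by apply: (closed_subvariety_sub XTF); rewrite XTE; apply/gT/e0.
  have : regular XT (fun x => coord (FG i0) x 0 j).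
    by apply: closed_subvariety_regular XTF _; apply: regular_coord.
  move=> /(fun_algebra_regular (regular_algebra (torus_variety R d)) gm greg) hreg.
  apply: (fun_algebra_regular La (X := torus_variety R d) (phi := e i) _ _ hreg) => [z z0|k].
    exact: e0.
  have [l|l] := split_ordP k => ->.
    have [->|li] := eqVneq l i.
      by apply: Lext (laurent_id C) => z _; rewrite row_mxEl mxE eqxx.
    by apply: Lext (Lc 1) => z _; rewrite row_mxEl mxE (negPf li).
  have [->|li] := eqVneq l i.
    by apply: Lext (laurent_inv C) => z _; rewrite row_mxEr !mxE eqxx.
  by apply: Lext (Lc 1) => z _; rewrite row_mxEr !mxE (negPf li) invr1.
- move=> i z w z0 w0; have zw0 : z * w != 0 by rewrite mulf_neq0.
  have [Tz Tw] := (gT _ (e0 i z z0), gT _ (e0 i w w0)).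
  apply: T_eq => [||j]; [exact/gT/e0|exact: TM|].
  rewrite (fM _ _ Tz Tw) !fg; try exact: e0.
  by rewrite !mxE; case: ifP; rewrite ?mulr1.
- move=> i j z w z0 w0; have [Tz Tw] := (gT _ (e0 i z z0), gT _ (e0 j w w0)).
  apply: T_eq => [||l]; [exact: TM|exact: TM|].
  by rewrite (fM _ _ Tz Tw) (fM _ _ Tw Tz) mulrC.
- by move=> i z z0; apply/gT/e0.
move=> x hx t Tt; pose v := f t.
have v0 i : v 0 i != 0 by apply: fm; rewrite XTE.
(* The first m coordinates of t, completed by 1; t is reached by multiplying in one cocharacter
   value at a time. *)
pose u m : 'rV[C]_d := \row_j (if (j < m)%N then v 0 j else 1).
have u0 m j : u m 0 j != 0 by rewrite mxE; case: ifP => // _; apply: oner_neq0.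
have -> : t = g (u d).
  apply: T_eq => // [|i]; first exact/gT/u0.
  rewrite fg; last exact: u0.
  by rewrite mxE ltn_ord.
suff H m : (m <= d)%N -> (g (u m) * x * (g (u m))^-1)%g = x by apply: H.
elim: m => [|m IHm] md.
  have T1 := subgroup1 Tgrp; have f11 i : f 1%g 0 i = 1.
    have f0 : f 1%g 0 i != 0 by apply: fm; rewrite XTE.
    by apply: (mulfI f0); rewrite -(fM _ _ T1 T1) !mulg1 mulr1.
  have -> : g (u 0%N) = 1%g; last by rewrite mul1g invg1 mulg1.
  apply: T_eq => // [|i]; first exact/gT/u0.
  by rewrite f11 fg ?mxE.
pose i := Ordinal md.
have -> : g (u m.+1) = (g (u m) * g (e i (v 0 i)))%g.
  have [Ta Tb] := (gT _ (u0 m), gT _ (e0 i _ (v0 i))).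
  apply: T_eq => [||j]; [exact/gT/u0|exact: TM|].
  rewrite (fM _ _ Ta Tb) !fg //; last exact: e0.
  rewrite !mxE ltnS leq_eqVlt -val_eqE /=.
  have [jm|_] := eqVneq (j : nat) m; last by rewrite mulr1.
  rewrite jm ltnn mul1r; congr (v 0 _); exact: val_inj.
rewrite invgM !mulgA -[(g (u m) * _ * x * _)%g]mulgA -[(_ * _ * (x * _))%g]mulgA.
have -> : (g (e i (v 0%R i)) * (x * (g (e i (v 0%R i)))^-1) = x)%g by rewrite mulgA hx.
exact: IHm (ltnW md).
Qed.

End TorusCocharacters.

(** * Torus-stable filtrations of a normalized ind-subgroup *)

Section InvariantFiltration.
Variables (R : realType) (G : groupType) (FG : indVariety R G).
Hypothesis hG : ind_group setT FG.
Notation C := (R[i]).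

Lemma conj_gmor X t : embedded FG X -> gmor FG (pts X) (regular X) (fun x => t * x * t^-1)%g.
Proof.
move=> Xe; have Xalg := regular_algebra X; have cg y := gmor_const hG Xalg y.
by apply: (gmorM hG Xalg) => //; apply: (gmorM hG Xalg) => //; apply: gmor_id.
Qed.

Variables (T U : set G) (F : indVariety R G).
Hypothesis hT : closed_torus FG T.
Hypothesis Fe : forall k, embedded FG (F k).
Hypothesis Fgrp : forall k, is_subgroup (pts (F k)).
Hypothesis FU : ind_pts F = U.
Hypothesis UT : forall t u, T t -> U u -> U (t * u * t^-1)%g.

Let Tgrp : is_subgroup T. Proof. by have [X [[]]] := hT. Qed.

Definition conj_core k : set G :=
  [set v | pts (F k) v /\ forall t : {t | T t}, pts (F k) (sval t * v * (sval t)^-1)%g].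

Lemma conj_core_closed k : var_closed (F k) (conj_core k).
Proof.
have -> : conj_core k = [set v | pts (F k) v /\ forall t : {t | T t},
    [set v | pts (F k) v /\ pts (F k) (sval t * v * (sval t)^-1)%g] v].
  apply/seteqP; split=> v [/= Fv hv]; split=> // t /=.
  exact: (proj2 (hv t)).
apply: var_closed_bigcap => -[t Tt] /=.
exact: (closed_preimage (Fe k) (var_closed_pts (F k)) (conj_gmor t (Fe k))).
Qed.

Definition core_variety k : affineVariety R G := restrict_variety (conj_core_closed k).

Lemma core_closed_subvariety k : closed_subvariety (core_variety k) (F k).
Proof. exact: restrict_closed_subvariety. Qed.

Lemma core_filtS k : closed_subvariety (core_variety k) (core_variety k.+1).
Proof.
have cF := closed_subvariety_trans (core_closed_subvariety k) (filtS F k).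
have sub := closed_subvariety_sub (filtS F k).
apply: closed_subvariety_crit.
- by move=> v [Fv hv]; split=> [|t]; apply: sub.
- by move=> j; apply: (closed_subvariety_regular cF (@regular_coord _ _ (F k.+1) j)).
- by move=> i; have := closed_subvariety_extend cF (@regular_coord _ _ (core_variety k) i).
Qed.

Definition core_ind : indVariety R G := IndVariety core_filtS.

Lemma core_embedded k : embedded FG (core_ind k).
Proof. exact: embedded_sub (core_closed_subvariety k) (Fe k). Qed.

Lemma core_subgroup k : is_subgroup (pts (core_ind k)).
Proof.
have [F1 FD] := Fgrp k; split.
  by split=> // t; rewrite mulg1 mulgV.
move=> x y [Fx hx] [Fy hy]; split=> [|t]; first exact: FD.
have := FD _ _ (hx t) (hy t).
by rewrite !invgM !invgK !mulgA mulgVK.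
Qed.

Lemma core_stable k t v : T t -> pts (core_ind k) v -> pts (core_ind k) (t * v * t^-1)%g.
Proof.
move=> Tt [Fv hv]; split=> [|[s Ts] /=]; first exact: (hv (exist _ t Tt)).
have := hv (exist _ (s * t)%g (subgroupM Tgrp Ts Tt)).
by rewrite /= invgM !mulgA.
Qed.

(** For a fixed u the sets of t in T whose conjugate of u lies in [F k] are closed, increasing in k
    and cover T, so one k serves all t. *)
Lemma core_pts : ind_pts core_ind = U.
Proof.
rewrite -FU; apply/seteqP; split=> [v [k _ [Fv _]]|u Uu]; first by exists k.
have [XT [[_ _ XTE XTe] _]] := hT.
have XTe' : embedded FG XT by [].
have cg : gmor FG (pts XT) (regular XT) (fun t => t * u * t^-1)%g.
  have Xalg := regular_algebra XT; have idg := gmor_id XTe'.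
  apply: (gmorF hG Xalg) => //; apply: (gmorM hG Xalg) => //.
  exact: (gmor_const hG Xalg).
have [k|k t [Tt Ft]|t Tt|k kP] := @var_baire _ _ XT (fun k => [set t | pts XT t /\ pts (F k) (t * u * t^-1)%g]).
- exact: closed_preimage (Fe k) (var_closed_pts (F k)) cg.
- by split=> //; apply: (closed_subvariety_sub (filtS F k)).
- have : U (t * u * t^-1)%g by apply: UT; rewrite -?XTE // -FU.
  by rewrite -FU => -[k _ Fk]; exists k.
have T1 : pts XT 1%g by rewrite XTE; apply: subgroup1.
exists k => //; split=> [|[t Tt] /=].
  by have [_] := kP _ T1; rewrite mul1g invg1 mulg1.
by have [|_] := kP t; rewrite ?XTE.
Qed.

End InvariantFiltration.

Theorem mainTheorem1 (R : realType) (G : groupType) (FG : indVariety R G)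
    (hG : ind_group setT FG)
    (T : set G) (hT : closed_torus FG T)
    (theta : G -> G) (theta_bij : bijective theta)
    (thetaM : forall x y, theta (x * y)%g = (theta x * theta y)%g)
    (theta_T : forall t, T t -> theta t = t)
    (U : set G) (hU : unipotent_ind_subgroup FG U)
    (U_norm : forall t u, T t -> U u -> U (t * u * t^-1)%g)
    (U_fix : forall u, U u -> (forall t, T t -> (t * u * t^-1)%g = u) ->
             u = 1%g) :
  unipotent_ind_subgroup FG (theta @` U) /\
  forall FU FV : indVariety R G,
    ind_subgroup_structure FG U FU ->
    ind_subgroup_structure FG (theta @` U) FV ->
    ind_group_isomorphism FU FV theta.
Proof.
have [theta' thK thK'] := theta_bij.
have [FH [[[Ugrp FHU _] FHe] [_ [F [FHF Funip]]]]] := hU.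
have Fe := same_structure_embedded FHe FHF.
have FU0 : ind_pts F = U by have [<-] := FHF.
have Fgrp k : is_subgroup (pts (F k)) by have [[]] := Funip k.
pose V := core_ind hG T Fe.
have Ve k : embedded FG (V k) := core_embedded hG T Fe k.
have Vgrp k : is_subgroup (pts (V k)) := core_subgroup hG T Fe Fgrp k.
have VU : ind_pts V = U := core_pts hG hT Fe FU0 U_norm.
have [d [lam [lam_g lamM lamC lamT lam_fix]]] := torus_cocharacters hT.
have Vrep k : exists n (f : G -> 'M[R[i]]_n) g, unipotent_rep (V k) f g.
  have [n [f [g rep]]] := unipotent_rep_exists (Funip k); exists n, f, g.
  exact: unipotent_rep_sub (core_closed_subvariety hG T Fe k) rep.
pose W : indVariety R G := IndVariety (fun k => image_closed_subvariety thK (filtS V k)).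
have theta1 : theta 1%g = 1%g.
  by apply: (mulgI (theta 1%g)); rewrite -thetaM !mulg1.
have thetaV x : theta x^-1%g = (theta x)^-1%g.
  by apply: (mulgI (theta x)); rewrite -thetaM !mulgV theta1.
(* [theta_gmor] makes the ambient coordinates regular on the source, and [regular_theta] makes the
   source coordinates polynomial in them; together this is the closed embedding. *)
have We k : embedded FG (W k).
  have [n [f [g [fM fnil freg fK Xpoly]]]] := Vrep k.
  have lamV i (z : R[i]) x : z != 0%R -> pts (V k) x -> pts (V k) (lam i z * x * (lam i z)^-1)%g.
    by move=> /lamT Tz; apply: core_stable.
  have lamF x : pts (V k) x ->
      (forall i (z : R[i]), z != 0%R -> (lam i z * x * (lam i z)^-1)%g = x) -> x = 1%g.
    move=> Vx hx; apply: U_fix; first by rewrite -VU; exists k.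
    exact: lam_fix.
  have lamth i (z : R[i]) : z != 0%R -> theta (lam i z) = lam i z by move=> /lamT /theta_T.
  have [l thl] := theta_gmor hG (Ve k) (Vgrp k) fM fnil freg fK Xpoly lam_g lamM lamC lamV lamF
    thetaM lamth.
  have [thV threg] := thl; exists l; apply: closed_subvariety_crit.
  - by move=> _ [x Vx <-]; apply: thV.
  - by move=> j; apply/regular_image/threg.
  - move=> i; have [p pE] := regular_theta hG (Ve k) (Vgrp k) fM fnil freg fK Xpoly lam_g lamM lamC
      lamV lamF thetaM lamth (can_inj thK) thl (@regular_coord _ _ (V k) i).
    by exists p => _ [x Vx <-]; rewrite /= thK pE.
have Wgrp k : is_subgroup (pts (W k)).
  have [V1 VD] := Vgrp k; split; first by exists 1%g.
  move=> _ _ [x Vx <-] [y Vy <-]; exists (x * y^-1)%g; first exact: VD.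
  by rewrite thetaM thetaV.
have WU : ind_pts W = theta @` U.
  rewrite -VU; apply/seteqP; split=> [_ [k _ [x Vx <-]]|_ [x [k _ Vx] <-]].
    by exists x => //; exists k.
  by exists k => //; exists x.
have thUgrp : is_subgroup (theta @` U).
  have [U1 UD] := Ugrp; split; first by exists 1%g.
  move=> _ _ [x Ux <-] [y Uy <-]; exists (x * y^-1)%g; first exact: UD.
  by rewrite thetaM thetaV.
have Wind : ind_group (theta @` U) W.
  by split=> // k; exists k; have [_] := embedded_algebraic_group hG (We k) (Wgrp k).
have VW : ind_morphism V W theta by move=> k; exists k; apply: image_morphism.
have WV : ind_morphism W V theta' by move=> k; exists k; apply: image_morphism_inv.
split.
  exists W; split; first by split.
  split=> //; exists W; split.
    by split=> // k; exists k; have [_] := closed_subvariety_refl (W k).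
  move=> k; have [n [f [g [fM fnil freg fK Xpoly]]]] := Vrep k.
  apply: (@unipotent_rep_group _ _ _ hG _ n (f \o theta') (theta \o g)) => //.
  split=> /=.
  - move=> _ _ [x Vx <-] [y Vy <-]; rewrite -thetaM !thK; exact: fM.
  - by move=> _ [x Vx <-]; rewrite thK; apply: fnil.
  - move=> i j; apply/regular_image.
    have [_ _ _ ext] := regular_algebra (V k); apply: ext (freg i j) => x _.
    by rewrite thK.
  - by move=> _ [x Vx <-]; rewrite thK fK.
  - move=> h /regular_image /Xpoly [p pE]; exists p => _ [x Vx <-].
    by rewrite thK pE.
move=> FU FV [[_ FUU _] FUe] [[_ FVU _] FVe].
(* Any structures of ind-subgroup on U and on its image agree with those of V and W, for which
   [theta] is an isomorphism by construction. *)
have FUV : ind_morphism FU V id by apply: (ind_morphism_id FUe Ve); rewrite FUU VU.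
have VFU : ind_morphism V FU id by apply: (ind_morphism_id Ve FUe); rewrite FUU VU.
have WFV : ind_morphism W FV id by apply: (ind_morphism_id We FVe); rewrite FVU WU.
have FVW : ind_morphism FV W id by apply: (ind_morphism_id FVe We); rewrite FVU WU.
split.
- by move=> x y _ _; apply: thetaM.
- exact: ind_morphism_comp (ind_morphism_comp FUV VW) WFV.
exists theta'; split=> //.
exact: ind_morphism_comp (ind_morphism_comp FVW WV) VFU.
Qed.
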